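(* Let $m\geq 3$ be a prime. Then $$\sum_{n=0}^\infty b_4\left(\frac{mn-1}{8}\right)q^n\in M_{3m-3}(\Gamma_0(256))_m,$$ i.e. there is a holomorphic modular form of weight $3m-3$ on $\Gamma_0(256)$ (trivial character) with integer Fourier coefficients whose $q$-expansion is congruent coefficientwise modulo $m$ to this series.
   Context: $b_4(n)$ is the number of partitions of $n$ with no part divisible by $4$, with $b_4(0)=1$ and $b_4(x)=0$ whenever $x\notin\mathbb{Z}_{\geq 0}$ (in particular when $(mn-1)/8$ is not a nonnegative integer). For a prime $m$, $M_k(\Gamma_0(N),\chi)_m$ denotes the $\mathbb{F}_m$-vector space obtained by reducing modulo $m$ the $q$-expansions of modular forms in $M_k(\Gamma_0(N),\chi)$ with integer coefficients; $q=e^{2\pi i z}$. *)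

(* Defs.v *)
From HB Require Import structures.
From mathcomp Require Import all_boot all_order all_algebra.
From mathcomp Require Import archimedean complex.
From mathcomp Require Import all_classical all_reals all_analysis.

Set Implicit Arguments.
Unset Strict Implicit.
Unset Printing Implicit Defensive.

Import Order.TTheory GRing.Theory Num.Theory.
Import numFieldNormedType.Exports.

Local Open Scope classical_set_scope.
Local Open Scope ring_scope.
Local Open Scope complex_scope.

Definition is_partition (n : nat) (s : seq nat) : bool :=
  [&& sorted geq s, 0%N \notin s & sumn s == n].

Lemma is_partition_size (n : nat) (s : seq nat) :
  is_partition n s -> (size s <= n)%N.
Proof.
case/and3P=> _ + /eqP <-; elim: s => //= x s IHs.
by rewrite inE negb_or eq_sym -lt0n => /andP[x_gt0 /IHs] /(leq_add x_gt0).
Qed.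

Lemma is_partition_part (n : nat) (s : seq nat) (x : nat) :
  is_partition n s -> x \in s -> (x < n.+1)%N.
Proof.
case/and3P=> _ _ /eqP <-; rewrite ltnS; elim: s => //= y s IHs.
rewrite inE => /orP[/eqP->|/IHs xs]; first exact: leq_addr.
exact: leq_trans xs (leq_addl _ _).
Qed.

(* The bounds on the number and size of the parts only serve to make the type
   finite: by the two lemmas above every partition of n satisfies them. *)
Definition b4_nat (n : nat) : nat :=
  #|[set s : n.-bseq 'I_n.+1 | let p := [seq val i | i <- s] in
       is_partition n p && all (fun d => ~~ (4 %| d)) p]%SET|%N.

Definition b4 (x : rat) : nat :=
  if x \is a Num.nat then b4_nat (Num.truncn x) else 0%N.

Section ModularForms.
Variable R : realType.

Definition upper_half_plane : set R[i] := [set z | 0 < complex.Im z].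

Definition SL2Z : set 'M[int]_2 := [set g | \det g = 1].

Definition Gamma0 (N : nat) : set 'M[int]_2 :=
  [set g | SL2Z g /\ (N%:Z %| g 1%R 0%R)%Z].

Definition automorphy (g : 'M[int]_2) (z : R[i]) : R[i] :=
  (g 1 0)%:~R * z + (g 1 1)%:~R.

Definition moebius (g : 'M[int]_2) (z : R[i]) : R[i] :=
  ((g 0 0)%:~R * z + (g 0 1)%:~R) / automorphy g z.

Definition slash (k : nat) (f : R[i] -> R[i]) (g : 'M[int]_2) (z : R[i]) :
    R[i] :=
  automorphy g z ^- k * f (moebius g z).

(* The regular algebra R[i]^o carries the topology of the norm of R[i], so that
   derivability along 1 over the field R[i] is complex differentiability. *)
Definition holomorphic_on (D : set R[i]) (f : R[i] -> R[i]) : Prop :=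
  forall z : R[i], D z -> derivable (f : R[i]^o -> R[i]^o) z 1.

Definition bounded_at_infinity (f : R[i] -> R[i]) : Prop :=
  exists A M : R, forall z : R[i],
    upper_half_plane z -> A <= complex.Im z -> `|f z| <= M%:C.

(* M_k(Gamma_0(N)) with trivial character; as SL2(Z) permutes the cusps
   transitively, holomorphy at all cusps is boundedness of f |_k g at
   i * infinity for every g in SL2(Z). *)
Record modular_form (k N : nat) (f : R[i] -> R[i]) : Prop := ModularForm {
  modular_form_holomorphic : holomorphic_on upper_half_plane f;
  modular_form_slash : forall g : 'M[int]_2, Gamma0 N g ->
    forall z : R[i], upper_half_plane z -> slash k f g z = f z;
  modular_form_cusps : forall g : 'M[int]_2, SL2Z g ->
    bounded_at_infinity (slash k f g)
}.

Definition cexp (z : R[i]) : R[i] :=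
  (expR (complex.Re z))%:C * (cos (complex.Im z) +i* sin (complex.Im z)).

Definition nome (z : R[i]) : R[i] := cexp ((0 +i* (2 * pi)) * z).

Definition has_int_qexpansion (f : R[i] -> R[i]) (a : nat -> int) : Prop :=
  forall z : R[i], upper_half_plane z ->
    series (fun n => (a n)%:~R * nome z ^+ n : R[i]^o) @ \oo --> (f z : R[i]^o).

(* A power series over F_m is given by its coefficient sequence. *)
Definition modular_forms_mod (k N m : nat) : set (nat -> 'F_m) :=
  [set c | exists (f : R[i] -> R[i]) (a : nat -> int),
     [/\ modular_form k N f, has_int_qexpansion f a
       & forall n : nat, c n = (a n)%:~R]].

End ModularForms.

Arguments modular_forms_mod R k N m : clear implicits.

(* Main.v *)
(* With q = e(z), F = sum b_4(n) q^(8n+1) is the eta quotient eta(32z) / eta(8z).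
   Put x = theta(32z) = sum q^(32 n^2) and y = theta(8z) - x.  Jacobi's identities
   give 2 F^8 (x - y)^4 = x y (x^2 + y^2), and the Wronskian of x and y is
   8 x y (x^4 - y^4).  The Hasse polynomial H = sum C(n,i)^2 x^(4(n-i)) y^(4i),
   n = (m-1)/2, is 1 modulo m, because Landen's transformation shows that it is
   invariant under q -> q^2.  Hence F times a suitable m-th power is, modulo m,
   a polynomial in x and y times the Wronskian, and U_m can be computed on each
   monomial: it kills total derivatives, and the surviving terms give a form
   th ka^(r-1) P(x, y) with P homogeneous and th, ka theta series.

   The transformation laws come from a single double series,
   sum_(k odd) sum_j (-1)^j (k t + 2j)^-2: summed by rows and by columns, with
   the partial fractions of 1 / sin^2 and Jacobi's four square theorem, it gives
   theta(-1/t)^4, and the duplication formulas then determine theta_2 / theta_3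
   at -1/t.  The sign of the eta quotient under t -> -1/(4t) is constant by
   continuity. *)

Require Import Defs.
From HB Require Import structures.
From mathcomp Require Import all_boot all_order all_algebra all_field.
From mathcomp Require Import archimedean complex.
From mathcomp Require Import all_classical all_reals all_analysis.
From mathcomp Require Import zify ring lra.

Set Implicit Arguments.
Unset Strict Implicit.
Unset Printing Implicit Defensive.

Import Order.TTheory GRing.Theory Num.Theory.
Import numFieldNormedType.Exports.

Local Open Scope ring_scope.

(** * Formal power series *)

(** [U_m] is explicit on multiples of the Wronskian for the reason that the Cartier operator is
    explicit on differential forms: with [D = q d/dq], the term [x^i y^j (x Dy - y Dx)] for
    [m | i + j + 2] is either exact or, up to an [m]-th power, logarithmic. To reach this shape, [F]
    is multiplied by the [m]-th power of the Wronskian, which contains enough factors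
    [x y (x^2 + y^2) = 2 F^8 (x - y)^4] to complete [F] to an [m]-th power: [s m = 8 e + 1] with
    [s = m mod 8], as odd squares are 1 modulo 8. The polynomial left over must have degree [-2]
    modulo [m], and the final degree must fit the weight [3m - 3]; powers of [H], of degree [2m - 2]
    but equal to 1 modulo [m], correct both. Coefficients stay integers, so that the polynomial
    found modulo [m] can be read in characteristic 0. The four square theorem is a by-product: the
    logarithmic derivative of [F] is [(x + y)^4] by the Wronskian, and a series of divisor sums by
    the product for [b_4]. The level is 256 because there the multipliers of [eta(32z)/eta(8z)] and
    of [theta_2/theta_3] at [32z], an eighth and a fourth root of unity, become trivial. *)

Record fps (R : Type) := Fps { co : nat -> R }.
Arguments co {R}.

Lemma fpsP (R : Type) (f g : fps R) : (forall n, co f n = co g n) -> f = g.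
Proof. by case: f; case: g => f g /= fg; congr Fps; apply/funext. Qed.

HB.instance Definition _ (R : Type) := gen_eqMixin (fps R).
HB.instance Definition _ (R : Type) := gen_choiceMixin (fps R).

Section FpsRing.
Variable R : comNzRingType.
Implicit Types f g h : fps R.

Definition fps_add f g := Fps (fun n => co f n + co g n).
Definition fps_opp f := Fps (fun n => - co f n).
Definition fps_zero : fps R := Fps (fun=> 0).
Definition fps_one : fps R := Fps (fun n => (n == 0%N)%:R).
Definition fps_mul f g := Fps (fun n => \sum_(i < n.+1) co f i * co g (n - i)%N).

Fact fps_addA : associative fps_add.
Proof. by move=> f g h; apply: fpsP => n /=; rewrite addrA. Qed.
Fact fps_addC : commutative fps_add.
Proof. by move=> f g; apply: fpsP => n /=; rewrite addrC. Qed.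
Fact fps_add0 : left_id fps_zero fps_add.
Proof. by move=> f; apply: fpsP => n /=; rewrite add0r. Qed.
Fact fps_addN : left_inverse fps_zero fps_opp fps_add.
Proof. by move=> f; apply: fpsP => n /=; rewrite addNr. Qed.

HB.instance Definition _ :=
  GRing.isZmodule.Build (fps R) fps_addA fps_addC fps_add0 fps_addN.

Definition trunc (N : nat) f : {poly R} := \poly_(i < N) co f i.

Lemma coef_trunc N f i : (i < N)%N -> (trunc N f)`_i = co f i.
Proof. by move=> iN; rewrite coef_poly iN. Qed.

Lemma co_mul_trunc N f g n : (n < N)%N ->
  co (fps_mul f g) n = (trunc N f * trunc N g)`_n.
Proof.
move=> nN; rewrite coefM; apply: eq_bigr => i _.
by rewrite !coef_trunc //; have := ltn_ord i; lia.
Qed.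

Fact fps_mulC : commutative fps_mul.
Proof. by move=> f g; apply: fpsP => n; rewrite !(@co_mul_trunc n.+1) // mulrC. Qed.

(** A coefficient of a product only sees truncations of the factors, so associativity is inherited
    from polynomials. *)
Fact fps_mulA : associative fps_mul.
Proof.
have E f g h n : co (fps_mul f (fps_mul g h)) n =
   (trunc n.+1 f * (trunc n.+1 g * trunc n.+1 h))`_n.
  rewrite coefM; apply: eq_bigr => i _; congr (_ * _).
    by rewrite coef_trunc // ltn_ord.
  by rewrite -(@co_mul_trunc n.+1) //; have := ltn_ord i; lia.
move=> f g h; apply: fpsP => n.
by rewrite E fps_mulC E mulrA mulrC.
Qed.

Fact fps_mul1 : left_id fps_one fps_mul.
Proof.
move=> f; apply: fpsP => n /=; rewrite big_ord_recl /= subn0 mul1r big1 ?addr0 //.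
by move=> i _; rewrite mul0r.
Qed.

Fact fps_mulD : left_distributive fps_mul fps_add.
Proof.
move=> f g h; apply: fpsP => n /=; rewrite -big_split /=.
by apply: eq_bigr => i _; rewrite mulrDl.
Qed.

Fact fps_one_neq0 : fps_one != fps_zero.
Proof. by apply/eqP => /(congr1 (co^~ 0%N)) /eqP /=; rewrite oner_eq0. Qed.

HB.instance Definition _ := GRing.Zmodule_isComNzRing.Build (fps R)
  fps_mulA fps_mulC fps_mul1 fps_mulD fps_one_neq0.

Lemma coD f g n : co (f + g) n = co f n + co g n. Proof. by []. Qed.
Lemma coN f n : co (- f) n = - co f n. Proof. by []. Qed.
Lemma coB f g n : co (f - g) n = co f n - co g n. Proof. by []. Qed.
Lemma co0 n : co (0 : fps R) n = 0. Proof. by []. Qed.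
Lemma co1 n : co (1 : fps R) n = (n == 0%N)%:R. Proof. by []. Qed.
Lemma coM f g n : co (f * g) n = \sum_(i < n.+1) co f i * co g (n - i)%N.
Proof. by []. Qed.
Lemma coMtrunc N f g n : (n < N)%N ->
  co (f * g) n = (trunc N f * trunc N g)`_n.
Proof. exact: co_mul_trunc. Qed.

Lemma co_sum (I : Type) (r : seq I) (P : pred I) (F : I -> fps R) n :
  co (\sum_(i <- r | P i) F i) n = \sum_(i <- r | P i) co (F i) n.
Proof. by elim/big_rec2: _ => // i y1 y2 _ <-. Qed.

Lemma coMn f k n : co (f *+ k) n = co f n *+ k.
Proof. by elim: k => // k IH; rewrite !mulrSr coD IH. Qed.

Lemma co_natl k f n : co (k%:R * f) n = k%:R * co f n.
Proof. by rewrite !mulr_natl coMn. Qed.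

Lemma co_nat k n : co (k%:R : fps R) n = if n == 0%N then k%:R else 0.
Proof. by rewrite coMn co1; case: eqP => // _; rewrite mul0rn. Qed.

Definition of_poly (p : {poly R}) : fps R := Fps (fun n => p`_n).

Fact of_poly_zmod : zmod_morphism of_poly.
Proof. by move=> p q; apply: fpsP => n /=; rewrite coefB. Qed.
Fact of_poly_monoid : monoid_morphism of_poly.
Proof.
split=> [|p q]; apply: fpsP => n /=; first by rewrite coef1.
by rewrite coefM.
Qed.
HB.instance Definition _ :=
  GRing.isZmodMorphism.Build {poly R} (fps R) of_poly of_poly_zmod.
HB.instance Definition _ :=
  GRing.isMonoidMorphism.Build {poly R} (fps R) of_poly of_poly_monoid.

Lemma of_polyM p q : of_poly (p * q) = of_poly p * of_poly q.
Proof. exact: rmorphM. Qed.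

Definition X : fps R := of_poly 'X.

Lemma coXn k n : co (X ^+ k) n = (n == k)%:R.
Proof. by rewrite /X -rmorphXn /= coefXn. Qed.

Lemma coXnM k f n : co (X ^+ k * f) n = if (n < k)%N then 0 else co f (n - k)%N.
Proof.
rewrite /X -rmorphXn (@coMtrunc n.+1) //.
have -> : (trunc n.+1 (of_poly 'X^k) * trunc n.+1 f)`_n = ('X^k * trunc n.+1 f)`_n.
  rewrite !coefM; apply: eq_bigr => i _; rewrite coef_trunc //.
rewrite coefXnM; case: ltnP => // kn.
by rewrite coef_trunc //; lia.
Qed.

Definition eqmod N f g := forall n, (n < N)%N -> co f n = co g n.

Lemma eqmod_sym N f g : eqmod N f g -> eqmod N g f.
Proof. by move=> fg n nN; rewrite fg. Qed.
Lemma eqmod_trans N g f h : eqmod N f g -> eqmod N g h -> eqmod N f h.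
Proof. by move=> fg gh n nN; rewrite fg ?gh. Qed.
Lemma eqmodW M N f g : (N <= M)%N -> eqmod M f g -> eqmod N f g.
Proof. by move=> NM fg n nN; apply: fg; lia. Qed.
Lemma eqmodM N f g f' g' : eqmod N f f' -> eqmod N g g' -> eqmod N (f * g) (f' * g').
Proof.
move=> ff gg n nN; rewrite !coM; apply: eq_bigr => i _.
by rewrite ff ?gg //; have := ltn_ord i; lia.
Qed.
Lemma eqmodX N k f f' : eqmod N f f' -> eqmod N (f ^+ k) (f' ^+ k).
Proof. by move=> ff; elim: k => // k IH; rewrite !exprS; apply: eqmodM. Qed.
Lemma eqmod_eq f g : (forall N, eqmod N f g) -> f = g.
Proof. by move=> fg; apply: fpsP => n; apply: (fg n.+1). Qed.
Lemma eqmod_trunc N f : eqmod N f (of_poly (trunc N f)).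
Proof. by move=> n nN /=; rewrite coef_trunc. Qed.

Lemma eqmod_cancel N f g h : co h 0 = 1 -> eqmod N (h * f) (h * g) -> eqmod N f g.
Proof.
move=> h0 hfg n; elim/ltn_ind: n => n IH nN.
have := hfg _ nN; rewrite !coM !big_ord_recl /= subn0 h0 !mul1r.
rewrite (eq_bigr (fun i : 'I_n => co h (bump 0 i) * co g (n - bump 0 i)%N)).
  by move/addIr.
by move=> i _; rewrite IH //; have := ltn_ord i; rewrite /bump; lia.
Qed.

Lemma fps_cancel f g h : co h 0 = 1 -> h * f = h * g -> f = g.
Proof.
move=> h0 E; apply: eqmod_eq => N; apply: eqmod_cancel h0 _ => n nN.
by rewrite E.
Qed.

(** The Euler derivation [q d/dq], which commutes with [sub k] up to the factor [k]. *)
Definition fD f := Fps (fun n => co f n *+ n).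

Lemma fDD f g : fD (f + g) = fD f + fD g.
Proof. by apply: fpsP => n /=; rewrite mulrnDl. Qed.
Lemma fDN f : fD (- f) = - fD f.
Proof. by apply: fpsP => n /=; rewrite mulNrn. Qed.
Lemma fDM f g : fD (f * g) = fD f * g + f * fD g.
Proof.
apply: fpsP => n; rewrite coD !coM /= -big_split -sumrMnl; apply: eq_bigr => i _ /=.
rewrite mulrnAl mulrnAr -mulrnDr; congr (_ *+ _).
by have := ltn_ord i; lia.
Qed.
Lemma fD1 : fD 1 = 0.
Proof. by apply: fpsP => n /=; case: n => [|n] /=; rewrite ?mulr0n ?mul0rn. Qed.
Lemma fDX f k : fD (f ^+ k.+1) = k.+1%:R * f ^+ k * fD f.
Proof.
elim: k => [|k IH]; first by rewrite expr1 expr0 !mul1r.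
rewrite exprS fDM IH !exprS; ring.
Qed.
Lemma fD_nat k : fD k%:R = 0.
Proof. by apply: fpsP => n /=; rewrite co_nat; case: n => [|n] //=; rewrite mul0rn. Qed.

Lemma fD_prod_log (I : Type) (r : seq I) (P : pred I) (F G : I -> fps R) :
  (forall i, P i -> fD (F i) = G i * F i) ->
  fD (\prod_(i <- r | P i) F i) = (\sum_(i <- r | P i) G i) * \prod_(i <- r | P i) F i.
Proof.
move=> FG; elim: r => [|i r IH]; first by rewrite !big_nil fD1 mul0r.
by rewrite !big_cons; case: ifP => // Pi; rewrite fDM IH FG //; ring.
Qed.

(* q -> q^k *)
Definition sub (k : nat) f :=
  Fps (fun n => if (k %| n)%N then co f (n %/ k) else 0).

(* q -> - q *)
Definition ftw f := Fps (fun n => (-1) ^+ n * co f n).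

Lemma co_fD f n : co (fD f) n = co f n *+ n. Proof. by []. Qed.
Lemma co_sub k f n : co (sub k f) n = if (k %| n)%N then co f (n %/ k) else 0.
Proof. by []. Qed.
Lemma co_ftw f n : co (ftw f) n = (-1) ^+ n * co f n. Proof. by []. Qed.

Lemma sub_of_poly k p : (0 < k)%N -> sub k (of_poly p) = of_poly (p \Po 'X^k).
Proof. by move=> k0; apply: fpsP => n /=; rewrite coef_comp_poly_Xn. Qed.
Lemma eqmod_sub k N f g : (0 < k)%N -> eqmod N f g -> eqmod (k * N) (sub k f) (sub k g).
Proof.
move=> k0 fg n nN /=; case: ifP => // kn; apply: fg.
by rewrite ltn_divLR // mulnC.
Qed.
Lemma eqmod_subW k N f g : (0 < k)%N -> eqmod N f g -> eqmod N (sub k f) (sub k g).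
Proof. by move=> k0 /(eqmod_sub k0); apply: eqmodW; nia. Qed.

Lemma sub1 k : (0 < k)%N -> sub k 1 = 1.
Proof.
move=> k0; apply: fpsP => n /=; case: ifP => [/dvdnP[j ->]|].
  by rewrite mulnK // muln_eq0 (gtn_eqF k0) orbF.
by case: n => //=; rewrite dvdn0.
Qed.
Lemma subM k f g : (0 < k)%N -> sub k (f * g) = sub k f * sub k g.
Proof.
move=> k0; apply: eqmod_eq => N.
have tr h := eqmod_trunc (N := N) h.
apply: (@eqmod_trans _ (sub k (of_poly (trunc N f) * of_poly (trunc N g)))).
  by apply: eqmod_subW => //; apply: eqmodM.
rewrite -of_polyM sub_of_poly // comp_polyM of_polyM -!sub_of_poly //.
by apply: eqmodM; apply: eqmod_sym; apply: eqmod_subW.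
Qed.

Lemma subD k f g : sub k (f + g) = sub k f + sub k g.
Proof. by apply: fpsP => n /=; case: ifP => // _; rewrite addr0. Qed.
Lemma subN k f : sub k (- f) = - sub k f.
Proof. by apply: fpsP => n /=; case: ifP => // _; rewrite oppr0. Qed.
Lemma subX k n f : (0 < k)%N -> sub k (f ^+ n) = sub k f ^+ n.
Proof. by move=> k0; elim: n => [|n IH]; rewrite ?sub1 // !exprS subM // IH. Qed.
Lemma sub_nat k n : (0 < k)%N -> sub k n%:R = n%:R.
Proof.
move=> k0; elim: n => [|n IH]; first by apply: fpsP => i /=; case: ifP.
by rewrite -!natr1 subD IH sub1.
Qed.
Lemma sub_sub j k f : (0 < j)%N -> (0 < k)%N -> sub j (sub k f) = sub (j * k) f.
Proof.
move=> j0 k0; apply: fpsP => n /=.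
case: (boolP (j %| n)%N) => [/dvdnP[i ->]|jn].
  rewrite mulnK // (mulnC i) dvdn_pmul2l //; case: ifP => // /dvdnP[l ->].
  by rewrite mulnK // (mulnC l k) mulnA mulKn // muln_gt0 j0.
case: ifP => // /dvdnP[l El]; case/negP: jn; rewrite El.
by rewrite mulnCA dvdn_mulr.
Qed.
Lemma sub_inj k f g : (0 < k)%N -> sub k f = sub k g -> f = g.
Proof.
move=> k0 E; apply: fpsP => n; move: (congr1 (co^~ (n * k)%N) E) => /=.
by rewrite dvdn_mull // mulnK.
Qed.
Lemma subXn k n : (0 < k)%N -> sub k (X ^+ n) = X ^+ (k * n).
Proof.
move=> k0; apply: fpsP => i; rewrite /= !coXn.
case: ifP => [/dvdnP[j ->]|ki]; first by rewrite mulnK // mulnC eqn_pmul2l.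
by case: eqP => // Ei; rewrite Ei dvdn_mulr in ki.
Qed.
Lemma sub_X k : (0 < k)%N -> sub k X = X ^+ k.
Proof. by move=> k0; have := @subXn k 1 k0; rewrite expr1 muln1. Qed.
Lemma fD_sub k f : (0 < k)%N -> fD (sub k f) = k%:R * sub k (fD f).
Proof.
move=> k0; apply: fpsP => n; rewrite co_natl /=.
case: ifP => [/dvdnP[j ->]|]; last by rewrite mul0rn mulr0.
by rewrite mulnK // mulr_natl mulrnA.
Qed.

Lemma ftwD f g : ftw (f + g) = ftw f + ftw g.
Proof. by apply: fpsP => n /=; rewrite mulrDr. Qed.
Lemma ftwN f : ftw (- f) = - ftw f.
Proof. by apply: fpsP => n /=; rewrite mulrN. Qed.
Lemma ftw1 : ftw 1 = 1.
Proof. by apply: fpsP => -[|n] /=; rewrite ?mulr1 ?expr0 ?mulr0. Qed.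
Lemma ftwM f g : ftw (f * g) = ftw f * ftw g.
Proof.
apply: fpsP => n /=; rewrite mulr_sumr; apply: eq_bigr => i _ /=.
rewrite mulrACA -exprD subnKC //; have := ltn_ord i; lia.
Qed.
Lemma ftwX f n : ftw (f ^+ n) = ftw f ^+ n.
Proof. by elim: n => [|n IH]; rewrite ?ftw1 // !exprS ftwM IH. Qed.
Lemma ftw_nat n : ftw n%:R = n%:R.
Proof.
elim: n => [|n IH]; first by apply: fpsP => i /=; rewrite mulr0.
by rewrite -!natr1 ftwD IH ftw1.
Qed.
Lemma ftwXn n : ftw (X ^+ n) = (-1) ^+ n * X ^+ n.
Proof.
apply: fpsP => i.
have -> : co ((-1) ^+ n * X ^+ n) i = (-1) ^+ n * co (X ^+ n) i.
  by rewrite -!(signr_odd _ n); case: odd; rewrite ?expr0 ?expr1 ?mul1r ?mulN1r.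
by rewrite /= !coXn; case: eqP => [->|]; rewrite ?mulr0.
Qed.
Lemma ftw_X : ftw X = - X.
Proof. by have := ftwXn 1; rewrite !expr1 mulN1r. Qed.
Lemma ftw_sub_even k f : (0 < k)%N -> ~~ odd k -> ftw (sub k f) = sub k f.
Proof.
move=> k0 ok; apply: fpsP => n /=; case: ifP => [/dvdnP[j ->]|]; last by rewrite mulr0.
by rewrite -signr_odd oddM (negbTE ok) andbF mul1r.
Qed.
Lemma eqmod_ftw N f g : eqmod N f g -> eqmod N (ftw f) (ftw g).
Proof. by move=> fg n nN /=; rewrite fg. Qed.
Lemma ftw_prod (I : Type) (r : seq I) (P : pred I) (F : I -> fps R) :
  ftw (\prod_(i <- r | P i) F i) = \prod_(i <- r | P i) ftw (F i).
Proof. by elim/big_rec2: _ => [|i a b _ <-]; rewrite ?ftw1 ?ftwM. Qed.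
Lemma sub_prod k (I : Type) (r : seq I) (P : pred I) (F : I -> fps R) : (0 < k)%N ->
  sub k (\prod_(i <- r | P i) F i) = \prod_(i <- r | P i) sub k (F i).
Proof. by move=> k0; elim/big_rec2: _ => [|i a b _ <-]; rewrite ?sub1 ?subM. Qed.

Lemma co0M f g : co (f * g) 0 = co f 0 * co g 0.
Proof. by rewrite coM big_ord_recl big_ord0 addr0. Qed.
Lemma co1M f g : co (f * g) 1 = co f 0 * co g 1 + co f 1 * co g 0.
Proof. by rewrite coM !big_ord_recl big_ord0 addr0. Qed.
Lemma co0X f n : co (f ^+ n) 0 = co f 0 ^+ n.
Proof. by elim: n => // n IH; rewrite !exprS co0M IH. Qed.
Lemma co0sub k f : co (sub k f) 0 = co f 0.
Proof. by rewrite /= dvdn0 div0n. Qed.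
Lemma co0_prod (I : Type) (r : seq I) (P : pred I) (F : I -> fps R) :
  (forall i, P i -> co (F i) 0 = 1) -> co (\prod_(i <- r | P i) F i) 0 = 1.
Proof.
move=> F1; elim/big_rec: _ => [|i f Pi IH]; first by rewrite co1.
by rewrite co0M F1 // mul1r.
Qed.

End FpsRing.

Lemma fps_domain (R : idomainType) (f g : fps R) : f * g = 0 -> f = 0 \/ g = 0.
Proof.
move=> fg0; case: (pselect (f = 0)) => [|f0]; [by left|right].
have [i fi0 mini] : exists2 i, co f i != 0 & forall j, (j < i)%N -> co f j = 0.
  have /existsNP[i /eqP fi] : ~ (forall i, co f i = 0) by move=> E; apply: f0; apply: fpsP.
  have ex : exists i, co f i != 0 by exists i.
  exists (ex_minn ex); case: ex_minnP => // k _ mink j jk.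
  by apply/eqP; apply: contraLR jk => /mink; rewrite -leqNgt.
apply: fpsP => n; elim/ltn_ind: n => n IH; rewrite co0.
have := congr1 (co^~ (i + n)%N) fg0; rewrite coM co0.
have ii : (i < (i + n).+1)%N by lia.
rewrite (bigD1 (Ordinal ii)) //= big1 ?addr0 => [|j /eqP jn].
  by rewrite addKn => /eqP; rewrite mulf_eq0 (negbTE fi0) => /eqP.
case: (ltngtP j i) => ji; [by rewrite mini ?mul0r| |by case: jn; apply: val_inj].
by rewrite IH ?co0 ?mulr0 //; have := ltn_ord j; lia.
Qed.

Lemma fps_mulIf (R : idomainType) (h f g : fps R) : h != 0 -> h * f = h * g -> f = g.
Proof.
move=> /eqP h0 E; have /fps_domain[//|/eqP] : h * (f - g) = 0 by rewrite mulrBr E subrr.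
by rewrite subr_eq0 => /eqP.
Qed.

Section FpsMap.
Variables (R S : comNzRingType) (u : {rmorphism R -> S}).
Definition fmap (f : fps R) : fps S := Fps (fun n => u (co f n)).
Fact fmap_zmod : zmod_morphism fmap.
Proof. by move=> f g; apply: fpsP => n /=; rewrite rmorphB. Qed.
Fact fmap_monoid : monoid_morphism fmap.
Proof.
split=> [|f g]; apply: fpsP => n /=; first by rewrite rmorph_nat.
by rewrite rmorph_sum; apply: eq_bigr => i _; rewrite rmorphM.
Qed.
HB.instance Definition _ := GRing.isZmodMorphism.Build (fps R) (fps S) fmap fmap_zmod.
HB.instance Definition _ := GRing.isMonoidMorphism.Build (fps R) (fps S) fmap fmap_monoid.
Lemma fmap_sub k f : fmap (sub k f) = sub k (fmap f).
Proof. by apply: fpsP => n /=; case: ifP; rewrite ?rmorph0. Qed.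
Lemma fmap_fD f : fmap (fD f) = fD (fmap f).
Proof. by apply: fpsP => n /=; rewrite rmorphMn. Qed.
End FpsMap.

(** * Theta series *)

(** The series [sum_k q^(e k)]. The sum may stop at [k = n] because the exponent sequences satisfy
    [k <= e k]. *)
Definition gs (e : nat -> nat) : fps int :=
  Fps (fun n => \sum_(k < n.+1) (e k == n)%:R).

Lemma gsE (e : nat -> nat) M n : (forall k, (k <= e k)%N) -> (n < M)%N ->
  co (gs e) n = \sum_(k < M) (e k == n)%:R.
Proof.
move=> ek nM /=; rewrite -!(big_mkord xpredT (fun k => (e k == n)%:R)).
rewrite [RHS](@big_cat_nat _ _ _ n.+1) //=.
have -> : \sum_(n.+1 <= k < M) (e k == n)%:R = 0 :> int; last by rewrite addr0.
rewrite big_nat big1 // => k /andP[nk _]; case: eqP => // E; have := ek k; lia.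
Qed.

Lemma eqmod_gs (e : nat -> nat) M : (forall k, (k <= e k)%N) ->
  eqmod M (gs e) (\sum_(k < M) X int ^+ (e k)).
Proof.
move=> ek n nM; rewrite (gsE ek nM) co_sum.
by apply: eq_bigr => k _; rewrite coXn eq_sym.
Qed.

Lemma sum_double (V : zmodType) (F : nat -> V) M :
  \sum_(k < M.*2) F k = \sum_(k < M) (F k.*2 + F k.*2.+1).
Proof.
elim: M => [|M IH]; first by rewrite !big_ord0.
by rewrite doubleS !big_ord_recr /= IH addrA.
Qed.

Lemma gs_split (e e0 e1 : nat -> nat) : (forall k, (k <= e k)%N) ->
  (forall k, e0 k = e k.*2) -> (forall k, e1 k = e k.*2.+1) -> gs e = gs e0 + gs e1.
Proof.
move=> ek E0 E1; apply: fpsP => n; rewrite coD (@gsE e n.+1.*2) //; last by lia.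
rewrite (sum_double (fun k => (e k == n)%:R)) big_split /=.
by congr (_ + _); apply: eq_bigr => k _; rewrite ?E0 ?E1.
Qed.

Lemma sub_gs j (e : nat -> nat) : (0 < j)%N -> (forall k, (k <= e k)%N) ->
  sub j (gs e) = gs (fun k => j * e k)%N.
Proof.
move=> j0 ek; apply: fpsP => n.
rewrite [RHS](@gsE _ n.+1) //; last by move=> k; have := ek k; nia.
rewrite co_sub; case: ifP => [/dvdnP[i ->]|jn].
  rewrite mulnK // (@gsE _ (i * j).+1) //; last by nia.
  by apply: eq_bigr => k _; rewrite (mulnC j) eqn_pmul2r.
by rewrite big1 // => k _; case: eqP => // E; rewrite -E dvdn_mulr in jn.
Qed.

Lemma XM_gs j (e : nat -> nat) : (forall k, (k <= e k)%N) ->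
  X int ^+ j * gs e = gs (fun k => j + e k)%N.
Proof.
move=> ek; apply: fpsP => n; rewrite coXnM.
rewrite [RHS](@gsE _ n.+1) //; last by move=> k; have := ek k; lia.
case: ltnP => jn.
  by rewrite big1 // => k _; case: eqP => // E; lia.
rewrite (@gsE _ n.+1) //; last by lia.
by apply: eq_bigr => k _; congr ((_ : bool)%:R); apply/eqP/eqP; lia.
Qed.

(** Ramanujan's [phi], the sum of [q^(n^2)] over all integers, and [psi], the sum of [q^(k(k+1)/2)]
    over [k >= 0]; [om] is the sum of [q^(n^2)] over odd [n > 0]. *)
Definition phi : fps int := 1 + 2 * gs (fun k => k.+1 ^ 2)%N.
Definition psi : fps int := gs (fun k => 'C(k.+1, 2)).
Definition om : fps int := X int * sub 8 psi.

Lemma tri_ge k : (k <= 'C(k.+1, 2))%N.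
Proof. by rewrite bin2 /=; nia. Qed.

Lemma triE k : 'C(k.+1, 2).*2 = (k * k.+1)%N.
Proof.
elim: k => // k IH; rewrite binS bin1 doubleD IH; nia.
Qed.

Lemma omE : om = gs (fun k => k.*2.+1 ^ 2)%N.
Proof.
rewrite /om -[X int]expr1 sub_gs //; last exact: tri_ge.
rewrite XM_gs; last by move=> k; have := tri_ge k; lia.
congr gs; apply/funext => k; have := triE k; rewrite -!mulnn; nia.
Qed.

Lemma phi_split : phi = sub 4 phi + 2 * om.
Proof.
have sq k : (k <= k.+1 ^ 2)%N by rewrite -mulnn; nia.
rewrite {1}/phi omE (@gs_split _ (fun k => k.*2.+1 ^ 2)%N (fun k => 4 * k.+1 ^ 2)%N) //.
  rewrite -sub_gs // /phi subD sub1 // subM // sub_nat //; ring.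
by move=> k; rewrite -!mulnn; nia.
Qed.

Lemma ftw_om : ftw om = - om.
Proof. by rewrite /om ftwM ftw_sub_even // ftw_X mulNr. Qed.

Lemma ftw_phi : ftw phi = sub 4 phi - 2 * om.
Proof. by rewrite {1}phi_split ftwD ftwM ftw_om ftw_nat ftw_sub_even // mulrN. Qed.

(** The shift by [K] turns the window from [-K] to [K] into an ordinal, so that representations as
    two squares form a finite type. *)
Definition sd (K i : nat) : nat := absz (i%:Z - K%:Z).

Lemma phi_coE K n : (n <= K)%N ->
  co phi n = \sum_(i < K.*2.+1) (sd K i ^ 2 == n)%N%:R.
Proof.
move=> nK; have sq k : (k <= k.+1 ^ 2)%N by rewrite -mulnn; nia.
rewrite /phi coD co_natl co1 (@gsE _ n.+1) //.
have -> : \sum_(k < n.+1) (k.+1 ^ 2 == n)%N%:R = \sum_(k < K) (k.+1 ^ 2 == n)%N%:R :> int.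
  rewrite -(@gsE (fun k => k.+1 ^ 2)%N) // .
  case: (ltngtP n K) nK => // [nK|->] _; first by rewrite (@gsE _ K).
  rewrite (@gsE _ K.+1) // big_ord_recr /=; case: eqP; rewrite ?addr0 // -mulnn; nia.
rewrite -addnn -addnS -(big_mkord xpredT (fun i => (sd K i ^ 2 == n)%N%:R)).
rewrite (@big_cat_nat _ _ _ K) //=; last by lia.
have shift (F : nat -> int) :
    \sum_(K <= i < K + K.+1) F i = \sum_(0 <= i < K.+1) F (i + K)%N.
  by rewrite -{1}(add0n K) big_addn addKn.
rewrite shift big_nat_recl //= !big_mkord.
have -> : (sd K (0 + K) ^ 2 == n)%N = (n == 0)%N.
  have -> : sd K (0 + K) = 0%N by rewrite /sd; lia.
  by rewrite exp0n // eq_sym.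
have -> : \sum_(i < K) (sd K i ^ 2 == n)%N%:R = \sum_(i < K) (i.+1 ^ 2 == n)%N%:R :> int.
  rewrite (reindex_inj rev_ord_inj); apply: eq_bigr => i _ /=.
  by have -> : sd K (K - i.+1) = i.+1 by rewrite /sd; have := ltn_ord i; lia.
have -> : \sum_(i < K) (sd K (i.+1 + K) ^ 2 == n)%N%:R =
    \sum_(i < K) (i.+1 ^ 2 == n)%N%:R :> int.
  apply: eq_bigr => i _; by have -> : sd K (i.+1 + K) = i.+1 by rewrite /sd; lia.
by ring.
Qed.

Definition sqp K (p : 'I_K.*2.+1 * 'I_K.*2.+1) : nat :=
  (sd K p.1 ^ 2 + sd K p.2 ^ 2)%N.

Lemma phi2_coE K n : (n <= K)%N ->
  co (phi ^+ 2) n = #|[pred p | @sqp K p == n]|%:R.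
Proof.
move=> nK; rewrite expr2 coM.
under eq_bigr => a _.
  rewrite (@phi_coE K a) ?(@phi_coE K (n - a)); try by have := ltn_ord a; lia.
  rewrite big_distrlr /=; over.
rewrite exchange_big /= -sum1_card natr_sum.
rewrite (eq_bigr (fun i => \sum_(j < K.*2.+1) (sqp (i, j) == n)%:R)) => [|i _].
  rewrite pair_big /= [RHS]big_mkcond /=; apply: eq_bigr => -[i j] _ /=.
  by rewrite inE /=; case: eqP.
rewrite exchange_big /=; apply: eq_bigr => j _; rewrite /sqp /=.
set s := (sd K i ^ 2)%N; set t := (sd K j ^ 2)%N.
case: eqP => [E|E].
  have sn : (s < n.+1)%N by lia.
  rewrite (bigD1 (Ordinal sn)) //= eqxx mul1r big1 => [|a /eqP an].
    by rewrite addr0; case: eqP => //; lia.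
  by case: eqP => [Ea|]; rewrite ?mul0r //; case: an; apply: val_inj.
rewrite big1 // => a _; case: eqP => [Ea|]; rewrite ?mul0r //.
by case: eqP => [Eb|]; rewrite ?mulr0 //; have := ltn_ord a; lia.
Qed.

Lemma card_le_inj (T : finType) (A B : pred T) (f : T -> T) :
  (forall x, A x -> B (f x)) -> {in A &, injective f} -> (#|A| <= #|B|)%N.
Proof.
move=> AB injf; rewrite -(card_in_imset injf); apply: subset_leq_card; apply/fintype.subsetP => y.
by case/imsetP => x Ax ->; apply: AB.
Qed.

Lemma int_sq_bound (a b : int) (n : nat) : (absz a ^ 2 + absz b ^ 2 = n)%N -> (absz a <= n)%N.
Proof. rewrite -!mulnn; nia. Qed.

(* (a, b) |-> (a + b, a - b) matches the representations of n and of 2n. *)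
Lemma phi2_double n : co (phi ^+ 2) n.*2 = co (phi ^+ 2) n.
Proof.
pose K := n.*2; rewrite !(@phi2_coE K) ?/K; try lia.
pose enc (a b : int) : 'I_K.*2.+1 * 'I_K.*2.+1 :=
  (inord (absz (a + K%:Z)%R), inord (absz (b + K%:Z)%R)).
have encK a b : (absz a <= K)%N -> (absz b <= K)%N ->
    (enc a b).1%:Z - K%:Z = a /\ (enc a b).2%:Z - K%:Z = b.
  by move=> aK bK; rewrite /enc /= !inordK; lia.
pose dec (p : 'I_K.*2.+1 * 'I_K.*2.+1) := (p.1%:Z - K%:Z, p.2%:Z - K%:Z).
have dec_inj : injective dec.
  move=> [a b] [c d] [] E1 E2.
  by congr (_, _); apply: val_inj => /=; lia.
have sqE p : @sqp K p = (absz (dec p).1 ^ 2 + absz (dec p).2 ^ 2)%N by [].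
have dec_enc a b : (absz a <= K)%N -> (absz b <= K)%N -> dec (enc a b) = (a, b).
  by move=> aK bK; rewrite /dec; have [-> ->] := encK a b aK bK.
congr (_%:R); apply/eqP; rewrite eqn_leq; apply/andP; split.
(* This direction divides by 2: [a + b] and [a - b] are even because [a^2 + b^2] is. *)
- apply: (@card_le_inj _ _ _ (fun p => enc (((dec p).1 + (dec p).2) %/ 2)%Z
     (((dec p).1 - (dec p).2) %/ 2)%Z)) => [p|p p'].
    move: (sqE p); case: (dec p) => a b /= -> /eqP E; apply/eqP.
    have aK := int_sq_bound E; have bK : (absz b <= n.*2)%N.
      by apply: (@int_sq_bound _ a); rewrite addnC.
    have [c Ec] : exists c : int, a + b = 2 * c.
      exists ((a + b) %/ 2)%Z; rewrite -!mulnn in E.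
      have : ((a + b) %% 2)%Z = 0 by nia.
      by lia.
    have [d Ed] : exists d : int, a - b = 2 * d by exists (c - b); lia.
    rewrite Ec Ed mulrC mulzK // mulrC mulzK //.
    rewrite sqE dec_enc /K /=; try lia.
  move: (sqE p) (sqE p') (@dec_inj p p').
  rewrite !inE => -> ->; case: (dec p) => a b; case: (dec p') => a' b' /= inj.
  move=> /eqP E /eqP E' /(congr1 dec).
  have aK := int_sq_bound E; have bK : (absz b <= n.*2)%N.
    by apply: (@int_sq_bound _ a); rewrite addnC.
  have aK' := int_sq_bound E'; have bK' : (absz b' <= n.*2)%N.
    by apply: (@int_sq_bound _ a'); rewrite addnC.
  have P : ((a + b) %% 2)%Z = 0 by rewrite -!mulnn in E; nia.
  have P' : ((a' + b') %% 2)%Z = 0 by rewrite -!mulnn in E'; nia.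
  clear E E'; rewrite !dec_enc /K; try lia.
  by case=> E1 E2; apply: inj; congr (_, _); lia.
- apply: (@card_le_inj _ _ _ (fun p => enc ((dec p).1 + (dec p).2)
     ((dec p).1 - (dec p).2))) => [p|p p'].
    move: (sqE p); case: (dec p) => a b /= -> /eqP E; apply/eqP.
    have aK := int_sq_bound E; have bK : (absz b <= n)%N.
      by apply: (@int_sq_bound _ a); rewrite addnC.
    rewrite sqE dec_enc /K /=; try lia.
  move: (sqE p) (sqE p') (@dec_inj p p').
  rewrite !inE => -> ->; case: (dec p) => a b; case: (dec p') => a' b' /= inj.
  move=> /eqP E /eqP E' /(congr1 dec).
  have aK := int_sq_bound E; have bK : (absz b <= n)%N.
    by apply: (@int_sq_bound _ a); rewrite addnC.
  have aK' := int_sq_bound E'; have bK' : (absz b' <= n)%N.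
    by apply: (@int_sq_bound _ a'); rewrite addnC.
  clear E E'; rewrite !dec_enc /K; try lia.
  by case=> E1 E2; apply: inj; congr (_, _); lia.
Qed.

(** The left side is twice the even part of [phi^2], which [phi2_double] identifies. *)
Lemma phi_sq_even : phi ^+ 2 + ftw phi ^+ 2 = 2 * sub 2 (phi ^+ 2).
Proof.
apply: fpsP => n; rewrite -ftwX coD co_natl co_ftw co_sub.
case: (boolP (2 %| n)%N) => [/dvdnP[k ->]|].
  by rewrite mulnK // muln2 phi2_double -signr_odd odd_double expr0; ring.
by rewrite dvdn2 negbK => n1; rewrite -signr_odd n1 expr1; ring.
Qed.

Lemma fps_int_mulI n (f g : fps int) : n.+1%:R * f = n.+1%:R * g -> f = g.
Proof.
apply: fps_mulIf; apply/eqP => /(congr1 (co^~ 0%N)) /eqP.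
by rewrite co_nat co0 /=; lia.
Qed.

Lemma sub2_phi_sq : sub 2 phi ^+ 2 = sub 4 phi ^+ 2 + 4 * om ^+ 2.
Proof.
apply: (@fps_int_mulI 1); rewrite -subX // -phi_sq_even ftw_phi {1}phi_split; ring.
Qed.

(** Two expressions for [phi(q^2)^2] are compared: the square of its splitting by parity, and
    [sub2_phi_sq] used at [q] and at [q^2]. Only [om^2] and a cross term remain. *)
Lemma om_sq : om ^+ 2 = sub 8 phi * sub 2 om.
Proof.
have E1 : sub 2 phi = sub 8 phi + 2 * sub 2 om.
  by rewrite {1}phi_split subD subM // sub_sub // sub_nat.
have E2 : sub 4 phi ^+ 2 = sub 8 phi ^+ 2 + 4 * sub 2 om ^+ 2.
  rewrite -(subX 2 phi (k := 4)) // (_ : 4 = 2 * 2)%N // -sub_sub // subX // sub2_phi_sq.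
  by rewrite subD subX // sub_sub // subM // subX // sub_nat.
apply: (@fps_int_mulI 3); have := sub2_phi_sq; rewrite E1 E2 => E.
have -> : 4 * om ^+ 2 = (sub 8 phi + 2 * sub 2 om) ^+ 2 - (sub 8 phi ^+ 2 + 4 * sub 2 om ^+ 2).
  by rewrite E; ring.
by ring.
Qed.

Lemma Xint_neq0 k : X int ^+ k != 0.
Proof. by apply/eqP => /(congr1 (co^~ k)) /eqP; rewrite coXn eqxx co0. Qed.

Lemma psi_sq : psi ^+ 2 = phi * sub 2 psi.
Proof.
apply: (@sub_inj _ 8) => //; apply: (fps_mulIf (Xint_neq0 2)).
have E : sub 2 om = X int ^+ 2 * sub 16 psi.
  by rewrite (@subM _ 2 (X int) (sub 8 psi)) // sub_sub // sub_X.
by rewrite subX // -exprMn -/om om_sq E subM // sub_sub //; ring.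
Qed.

(** [tha] and [thb] are the even and odd parts of [phi], that is theta_3 and theta_2 in [q^4]. They
    are locked to stay atoms for [ring]. *)
HB.lock Definition tha : fps int := sub 4 phi.
HB.lock Definition thb : fps int := 2 * om.

Lemma phiD : phi = tha + thb. Proof. by rewrite tha.unlock thb.unlock -phi_split. Qed.
Lemma phiB : ftw phi = tha - thb. Proof. by rewrite tha.unlock thb.unlock ftw_phi. Qed.

(** With [thb_sq], the duplication formulas behind the arithmetic-geometric mean. The Wronskian, the
    Hasse polynomial and the modular transformations all rest on this pair. *)
Lemma tha_sq : tha ^+ 2 = sub 2 tha ^+ 2 + sub 2 thb ^+ 2.
Proof.
rewrite tha.unlock thb.unlock sub_sub // subM // sub_nat //.
rewrite -(subX 2 phi (k := 4)) // (_ : 4 = 2 * 2)%N // -sub_sub // subX // sub2_phi_sq.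
by rewrite subD subX // sub_sub // subM // subX // sub_nat //; ring.
Qed.

Lemma thb_sq : thb ^+ 2 = 2 * sub 2 tha * sub 2 thb.
Proof. by rewrite tha.unlock thb.unlock exprMn om_sq subM // sub_nat // sub_sub //; ring. Qed.

Lemma co_psi0 : co psi 0 = 1.
Proof. by rewrite /= big_ord_recl big_ord0. Qed.
Lemma co_phi0 : co phi 0 = 1.
Proof. by rewrite /phi coD co_natl co1 /= big_ord_recl big_ord0. Qed.
Lemma co_tha0 : co tha 0 = 1.
Proof. by rewrite tha.unlock co0sub co_phi0. Qed.
Lemma co_thb0 : co thb 0 = 0.
Proof. by rewrite thb.unlock /om co_natl co0M -[X int]expr1 coXn mul0r mulr0. Qed.
Lemma co_thb1 : co thb 1 = 2.
Proof.
by rewrite thb.unlock /om co_natl -[X int]expr1 coXnM ltnn subnn co0sub co_psi0.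
Qed.

Definition wron (f g : fps int) := f * fD g - g * fD f.

Lemma wron_sub2 f g : wron (sub 2 f) (sub 2 g) = 2 * sub 2 (wron f g).
Proof. by rewrite /wron !fD_sub // subD subN !subM //; ring. Qed.

(** Differentiating the duplication formulas gives the equation [key] between the defect [dl(q)] of
    the identity and [dl(q^2)]. As [tha * thb] starts with [2 q], coefficient [n + 1] of [key]
    expresses [dl_n], for [n >= 2], by coefficients of smaller index. *)
Lemma wron_theta : wron tha thb = tha * thb * (tha ^+ 4 - thb ^+ 4).
Proof.
set a := tha; set b := thb; pose a1 := sub 2 a; pose b1 := sub 2 b.
have A : a ^+ 2 = a1 ^+ 2 + b1 ^+ 2 := tha_sq.
have B : b ^+ 2 = 2 * a1 * b1 := thb_sq.
have DA : 2 * (a * fD a) = 2 * (a1 * fD a1 + b1 * fD b1).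
  by have := congr1 (@fD _) A; rewrite fDD !fDX !expr1 => E; rewrite mulrA E; ring.
have DB : 2 * (b * fD b) = 2 * (a1 * fD b1 + b1 * fD a1).
  have := congr1 (@fD _) B; rewrite fDX !expr1 !fDM fD_nat => E.
  by rewrite mulrA E; ring.
have {}DA := fps_int_mulI DA; have {}DB := fps_int_mulI DB.
pose dl := wron a b - a * b * (a ^+ 4 - b ^+ 4).
have key : a * b * dl = (a1 ^+ 2 - b1 ^+ 2) * (2 * sub 2 dl).
  have -> : 2 * sub 2 dl = wron a1 b1 - 2 * (a1 * b1 * (a1 ^+ 4 - b1 ^+ 4)).
    have E : sub 2 (a * b * (a ^+ 4 - b ^+ 4)) = a1 * b1 * (a1 ^+ 4 - b1 ^+ 4).
      by rewrite subM // subM // subD subN subX // subX.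
    by rewrite wron_sub2 /dl subD subN E; ring.
  have -> : a * b * dl = a ^+ 2 * (b * fD b) - b ^+ 2 * (a * fD a)
      - a ^+ 2 * b ^+ 2 * ((a ^+ 2) ^+ 2 - (b ^+ 2) ^+ 2) by rewrite /dl /wron; ring.
  by rewrite DA DB A B /wron; ring.
suff E : dl = 0 by move/eqP: E; rewrite subr_eq0 => /eqP.
have a0 : co a 0 = 1 := co_tha0.
have b0 : co b 0 = 0 := co_thb0.
have b1E : co b 1 = 2 := co_thb1.
have ab0 : co (a * b) 0 = 0 by rewrite co0M b0 mulr0.
have ab1 : co (a * b) 1 = 2.
  by rewrite co1M b0 b1E a0 mulr0 addr0 mul1r.
have s0 : co (a1 ^+ 2 - b1 ^+ 2) 0 = 1.
  by rewrite coB !co0X (co0sub 2 a) (co0sub 2 b) a0 b0 expr1n expr0n subr0.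
apply: fpsP => n; elim/ltn_ind: n => n IH; rewrite co0.
have sub0 k : (k < n.*2)%N -> co (sub 2 dl) k = 0.
  move=> kn; rewrite co_sub; case: ifP => // /dvdnP[j Ej]; rewrite Ej mulnK //.
  by apply: IH; lia.
case: n IH sub0 => [|[|n]] IH sub0.
- have := congr1 (co^~ 0%N) key; rewrite [co (a * b * dl) 0]co0M ab0 mul0r.
  by rewrite co0M s0 mul1r co_natl co0sub; lia.
(* Coefficient 2 of [key] is the tautology [2 dl_1 = 2 dl_1], so [dl_1] is computed from the
   definition. *)
- rewrite /dl /wron !coB [co (a * b * _) 1]co1M ab0 ab1 mul0r add0r.
  rewrite coB !co0X a0 b0 expr1n expr0n subr0 !co1M !co_fD b0 b1E a0.
  by rewrite mulr0n mulr1n mul0r !mulr0; lia.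
- have := congr1 (co^~ n.+3) key.
  have -> : co ((a1 ^+ 2 - b1 ^+ 2) * (2 * sub 2 dl)) n.+3 = 0.
    rewrite coM big1 // => i _; rewrite co_natl sub0 ?mulr0 //; lia.
  rewrite coM 2!big_ord_recl big1 => [|i _].
    change (co (a * b) 0 * co dl n.+3 + (co (a * b) 1 * co dl n.+2 + 0) = 0 ->
      co dl n.+2 = 0).
    by rewrite ab0 ab1; lia.
  by rewrite IH ?mulr0 //= /bump /=; lia.
Qed.

(** * Product formulas and the generating function of b_4 *)

Definition geo (d : nat) : fps int := Fps (fun n => (d %| n)%N%:R).

Lemma geoE d : (0 < d)%N -> (1 - X int ^+ d) * geo d = 1.
Proof.
move=> d0; apply: fpsP => n; rewrite mulrBl mul1r coB coXnM co1.
case: ltnP => nd; last first.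
  by rewrite /= dvdn_subl // subrr; case: eqP nd => // ->; rewrite leqNgt d0.
rewrite subr0 /=; case: n nd => [|n] nd; first by rewrite dvdn0.
by rewrite gtnNdvd.
Qed.

Definition odf k : fps int := 1 - X int ^+ k.*2.+1.
Definition evf k : fps int := 1 - X int ^+ k.*2.+2.
(** The product of [(1 - q^(2k+2)) / (1 - q^(2k+1))] over [s <= k < n]. *)
Definition prt n s : fps int := \prod_(s <= k < n) (evf k * geo k.*2.+1).

Lemma prt_recr n s : (s <= n)%N -> odf n * prt n.+1 s = evf n * prt n s.
Proof.
move=> sn; rewrite /prt big_nat_recr //= mulrC -!mulrA [geo _ * _]mulrC geoE // mulr1.
by rewrite mulrC.
Qed.
Lemma prt_recl n s : (s < n)%N -> odf s * prt n s = evf s * prt n s.+1.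
Proof.
by move=> sn; rewrite /prt big_ltn // mulrA mulrCA geoE // mulr1.
Qed.
Lemma prtnn n : prt n n = 1.
Proof. by rewrite /prt big_geq. Qed.

(* Shanks' finite form of Gauss' product for psi; the sums telescope. *)
Lemma shanks n : \sum_(s < n) prt n s * X int ^+ (s * n.*2.+1) =
  \sum_(s < n.*2) X int ^+ 'C(s.+1, 2).
Proof.
elim: n => [|n IH]; first by rewrite !big_ord0.
pose T s := prt n.+1 s * X int ^+ (s * n.+1.*2.+1).
pose t s := prt n s * X int ^+ (s * n.*2.+1).
pose h s := prt n s * (1 - X int ^+ s.*2) * X int ^+ (s * n.*2.+1).
have step s : (s <= n)%N -> odf n * (T s - t s) =
    odf s * prt n s * X int ^+ (s.+1 * n.*2.+1) - h s.
  move=> sn; rewrite mulrBr /T mulrA prt_recr // /t /h /evf /odf.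
  have -> : (s * n.+1.*2.+1 = s * n.*2.+1 + s.*2)%N by lia.
  have -> : (s.+1 * n.*2.+1 = s * n.*2.+1 + n.*2.+1)%N by lia.
  rewrite (exprS _ n.*2.+1) (exprS _ s.*2) !exprD; ring.
have tel j : (j <= n)%N -> odf n * \sum_(s < j) (T s - t s) = h j.
  elim: j => [|j IHj] jn.
    by rewrite big_ord0 mulr0 /h expr0 subrr mulr0 mul0r.
  rewrite big_ord_recr /= mulrDr IHj ?step 1?prt_recl //; try lia.
  by rewrite addrC subrK /h /evf; ring.
have E : \sum_(s < n.+1) (T s - t s) = X int ^+ (n.+1 * n.*2.+1).
  apply: (@fps_cancel _ _ _ (odf n)).
    by rewrite /odf coB co1 coXn subr0.
  by rewrite big_ord_recr /= mulrDr tel // step // prtnn mulr1 addrC subrK.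
rewrite doubleS [in RHS]big_ord_recr [in RHS]big_ord_recr /= -IH.
have -> : 'C(n.*2.+2, 2) = (n.+1 * n.*2.+1)%N by have := triE n.*2.+1; lia.
have -> : 'C(n.*2.+1, 2) = (n * n.*2.+1)%N by have := triE n.*2; lia.
rewrite -E big_split /= sumrN.
by rewrite [X in _ - X]big_ord_recr /= /t prtnn mul1r; ring.
Qed.

(** In [shanks] every term with [s >= 1] is divisible by [q^(2n+1)], so modulo [q^(2n)] only the
    product [prt n 0] is left. *)
Lemma psi_prod n :
  eqmod n.*2 (psi * \prod_(k < n) odf k) (\prod_(k < n) evf k).
Proof.
have E : eqmod n.*2 psi (prt n 0).
  apply: (@eqmod_trans _ _ (\sum_(s < n.*2) X int ^+ 'C(s.+1, 2))).
    by apply: eqmod_gs; apply: tri_ge.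
  rewrite -shanks; case: n => [|n] //; rewrite big_ord_recl mul0n expr0 mulr1 => i iN.
  rewrite coD co_sum big1 ?addr0 // => s _.
  by rewrite mulrC coXnM ifT //= /bump /=; nia.
have <- : prt n 0 * \prod_(k < n) odf k = \prod_(k < n) evf k; last exact: eqmodM.
rewrite /prt big_mkord -big_split /=; apply: eq_bigr => k _.
by rewrite mulrAC -mulrA geoE // mulr1.
Qed.

(** Lists the partitions of [n] into parts at most [k] and not divisible by 4. The argument [f] is
    fuel; any [f > k + n] is enough. *)
Fixpoint pl (f k n : nat) : seq (seq nat) :=
  if f isn't f'.+1 then [::] else
  if k isn't k'.+1 then (if n == 0%N then [:: [::]] else [::]) else
  pl f' k' n ++
  (if (k'.+1 <= n)%N && ~~ (4 %| k'.+1)%N then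
     map (cons k'.+1) (pl f' k'.+1 (n - k'.+1)) else [::]).

Lemma plS f k n : pl f.+1 k.+1 n = pl f k n ++
  (if (k.+1 <= n)%N && ~~ (4 %| k.+1)%N then
     map (cons k.+1) (pl f k.+1 (n - k.+1)) else [::]).
Proof. by []. Qed.

Lemma pl_fuel f g k n : (k + n < f)%N -> (k + n < g)%N -> pl f k n = pl g k n.
Proof.
elim: f g k n => // f IH [|g] // [|k] n //= fk gk; congr (_ ++ _).
  by apply: IH; lia.
by case: ifP => // /andP[kn _]; rewrite (IH g) //; lia.
Qed.

Lemma geq_trans : transitive geq.
Proof. by move=> a b c /= ba cb; apply: leq_trans cb ba. Qed.

Lemma mem_pl f k n s : (k + n < f)%N ->
  s \in pl f k n = [&& is_partition n s, all (fun d => ~~ (4 %| d)%N) s &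
                       all (fun d => d <= k)%N s].
Proof.
elim: f k n s => // f IH [|k] n s fk.
  case: s => [|x s] /=.
    by rewrite /is_partition /=; case: n {fk} => [|n] /=; rewrite ?inE.
  have -> : ((x :: s) \in (if n == 0%N then [:: [::]] else [::])) = false by case: ifP.
  symmetry; apply/negP => /and3P[/and3P[_ + _] _ /andP[x0 _]].
  by rewrite inE; case: x x0.
rewrite /= mem_cat IH; last by lia.
have part_cons m x t : is_partition m (x :: t) =
    [&& (0 < x)%N, (x <= m)%N, all (fun d => d <= x)%N t & is_partition (m - x) t].
  rewrite /is_partition /= (path_sortedE geq_trans) inE negb_or eq_sym -lt0n.
  apply/and3P/and4P => [[/andP[st so] /andP[x0 z] /eqP E]|[x0 xm st /and3P[so z /eqP E]]].
    by split=> //; [lia|apply/and3P; split=> //; lia].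
  by split; [apply/andP|apply/andP|lia].
case: s => [|x s].
  rewrite /= andbT; case: (boolP (is_partition n [::])) => //= _.
  by apply/negP; case: ifP => // _ /mapP[? _ //].
apply/orP/and3P => [[|]|[part q4 le]].
- case/and3P => part q4 le; split=> //; apply: sub_all le => d; lia.
- case: ifP => // /andP[kn k4] /mapP[s' + [-> ->]].
  rewrite IH; last by lia.
  case/and3P => part q4 le; split; rewrite ?part_cons /= ?k4 ?leqnn ?kn //=.
  by rewrite le part.
move: part; rewrite part_cons => /and4P[x0 xn sx part].
move: q4 le => /= /andP[x4 q4] /andP[xk le].
case: (leqP x k) => xk'.
  left; apply/and3P; split; rewrite ?part_cons /= ?x0 ?xn ?sx ?part ?x4 ?q4 ?xk' //=.
  by apply: sub_all sx => d; lia.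
have E : x = k.+1 by lia.
right; rewrite -E xn x4 /=; apply: map_f; rewrite IH; last by lia.
by rewrite part q4 /= E.
Qed.

Lemma pl_uniq f k n : (k + n < f)%N -> uniq (pl f k n).
Proof.
elim: f k n => // f IH [|k] n fk /=; first by case: ifP.
rewrite cat_uniq IH /=; last by lia.
apply/andP; split; last first.
  by case: ifP => // /andP[kn _]; rewrite map_inj_uniq ?IH //; [lia|move=> ? ? []].
apply/hasPn => s; case: ifP => // _ /mapP[s' _ ->]; apply/negP.
rewrite mem_pl; last by lia.
by case/and3P => _ _ /=; rewrite ltnn.
Qed.

Lemma b4_natE n : b4_nat n = size (pl (n + n).+1 n n).
Proof.
rewrite /b4_nat cardE -(size_map (fun s : n.-bseq 'I_n.+1 => [seq val i | i <- s])).
apply: perm_size; apply: uniq_perm => [| |s].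
- rewrite map_inj_uniq ?enum_uniq // => s t /(inj_map val_inj) st.
  exact: val_inj.
- exact: pl_uniq.
rewrite mem_pl //; apply/mapP/and3P => [[t]|[part q4 _]].
  rewrite mem_enum inE => /andP[part q4] ->; split=> //.
  by apply/allP => d dt; have := is_partition_part part dt.
have sz : (size [seq inord x : 'I_n.+1 | x <- s] <= n)%N.
  by rewrite size_map; apply: is_partition_size part.
have E : [seq val i | i <- [seq inord x : 'I_n.+1 | x <- s]] = s.
  rewrite -map_comp -[RHS]map_id; apply/eq_in_map => d ds /=.
  by rewrite inordK //; apply: is_partition_part part ds.
exists (Bseq sz); last by rewrite /= E.
by rewrite mem_enum inE /= E part.
Qed.

Definition Bk (k : nat) : fps int := Fps (fun n => (size (pl (k + n).+1 k n))%:R).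
Definition Bgf : fps int := Fps (fun n => (b4_nat n)%:R).
Definition no4 k := ~~ (4 %| k.+1)%N.

Lemma Bk0 : Bk 0 = 1.
Proof. by apply: fpsP => -[|n]. Qed.

Lemma BkS k : Bk k.+1 = Bk k + (if no4 k then X int ^+ k.+1 * Bk k.+1 else 0).
Proof.
apply: fpsP => n; rewrite coD.
have -> : co (Bk k.+1) n = (size (pl (k.+1 + n).+1 k.+1 n))%:R by [].
rewrite plS size_cat natrD; congr (_ + _).
rewrite -/(no4 k); case: (no4 k); last by rewrite andbF.
rewrite andbT coXnM; case: (leqP k.+1 n) => kn //.
change ((size (map (cons k.+1) (pl (k.+1 + n) k.+1 (n - k.+1))))%:R =
  co (Bk k.+1) (n - k.+1)); rewrite size_map.
have -> : co (Bk k.+1) (n - k.+1) =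
  (size (pl (k.+1 + (n - k.+1)).+1 k.+1 (n - k.+1)))%:R by [].
by rewrite (@pl_fuel (k.+1 + n) (k.+1 + (n - k.+1)).+1) //; lia.
Qed.

Lemma Bk_prod M : Bk M * \prod_(k < M | no4 k) (1 - X int ^+ k.+1) = 1.
Proof.
elim: M => [|M IH]; first by rewrite big_ord0 mulr1 Bk0.
rewrite big_mkcond big_ord_recr /= -big_mkcond /=.
have := BkS M; case: (no4 M) => E; last by rewrite E addr0 mulr1 IH.
rewrite mulrCA [_ * (1 - _)]mulrC mulrBl mul1r {1}E addrK mulrC; exact: IH.
Qed.

Lemma Bgf_Bk M : eqmod M.+1 Bgf (Bk M).
Proof.
have st k n : (n <= k)%N -> co (Bk k.+1) n = co (Bk k) n.
  move=> nk; rewrite BkS coD; case: ifP => _; last by rewrite co0 addr0.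
  by rewrite coXnM ltnS nk addr0.
have {}st k n : (n <= k)%N -> co (Bk k) n = co (Bk n) n.
  move=> nk; rewrite -(subnK nk); elim: (k - n)%N => // j IHj.
  by rewrite addSn st ?IHj // leq_addl.
by move=> n nM; rewrite (st M) // /Bk /= b4_natE.
Qed.

(** The logarithmic derivative of the product for [Bgf]. Multiplied by 8, its coefficients are the
    representation numbers of the four square theorem. *)
Definition Lam : fps int :=
  Fps (fun n => \sum_(k < n | (k.+1 %| n)%N && no4 k) k.+1%:R).

Definition Lamk M : fps int :=
  \sum_(k < M | no4 k) k.+1%:R * X int ^+ k.+1 * geo k.+1.

Lemma Lam_Lamk M : eqmod M.+1 Lam (Lamk M).
Proof.
move=> n nM; rewrite /Lamk co_sum.
have E k : co (k.+1%:R * X int ^+ k.+1 * geo k.+1) n =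
    if (k < n)%N && (k.+1 %| n)%N then k.+1%:R else 0.
  rewrite -mulrA co_natl coXnM ltnNge; case: (leqP k.+1 n) => kn /=; last by rewrite mulr0.
  by rewrite dvdn_subl //; case: ifP; rewrite ?mulr1 ?mulr0.
under eq_bigr do rewrite E.
rewrite -(big_mkord no4 (fun k => if (k < n)%N && (k.+1 %| n)%N then k.+1%:R else 0)).
rewrite (@big_cat_nat _ _ _ n) //=.
rewrite [X in _ + X]big_nat_cond [X in _ + X]big1 ?addr0 => [|k /andP[/andP[nk _] _]].
  rewrite -(big_mkord (fun k => (k.+1 %| n)%N && no4 k) (fun k => k.+1%:R)).
  rewrite big_mkcond [RHS]big_mkcond !big_nat; apply: eq_bigr => k /andP[_ kn].
  by rewrite kn; case: (k.+1 %| n)%N; case: no4.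
by rewrite ltnNge nk.
Qed.

Lemma fD_Bgf : fD Bgf = Lam * Bgf.
Proof.
have fDgeo d : (0 < d)%N -> fD (1 - X int ^+ d) = - (d%:R * X int ^+ d * geo d) * (1 - X int ^+ d).
  case: d => // d _; have := @geoE d.+1 isT.
  rewrite fDD fD1 fDN add0r => E.
  have -> : fD (X int ^+ d.+1) = d.+1%:R * X int ^+ d.+1.
    apply: fpsP => n; rewrite co_fD co_natl coXn.
    by case: eqP => [->|]; rewrite ?mul0rn ?mulr0 ?mulr1.
  move: E; move: (X int ^+ d.+1) (geo d.+1) (d.+1%:R : fps int) => a g c E.
  by transitivity (- (c * a) * ((1 - a) * g)); [rewrite E mulr1|ring].
apply: eqmod_eq => M.
have DB : fD (Bk M) = Lamk M * Bk M.
  have B0 := Bk_prod M; set P := \prod_(_ < _ | _) _ in B0.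
  have DP : fD P = - Lamk M * P.
    rewrite /P (@fD_prod_log _ _ _ _ _ (fun k : 'I_M => - (k.+1%:R * X int ^+ k.+1 * geo k.+1))).
      by rewrite sumrN.
    by move=> k _; apply: fDgeo.
  apply: (@fps_cancel _ _ _ P).
    by apply: co0_prod => k _; rewrite coB co1 coXn subr0.
  have := congr1 (@fD _) B0; rewrite fDM fD1 DP => E.
  have -> : P * fD (Bk M) = (fD (Bk M) * P + Bk M * (- Lamk M * P)) + P * (Lamk M * Bk M).
    by ring.
  by rewrite E add0r.
apply: (@eqmod_trans _ _ (fD (Bk M))).
  by move=> n nM; rewrite !co_fD (@Bgf_Bk M) // ltnS ltnW.
rewrite DB; apply: eqmodM; apply: eqmod_sym; apply: (@eqmodW _ M.+1) => //.
  exact: Lam_Lamk.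
exact: Bgf_Bk.
Qed.

Lemma sum_double_prod (R : comNzRingType) (F : nat -> R) M :
  \prod_(k < M.*2) F k = \prod_(k < M) (F k.*2 * F k.*2.+1).
Proof.
elim: M => [|M IH]; first by rewrite !big_ord0.
by rewrite doubleS !big_ord_recr /= IH mulrA.
Qed.

Lemma co0_odf k : co (odf k) 0 = 1.
Proof. by rewrite coB co1 coXn subr0. Qed.
(** All series are infinite products. Modulo [q^(4n)], the factors are grouped as [al] for
    [1 - q^odd], [al'] for [1 + q^odd], [be] for [1 - q^(4k+2)] and [ga] for [1 - q^(4k+4)]; [E1] to
    [E4] are the relations among them. *)
Lemma Bgf_psi : Bgf * ftw psi = sub 2 psi.
Proof.
apply: eqmod_eq => n; apply: (@eqmodW _ (4 * n)%N); first by lia.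
pose al := \prod_(k < n.*2) odf k; pose al' := \prod_(k < n.*2) ftw (odf k).
pose be := \prod_(k < n) sub 2 (odf k); pose ga := \prod_(k < n) sub 2 (evf k).
have sub_odf k : sub 2 (odf k) = 1 - X int ^+ (k.*2.+1).*2.
  by rewrite subD subN sub1 // subXn // mul2n.
have sub_evf k : sub 2 (evf k) = 1 - X int ^+ (k.*2.+2).*2.
  by rewrite subD subN sub1 // subXn // mul2n.
have E1 : eqmod (4 * n) (ftw psi * al') (be * ga).
  have -> : be * ga = ftw (\prod_(k < n.*2) evf k).
    rewrite ftw_prod /be /ga -big_split /= (sum_double_prod (fun k => ftw (evf k))).
    have ftw_evf k : ftw (evf k) = 1 - X int ^+ k.+1.*2.
      rewrite /evf -doubleS ftwD ftwN ftw1 ftwXn -signr_odd odd_double expr0 mul1r.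
      by [].
    by apply: eq_bigr => k _; rewrite sub_odf sub_evf !ftw_evf.
  rewrite /al' -ftw_prod -ftwM; apply: eqmod_ftw.
  by have := @psi_prod n.*2; rewrite -!muln2 -mulnA mulnC.
have E2 : eqmod (4 * n) (sub 2 psi * be) ga.
  rewrite /be /ga -!sub_prod // -subM //.
  by have := eqmod_sub (k := 2) isT (@psi_prod n); rewrite -muln2 mulnCA mulnC.
have E3 : eqmod (4 * n) (Bgf * (al * be)) 1.
  have -> : al * be = \prod_(k < 4 * n | no4 k) (1 - X int ^+ k.+1).
    rewrite /al (sum_double_prod (fun k => odf k)) /be -big_split /=.
    elim: n {al al' be ga E1 E2} => [|n IH]; first by rewrite muln0 !big_ord0.
    have -> : (4 * n.+1 = (4 * n).+4)%N by lia.
    rewrite big_ord_recr IH [in RHS]big_mkcond [in RHS]big_ord_recr [in RHS]big_ord_recr.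
    rewrite [in RHS]big_ord_recr [in RHS]big_ord_recr [in LHS]big_mkcond /=.
    rewrite sub_odf /no4 /odf (_ : (4 %| (4 * n).+1) = false)%N; last by lia.
    rewrite (_ : (4 %| (4 * n).+2) = false)%N; last by lia.
    rewrite (_ : (4 %| (4 * n).+3) = false)%N; last by lia.
    rewrite (_ : (4 %| (4 * n).+4) = true)%N; last by lia.
    have -> : (n.*2.*2.+1 = (4 * n).+1)%N by lia.
    have -> : (n.*2.+1.*2.+1 = (4 * n).+3)%N by lia.
    have -> : (n.*2.+1.*2 = (4 * n).+2)%N by lia.
    by rewrite /=; ring.
  apply: (@eqmod_trans _ _ (Bk (4 * n) * \prod_(k < 4 * n | no4 k) (1 - X int ^+ k.+1)));
    last by rewrite Bk_prod.
  apply: eqmodM => //.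
  by apply: (@eqmodW _ (4 * n).+1) => //; apply: Bgf_Bk.
have E4 : eqmod (4 * n) (al * al') be.
  have -> : al * al' = \prod_(k < n.*2) sub 2 (odf k).
    rewrite /al /al' -big_split /=; apply: eq_bigr => k _.
    rewrite sub_odf /odf ftwD ftwN ftw1 ftwXn -(signr_odd _ k.*2.+1) oddS odd_double expr1.
    by rewrite -(addnn k.*2.+1) exprD; ring.
  (* The factors with index at least [n] have exponent above [4n] and count as 1. *)
  rewrite -addnn big_split_ord /= -[X in eqmod _ _ X]mulr1; apply: eqmodM => //.
  elim/big_rec: _ => // i f _ IH; rewrite -[X in eqmod _ _ X]mulr1; apply: eqmodM => //.
  rewrite sub_odf => k kn; rewrite coB coXn; case: eqP; last by rewrite subr0.
  by lia.
apply: (@eqmod_cancel _ _ _ _ (al * be * al')).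
  rewrite !co0M !co0_prod ?mulr1 // => k _; rewrite ?co0sub ?co0_odf //.
  by rewrite co_ftw mul1r co0_odf.
apply: (@eqmod_trans _ _ (be * ga)).
  rewrite (_ : _ * _ = (Bgf * (al * be)) * (ftw psi * al')); last by ring.
  by rewrite -[X in eqmod _ _ X]mul1r; apply: eqmodM.
apply: eqmod_sym.
rewrite (_ : _ * sub 2 psi = (al * al') * (sub 2 psi * be)); last by ring.
exact: eqmodM.
Qed.

Lemma Bgf_phi : Bgf * ftw phi = ftw psi.
Proof.
apply: (@fps_cancel _ _ _ (sub 2 psi)); first by rewrite co0sub co_psi0.
have E : ftw psi ^+ 2 = ftw phi * sub 2 psi.
  by rewrite -ftwX psi_sq ftwM (@ftw_sub_even _ 2).
by rewrite mulrC -mulrA -E expr2 mulrA Bgf_psi.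
Qed.

(** * The series x, y and F, their algebraic relations, and the four square theorem *)

HB.lock Definition xx : fps int := sub 8 tha.
HB.lock Definition yy : fps int := sub 8 thb.
(** [kap = q^2 psi(q^16)] and [tht = q psi(-q^8)], of weight 1/2, are the theta series in front of
    the polynomial in the final form. *)
HB.lock Definition kap : fps int := sub 2 om.
HB.lock Definition tht : fps int := X int * sub 8 (ftw psi).
HB.lock Definition Fb : fps int := X int * sub 8 Bgf.

Lemma xDy : xx + yy = sub 8 phi. Proof. by rewrite xx.unlock yy.unlock -subD -phiD. Qed.
Lemma xBy : xx - yy = sub 8 (ftw phi). Proof. by rewrite xx.unlock yy.unlock -subN -subD -phiB. Qed.
Lemma co_xBy0 : co (xx - yy) 0 = 1.
Proof. by rewrite xBy co0sub phiB coB co_tha0 co_thb0 subr0. Qed.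
Lemma Fb_tht : Fb * (xx - yy) = tht.
Proof. by rewrite xBy Fb.unlock tht.unlock -mulrA -subM // Bgf_phi. Qed.

Lemma kapE : kap = X int ^+ 2 * sub 16 psi.
Proof. by rewrite kap.unlock /om (@subM _ 2 (X int)) // sub_sub // sub_X. Qed.

Lemma tht_sq : tht ^+ 2 = (xx - yy) * kap.
Proof.
rewrite xBy kapE tht.unlock exprMn -subX // -ftwX psi_sq ftwM (@ftw_sub_even _ 2) //.
by rewrite subM // sub_sub //; ring.
Qed.

Lemma Fb_sq : Fb ^+ 2 * (xx - yy) = kap.
Proof.
apply: (@fps_cancel _ _ _ (xx - yy) co_xBy0); rewrite -tht_sq -Fb_tht; ring.
Qed.

(** Since [2 kap = thb(q^2)], the duplication formulas at [q^2] and then at [q^4] lead to [q^8],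
    where [xx] and [yy] live. *)
Lemma kap4 : 2 * kap ^+ 4 = xx * yy * (xx ^+ 2 + yy ^+ 2).
Proof.
have K : 2 * kap = sub 2 thb by rewrite thb.unlock kap.unlock subM // sub_nat.
have E1 : sub 2 thb ^+ 2 = 2 * sub 4 tha * sub 4 thb.
  by rewrite -subX // thb_sq !subM // sub_nat // ?xx.unlock ?yy.unlock !sub_sub.
have E2 : sub 4 tha ^+ 2 = xx ^+ 2 + yy ^+ 2.
  by rewrite -subX // tha_sq subD !subX // xx.unlock yy.unlock !sub_sub.
have E3 : sub 4 thb ^+ 2 = 2 * xx * yy.
  by rewrite -subX // thb_sq !subM // sub_nat // ?xx.unlock ?yy.unlock !sub_sub.
apply: (@fps_int_mulI 7).
have -> : 8 * (2 * kap ^+ 4) = ((2 * kap) ^+ 2) ^+ 2 by ring.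
rewrite K E1 (_ : _ ^+ 2 = 4 * sub 4 tha ^+ 2 * sub 4 thb ^+ 2); last by ring.
by rewrite E2 E3; ring.
Qed.

Lemma wron_xy : wron xx yy = 8 * (xx * yy * (xx ^+ 4 - yy ^+ 4)).
Proof.
have -> : wron xx yy = 8 * sub 8 (wron tha thb).
  by rewrite /wron xx.unlock yy.unlock !fD_sub // subD subN !subM //; ring.
rewrite wron_theta xx.unlock yy.unlock; congr (_ * _).
by rewrite subM // subM // subD subN subX // subX.
Qed.

Lemma xx_neq0 : xx != 0.
Proof.
by apply/eqP => /(congr1 (co^~ 0%N)) /eqP; rewrite xx.unlock co0sub co_tha0.
Qed.

Lemma yy_neq0 : yy != 0.
Proof.
apply/eqP => /(congr1 (co^~ 8%N)) /eqP.
by rewrite yy.unlock co_sub [(8 %| 8)%N]/= [(8 %/ 8)%N]/= co_thb1.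
Qed.

(** The relation [2 F^8 (x - y)^4 = x y (x^2 + y^2)] is differentiated. After elimination of [F^8],
    the derivatives of [x] and [y] occur only through the Wronskian, which is a polynomial. *)
Lemma fD_Fb : fD Fb = (xx + yy) ^+ 4 * Fb.
Proof.
set x := xx; set y := yy.
pose c := x * y * (x ^+ 2 + y ^+ 2).
have c8 : c = 2 * Fb ^+ 8 * (x - y) ^+ 4.
  by rewrite /c /x /y -kap4 -Fb_sq; ring.
have Dc : fD c = 16 * Fb ^+ 7 * fD Fb * (x - y) ^+ 4 +
                 8 * Fb ^+ 8 * (x - y) ^+ 3 * (fD x - fD y).
  by rewrite c8 (fDM (2 * Fb ^+ 8)) (fDM 2) fD_nat !fDX fDD fDN; ring.
have Dc' : fD c = (3 * x ^+ 2 * y + y ^+ 3) * fD x + (x ^+ 3 + 3 * x * y ^+ 2) * fD y.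
  by rewrite /c (fDM (x * y)) (fDM x) fDD !fDX !expr1; ring.
have W := wron_xy; rewrite -/x -/y /wron in W.
have cn0 : 8 * (c * (x - y)) != 0.
  apply/eqP => /(@fps_domain _)[/(congr1 (co^~ 0%N))|].
    by rewrite co_nat.
  case/(@fps_domain _)=> [|/(congr1 (co^~ 0%N)) /eqP]; last by rewrite co_xBy0.
  case/(@fps_domain _)=> [|/(congr1 (co^~ 0%N)) /eqP].
    by case/(@fps_domain _)=> /eqP; apply/negP; rewrite ?xx_neq0 ?yy_neq0.
  by rewrite coD !co0X /x /y xx.unlock yy.unlock !co0sub co_tha0 co_thb0.
apply: (fps_mulIf cn0).
have -> : 8 * (c * (x - y)) * fD Fb =
    Fb * ((x - y) * fD c - 4 * c * (fD x - fD y)).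
  by rewrite Dc c8; ring.
rewrite Dc'.
have -> : (x - y) * ((3 * x ^+ 2 * y + y ^+ 3) * fD x + (x ^+ 3 + 3 * x * y ^+ 2) * fD y)
   - 4 * c * (fD x - fD y) = (x + y) ^+ 3 * (x * fD y - y * fD x).
  by rewrite /c; ring.
by rewrite W /c; ring.
Qed.

(** At [q^8], both sides are the logarithmic derivative of [Fb]: the left one by [fD_Fb], the right
    one by [fD_Bgf]. *)
Lemma four_squares : phi ^+ 4 = 1 + 8 * Lam.
Proof.
apply: (@sub_inj _ 8) => //; rewrite subX // -xDy.
have Fn0 : Fb != 0.
  apply/eqP => /(congr1 (co^~ 1%N)) /eqP.
  rewrite Fb.unlock -[X int]expr1 coXnM ltnn subnn co0sub co0.
  by have := @Bgf_Bk 0 0 isT => ->.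
apply: (fps_mulIf Fn0); rewrite mulrC -fD_Fb Fb.unlock fDM fD_sub // fD_Bgf subM //.
have -> : fD (X int) = X int.
  by apply: fpsP => n; rewrite co_fD -[X int]expr1 coXn; case: eqP => [->|]; rewrite ?mul0rn.
by rewrite subD subM // sub1 // sub_nat //; ring.
Qed.

(** * The operator U_m modulo m *)

Lemma coef_linX (R : comNzRingType) (a b : R) n j :
  ((a *: 'X + b%:P) ^+ n)`_j = a ^+ j * b ^+ (n - j) *+ 'C(n, j).
Proof.
rewrite addrC exprDn coef_sum; case: (ltnP j n.+1) => jn; last first.
  rewrite bin_small // mulr0n big1 // => i _.
  rewrite coefMn exprZn -scalerAr coefZ -polyC_exp coefCM coefXn.
  by case: eqP => [E|_]; rewrite ?mulr0 ?mul0rn //; have := ltn_ord i; lia.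
rewrite (bigD1 (Ordinal jn)) //= big1 ?addr0 => [|i /eqP ij];
  rewrite coefMn exprZn -scalerAr coefZ -polyC_exp coefCM coefXn.
  by rewrite eqxx mulr1.
by case: eqP => [E|_]; rewrite ?mulr0 ?mul0rn //; case: ij; apply: val_inj.
Qed.

(* Constant term in w of ((s - t w)(s - t / w))^n, expanded in two ways. *)
Lemma landen_identity (R : comNzRingType) (s t : R) n :
  \sum_(i < n.+1) 'C(n, i)%:R * ((-1) ^+ i * 'C(i.*2, i)%:R) * (s * t) ^+ i
     * (s + t) ^+ (n - i).*2 =
  \sum_(i < n.+1) 'C(n, i)%:R ^+ 2 * s ^+ (n - i).*2 * t ^+ i.*2.
Proof.
(* [(s X - t)(s - t X) = X (s + t)^2 - s t (1 + X)^2]. After multiplication by [w^n] the constant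
   term in [w] is the coefficient of [X^n]. *)
have E : ('X * ((s + t) ^+ 2)%:P + (- (s * t))%:P * (1 *: 'X + 1%:P) ^+ 2) ^+ n =
         (s *: 'X + (- t)%:P) ^+ n * ((- t) *: 'X + s%:P) ^+ n :> {poly R}.
  rewrite -exprMn; congr (_ ^+ _); rewrite -!mul_polyC !polyCN !polyCM polyCD polyC1.
  by ring.
move/(congr1 (fun p : {poly R} => p`_n)): E.
rewrite exprDn coef_sum coefM => E.
transitivity (\sum_(i < n.+1) ((('X * ((s + t) ^+ 2)%:P) ^+ (n - i) *
    ((- (s * t))%:P * (1 *: 'X + 1%:P) ^+ 2) ^+ i) *+ 'C(n, i))`_n : R).
  apply: eq_bigr => i _; have iN : (i <= n)%N by have := ltn_ord i; lia.
  have EQ (a b : R) (Q : {poly R}) k l : ('X * a%:P) ^+ k * (b%:P * Q) ^+ l =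
      'X^k * ((a ^+ k * b ^+ l)%:P * Q ^+ l).
    by rewrite polyCM !polyC_exp !exprMn; ring.
  rewrite EQ -(exprM _ 2 i) mul2n.
  rewrite coefMn coefXnM ltnNge leq_subr subKn // coefCM coef_linX !expr1n mul1r.
  rewrite /= -exprM mul2n (exprNn (s * t)) -[RHS]mulr_natl.
  move: ((s + t) ^+ (n - i).*2) ((s * t) ^+ i) ((-1) ^+ i : R) ('C(n, i)%:R : R).
  by move: ('C(i.*2, i)%:R : R) => a b c d f; ring.
rewrite E (reindex_inj rev_ord_inj) /=.
apply: eq_bigr => i _; have iN : (i <= n)%N by have := ltn_ord i; lia.
rewrite !coef_linX subSS !subKn ?leq_subr // bin_sub // -mulr_natl -[X in _ * X]mulr_natl.
have <- : (- t) ^+ i * (- t) ^+ i = t ^+ i.*2 by rewrite -exprMn mulrNN -expr2 -exprM mul2n.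
by rewrite -addnn exprD; ring.
Qed.

(** The degree of [N1] in [main_mod]: the summands are the degrees of its factors, in order, the
    last one that of a power of the Hasse polynomial. *)
Lemma deg_arith1 m r e : (3 <= m)%N -> (r <= 4)%N -> (e <= m.-1)%N ->
  (m * r <= 4 * e + m.-1)%N ->
  (0 * m.-1 + 0 * e + (1 + 1 + 1 * 2) * (m.-1 - e) + 1 * (4 * e + m.-1 - m * r)
   + 1 * m.-1 + 2 * m.-1 * (m - 2) = m * (m.*2 - r) - 2)%N.
Proof.
case: m => [|[|[|k]]] // _ r4 ek mr; rewrite mulnBr -muln2 /= in mr *.
by rewrite (_ : k.+3 - 2 = k.+1)%N //; nia.
Qed.

Lemma deg_arith2 m r s : (s.+1 = r.*2)%N -> (s * m + m = (m * r).*2)%N.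
Proof. by move=> E; rewrite -mulSnr E -!muln2; lia. Qed.

Lemma deg_arith3 m r : (3 <= m)%N -> (r <= 4)%N -> (2 <= m * (m.*2 - r))%N.
Proof. by move=> m3 r4; nia. Qed.

(** Of the [m - 1] factors [c] in [w^(m-1)], [e] are traded for [2 F^8 d^4]. Then
    [F * F^(8e) = F^(s m)] is an [m]-th power, and [d^(r m)] is split off from the powers of [d]. *)
Lemma key_alg (S : comNzRingType) (F c d p w : S) m s e r :
  (0 < m)%N -> (e <= m.-1)%N -> (m * r <= 4 * e + m.-1)%N -> (s * m = 8 * e + 1)%N ->
  w = 8 * (c * (d * p)) -> c = 2 * F ^+ 8 * d ^+ 4 ->
  F * w ^+ m = (8 ^+ m.-1 * 2 ^+ e * c ^+ (m.-1 - e) * d ^+ (4 * e + m.-1 - m * r)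
    * p ^+ m.-1) * w * (F ^+ s * d ^+ r) ^+ m.
Proof.
move=> m0 em ex Es Ew Ec.
have -> : w ^+ m = w * w ^+ m.-1 by rewrite -exprS prednK.
have -> : w ^+ m.-1 = 8 ^+ m.-1 * (c ^+ m.-1 * (d ^+ m.-1 * p ^+ m.-1)).
  by rewrite {1}Ew !exprMn.
have -> : c ^+ m.-1 = c ^+ (m.-1 - e) * c ^+ e by rewrite -exprD subnK.
have gen (a b f : S) : (a * b * f) ^+ e = a ^+ e * b ^+ e * f ^+ e by rewrite !exprMn.
have -> : c ^+ e = 2 ^+ e * F ^+ (8 * e) * d ^+ (4 * e) by rewrite {1}Ec gen -!exprM.
have -> : (F ^+ s * d ^+ r) ^+ m = F ^+ (8 * e) * F * d ^+ (r * m).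
  by rewrite exprMn -!exprM Es exprD expr1.
have E2 : d ^+ (4 * e) * d ^+ m.-1 = d ^+ (4 * e + m.-1 - m * r) * d ^+ (r * m).
  by rewrite -!exprD; congr (_ ^+ _); lia.
move: E2; move: (d ^+ (4 * e)) (d ^+ m.-1) (d ^+ (4 * e + m.-1 - m * r)) (d ^+ (r * m)).
move=> d1 d2 d3 d4 E2.
move: (8 ^+ _ : S) (2 ^+ _ : S) (c ^+ _) (p ^+ _) (F ^+ _) => a1 a2 a3 a4 a5.
transitivity (F * (w * (a1 * (a3 * a2 * a5 * a4 * (d1 * d2))))); first by ring.
by rewrite E2; ring.
Qed.

Lemma pow_alg (S : comNzRingType) (F d : S) r : (0 < r)%N ->
  F ^+ (r.*2 - 1) * d ^+ r = F * d * (F ^+ 2 * d) ^+ r.-1.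
Proof.
case: r => // r _; rewrite doubleS subn1 /= exprMn -exprM mul2n !exprS.
by move: (F ^+ _) (d ^+ _) => a b; ring.
Qed.

Section ModM.
Variable m : nat.
Hypothesis m_prime : prime m.
Hypothesis m_ge3 : (3 <= m)%N.
Local Notation K := 'F_m.

Lemma m_odd : odd m.
Proof. by case: (even_prime m_prime) => // E; move: m_ge3; rewrite E. Qed.

Lemma m_gt0 : (0 < m)%N. Proof. exact: prime_gt0. Qed.

Lemma natr_K_eq0 k : (k%:R == 0 :> K) = (m %| k)%N.
Proof. by rewrite (dvdn_pcharf (pchar_Fp m_prime)). Qed.

Lemma frob_poly (p : {poly K}) : p ^+ m = p \Po 'X^m.
Proof.
have ch : m \in [pchar {poly K}] by rewrite pchar_poly; apply: pchar_Fp.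
elim/poly_ind: p => [|p c IH].
  by rewrite comp_poly0 expr0n; case: (m) m_gt0.
rewrite exprDn_pchar; last by rewrite pnatE //= ch.
rewrite exprMn IH comp_polyD comp_polyM comp_polyX comp_polyC; congr (_ + _).
by rewrite -polyC_exp; congr polyC; have := expf_card c; rewrite card_Fp.
Qed.

Lemma frob_fps (f : fps K) : f ^+ m = sub m f.
Proof.
apply: eqmod_eq => N; have tr := eqmod_trunc (N := N) f.
apply: (@eqmod_trans _ _ (of_poly (trunc N f) ^+ m)); first exact: eqmodX.
rewrite -rmorphXn /= frob_poly -sub_of_poly ?m_gt0 //; apply: eqmod_sym.
by apply: eqmod_subW => //; apply: m_gt0.
Qed.

Definition Um (f : fps K) : fps K := Fps (fun n => co f (m * n)%N).

Lemma co_Um f n : co (Um f) n = co f (m * n). Proof. by []. Qed.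
Lemma UmD f g : Um (f + g) = Um f + Um g. Proof. exact: fpsP. Qed.
Lemma UmB (f g : fps K) : Um (f - g) = Um f - Um g. Proof. exact: fpsP. Qed.
Lemma sum_dvd (V : zmodType) (G : nat -> V) n :
  \sum_(i < (m * n).+1) (if (m %| i)%N then G (i %/ m)%N else 0) = \sum_(j < n.+1) G j.
Proof.
have m0 := m_gt0; elim: n => [|n IH].
  by rewrite muln0 !big_ord_recl !big_ord0 /= dvdn0 div0n.
rewrite [RHS]big_ord_recr /= -IH mulnS addnC.
rewrite -(big_mkord xpredT (fun i => if (m %| i)%N then G (i %/ m)%N else 0)).
rewrite (@big_cat_nat _ _ _ (m * n).+1) //=; last by lia.
rewrite big_mkord; congr (_ + _).
rewrite big_nat_recr /=; last by lia.
rewrite -mulnSr dvdn_mulr // mulKn // big_nat big1 ?add0r // => i /andP[i1 i2].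
case: ifP => // /dvdnP[j Ej]; exfalso.
have j1 : (n < j)%N by rewrite -(ltn_pmul2l m0); lia.
have j2 : (j < n.+1)%N by rewrite -(ltn_pmul2l m0); lia.
by lia.
Qed.

Lemma Um_frob g h : Um (g * h ^+ m) = h * Um g.
Proof.
have m0 := m_gt0; rewrite frob_fps mulrC; apply: fpsP => n; rewrite !coM.
rewrite -(sum_dvd (fun i => co h i * co (Um g) (n - i))).
apply: eq_bigr => i _; rewrite co_sub; case: ifP => [/dvdnP[j ->]|]; last by rewrite mul0r.
by rewrite mulnK //= mulnBr (mulnC j).
Qed.

Lemma Um_fD g : Um (fD g) = 0.
Proof.
apply: fpsP => n; rewrite /= -mulr_natr.
have /eqP -> : (m * n)%:R == 0 :> K by rewrite natr_K_eq0 dvdn_mulr.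
by rewrite mulr0.
Qed.

Definition red : fps int -> fps K := fmap (intmul 1 : {rmorphism int -> K}).
HB.instance Definition _ :=
  GRing.RMorphism.copy red (fmap (intmul 1 : {rmorphism int -> K})).

(** Over the integers [f^(m-1) Df = D(f^m) / m], so its coefficient at [m j] is [j] times that of
    [f^m], and [f^m = f(q^m)] modulo [m]. The division by [m] is the reason for stating this on
    reductions of integral series. *)
Lemma red_log (f : fps int) : Um (red f ^+ m.-1 * fD (red f)) = fD (red f).
Proof.
have m0 := m_gt0; apply: fpsP => j.
pose c := co (f ^+ m.-1 * fD f) (m * j).
have Ec : c = co (f ^+ m) (m * j) *+ j.
  have := fDX f m.-1; rewrite prednK // -mulrA => /(congr1 (co^~ (m * j)%N)).
  rewrite co_natl co_fD -/c => E.
  have mn0 : m%:R != 0 :> int by rewrite pnatr_eq0 -lt0n.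
  by apply: (mulfI mn0); rewrite -E mulr_natl -mulrnA mulnC.
have -> : co (Um (red f ^+ m.-1 * fD (red f))) j = c%:~R.
  by rewrite /red -fmap_fD -rmorphXn -rmorphM.
have -> : (c%:~R : K) = (co (f ^+ m) (m * j))%:~R *+ j by rewrite Ec rmorphMn.
have -> : (co (f ^+ m) (m * j))%:~R = co (red f ^+ m) (m * j) :> K.
  by rewrite /red -rmorphXn.
by rewrite frob_fps co_sub dvdn_mulr // mulKn.
Qed.

(** The Hasse polynomial, of degree [2m - 2]. It is written in [a^2] and [b^2] because the
    duplication formulas give the squares. *)
Definition Hs (R : comNzRingType) (a b : R) : R :=
  \sum_(i < m./2.+1) 'C(m./2, i)%:R ^+ 2 * (a ^+ 2) ^+ (m./2 - i).*2 * (b ^+ 2) ^+ i.*2.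

Lemma half_m : m = m./2.*2.+1.
Proof. by rewrite -{1}(odd_double_half m) m_odd. Qed.

Lemma central_bin i : (i.+1 * 'C(i.+1.*2, i.+1) = (i.*2.+1).*2 * 'C(i.*2, i))%N.
Proof.
have E1 := mul_bin_diag i.*2.+2 i; have E2 := mul_bin_diag i.*2.+1 i.
have E3 : 'C(i.*2.+1, i) = 'C(i.*2.+1, i.+1).
  by rewrite -bin_sub; [congr ('C(_, _))|]; lia.
rewrite /= in E1 E2; rewrite doubleS -E1 E3.
apply/eqP; rewrite -(eqn_pmul2l (ltn0Sn i)); apply/eqP.
rewrite mulnCA -E2 -!muln2; move: 'C(_, _) => c; lia.
Qed.

(** Modulo [m], [m./2] is [-1/2], and the binomial coefficient of [-1/2] over [i] is
    [(-1/4)^i 'C(2i, i)]. *)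
Lemma bin_half_mod i : (i <= m./2)%N ->
  'C(m./2, i)%:R * 4 ^+ i = (-1) ^+ i * 'C(i.*2, i)%:R :> K.
Proof.
have hm := half_m; elim: i => [|i IH] im; first by rewrite !bin0 !expr0.
have i0 : i.+1%:R != 0 :> K.
  by rewrite natr_K_eq0; apply/negP => /dvdn_leq; lia.
apply: (mulfI i0).
rewrite mulrA -natrM mul_bin_left natrM exprS mulrCA -!mulrA [_ * 4 ^+ i]mulrC.
rewrite [4 ^+ i * _]mulrC IH; last by lia.
have E : 4 * (m./2 - i)%:R = - ((i.*2.+1).*2)%:R :> K.
  apply/eqP; rewrite -subr_eq0 opprK -[4]/(4%:R) -natrM -natrD natr_K_eq0.
  by apply/dvdnP; exists 2; lia.
have -> : i.+1%:R * ((-1) ^+ i.+1 * 'C(i.+1.*2, i.+1)%:R) =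
    - (-1) ^+ i * ((i.*2.+1).*2 * 'C(i.*2, i))%N%:R :> K.
  by rewrite -central_bin natrM exprS; ring.
by rewrite mulrA E natrM; ring.
Qed.

Definition cstK : K -> fps K := @of_poly K \o polyC.
HB.instance Definition _ := GRing.RMorphism.copy cstK (@of_poly K \o polyC).

Lemma co_cst a f n : co (cstK a * f) n = a * co f n.
Proof.
rewrite coM big_ord_recl big1 ?addr0 => [|i _]; first by rewrite /= coefC subn0.
by rewrite /= coefC mul0r.
Qed.

(** The factor [4^i] coming from [B^2 = 2 a b] turns one of the two binomials into a central one;
    what results is [landen_identity] for [s = a^2] and [t = b^2]. *)
Lemma Hs_landen (a b A B : fps K) : A ^+ 2 = a ^+ 2 + b ^+ 2 -> B ^+ 2 = 2 * a * b ->
  Hs A B = Hs a b.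
Proof.
move=> EA EB; rewrite [RHS]/Hs -landen_identity /Hs EA EB; apply: eq_bigr => i _.
have im : (i <= m./2)%N by have := ltn_ord i; lia.
have := congr1 cstK (bin_half_mod im).
rewrite !rmorphM !rmorphXn rmorphN1 !rmorph_nat => <-.
have -> : (2 * a * b) ^+ i.*2 = 4 ^+ i * (a ^+ 2 * b ^+ 2) ^+ i.
  by rewrite -exprMn -mul2n exprM; congr (_ ^+ _); ring.
by ring.
Qed.

Lemma red_sub k f : red (sub k f) = sub k (red f). Proof. exact: fmap_sub. Qed.

Lemma sub2_fixed (G : fps K) : G = sub 2 G -> forall n, (0 < n)%N -> co G n = 0.
Proof.
move=> E n; elim/ltn_ind: n => n IH n0; rewrite E co_sub; case: ifP => // /dvdnP[k Ek].
by rewrite Ek mulnK //; apply: IH; lia.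
Qed.

Lemma sub_Hs k (a b : fps K) : (0 < k)%N -> sub k (Hs a b) = Hs (sub k a) (sub k b).
Proof.
move=> k0; rewrite /Hs.
have subS (I : Type) (r : seq I) (F : I -> fps K) :
    sub k (\sum_(i <- r) F i) = \sum_(i <- r) sub k (F i).
  elim/big_rec2: _ => [|i f g _ <-]; last by rewrite subD.
  by apply: fpsP => n /=; case: ifP.
rewrite subS; apply: eq_bigr => i _.
by rewrite (subM ('C(_, _)%:R ^+ 2 * _)) // (subM ('C(_, _)%:R ^+ 2)) // !subX // sub_nat.
Qed.

Lemma Hs_one : Hs (red xx) (red yy) = 1.
Proof.
have E : Hs (red tha) (red thb) = 1.
  have F : Hs (red tha) (red thb) = sub 2 (Hs (red tha) (red thb)).
    rewrite (@sub_Hs 2 (red tha) (red thb) isT) -(red_sub 2 tha) -(red_sub 2 thb).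
    apply: (@Hs_landen (red (sub 2 tha)) (red (sub 2 thb)) (red tha) (red thb)).
      by rewrite -!rmorphXn tha_sq rmorphD.
    by rewrite -rmorphXn thb_sq !rmorphM rmorph_nat.
  apply: fpsP => -[|n]; last by rewrite (sub2_fixed F).
  rewrite /Hs co_sum big_ord_recl big1 => [|i _].
    rewrite addr0 !co0M !co0X.
    have -> : co (red tha) 0 = 1 by rewrite /= co_tha0.
    have -> : co (red thb) 0 = 0 by rewrite /= co_thb0.
    by rewrite co_nat /= bin0 !expr1n expr0 !mulr1.
  rewrite co0M !co0X; have -> : co (red thb) 0 = 0 by rewrite /= co_thb0.
  by rewrite expr0n /= expr0n mulr0.
by rewrite xx.unlock yy.unlock !red_sub -(@sub_Hs 8 _ _ isT) E sub1.
Qed.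

Local Notation x := (red xx).
Local Notation y := (red yy).

(** A polynomial is a list of pairs of an integer coefficient and an exponent of [y]. Since
    [Hs x y = 1], a series does not determine its degree, so the degree is carried along; the same
    list is read over the integers in [imon]. *)
Definition mon (d : nat) (p : int * nat) : fps K := p.1%:~R * x ^+ (d - p.2) * y ^+ p.2.
Definition hom (d : nat) (f : fps K) := exists s : seq (int * nat),
  all (fun p => p.2 <= d)%N s /\ f = \sum_(p <- s) mon d p.

Lemma homM d e f g : hom d f -> hom e g -> hom (d + e) (f * g).
Proof.
move=> [s [sd ->]] [t [te ->]].
exists [seq (pq.1.1 * pq.2.1, (pq.1.2 + pq.2.2)%N) | pq <- [seq (p, q) | p <- s, q <- t]].
split.
  rewrite all_map; apply/allP => _ /allpairsP[[p q] [/(allP sd) pd /(allP te) qe ->]].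
  by move: pd qe => /=; lia.
rewrite big_map big_allpairs big_distrlr /= big_seq [RHS]big_seq.
apply: eq_bigr => p /(allP sd) pd.
rewrite big_seq [RHS]big_seq; apply: eq_bigr => q /(allP te) qe.
move: p q pd qe => [p1 p2] [q1 q2] /= pd qe.
rewrite /mon /= rmorphM /= (_ : (d + e - (p2 + q2)) = (d - p2) + (e - q2))%N; last by lia.
by rewrite !exprD; ring.
Qed.
Lemma homD d f g : hom d f -> hom d g -> hom d (f + g).
Proof.
move=> [s [sd ->]] [t [td ->]]; exists (s ++ t); split; first by rewrite all_cat sd.
by rewrite big_cat.
Qed.
Lemma hom_int c : hom 0 c%:~R.
Proof. by exists [:: (c, 0%N)]; split=> //; rewrite big_seq1 /mon /= !mulr1. Qed.
Lemma hom_nat c : hom 0 c%:R.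
Proof. exact: (hom_int c). Qed.
Lemma homX d k f : hom d f -> hom (d * k) (f ^+ k).
Proof.
move=> df; elim: k => [|k IH]; first by rewrite muln0; apply: (hom_nat 1).
by rewrite mulnS exprS; apply: homM.
Qed.
Lemma hom_x : hom 1 x.
Proof. by exists [:: (1, 0%N)]; split=> //; rewrite big_seq1 /mon /= mulr1z mulr1 mul1r. Qed.
Lemma hom_y : hom 1 y.
Proof. by exists [:: (1, 1%N)]; split=> //; rewrite big_seq1 /mon /= mulr1z mulr1 mul1r. Qed.
Lemma hom_sum d (I : Type) (r : seq I) (F : I -> fps K) :
  (forall i, hom d (F i)) -> hom d (\sum_(i <- r) F i).
Proof.
move=> dF; elim/big_rec: _ => [|i f _]; last exact: homD.
by exists [::]; rewrite big_nil.
Qed.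
Lemma hom_cast d e f : d = e -> hom d f -> hom e f. Proof. by move=> ->. Qed.

Lemma hom_xBy : hom 1 (x - y).
Proof. by apply: homD hom_x _; rewrite -mulN1r; apply: (homM (hom_int (-1)) hom_y). Qed.
Lemma hom_xDy : hom 1 (x + y). Proof. exact: homD hom_x hom_y. Qed.
Lemma hom_Hs : hom (4 * m./2) (Hs x y).
Proof.
apply: hom_sum => i; have im : (i <= m./2)%N by have := ltn_ord i; lia.
apply: (@hom_cast (0 * 2 + 1 * 2 * (m./2 - i).*2 + 1 * 2 * i.*2)); first by lia.
by do 2?apply: homM; do ?apply: homX; [apply: hom_nat|apply: hom_x|apply: hom_y].
Qed.

Definition wr : fps K := x * fD y - y * fD x.

Lemma wrE : wr = 8 * (x * y * (x ^+ 4 - y ^+ 4)).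
Proof.
have := congr1 red wron_xy; rewrite /wron rmorphB !rmorphM /= /wr /red !fmap_fD => ->.
by rewrite rmorph_nat rmorphB !rmorphXn.
Qed.

(** If [m] does not divide [j + 1], then [i + 1 = -(j + 1)] modulo [m] makes the term the derivative
    of a multiple of [x^(i+1) y^(j+1)], which [Um] kills. Otherwise it is an [m]-th power times
    [x^(m-1) y^(m-1) wr], and [red_log] shows that [Um] sends the latter to [wr]. *)
Lemma Um_mon i j : (m %| i + j + 2)%N ->
  exists2 f, hom ((i + j + 2) %/ m - 2) f & Um (x ^+ i * y ^+ j * wr) = f * wr.
Proof.
have m0 := m_gt0; move=> mij; have [mj|mj] := boolP (m %| j.+1)%N; last first.
  exists 0; first by exists [::]; rewrite big_nil.
  have -> : x ^+ i * y ^+ j * wr =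
      fD (cstK (j.+1%:R^-1) * (x ^+ i.+1 * y ^+ j.+1)).
    have D0 c : fD (cstK c) = 0.
      by apply: fpsP => -[|n]; rewrite co_fD //= coefC mul0rn.
    have ij : i.+1%:R = - j.+1%:R :> fps K.
      have : (i.+1 + j.+1)%N%:R == 0 :> K by rewrite natr_K_eq0 addSn addnS -addn2.
      rewrite natrD addr_eq0 => /eqP /(congr1 cstK).
      by rewrite rmorphN !rmorph_nat.
    have jj : cstK (j.+1%:R^-1) * j.+1%:R = 1.
      rewrite -(rmorph_nat cstK) -rmorphM mulVf ?rmorph1 //.
      by rewrite natr_K_eq0.
    rewrite fDM D0 mul0r add0r (fDM (x ^+ i.+1)) !fDX ij /wr.
    move: jj; move: (cstK _) (j.+1%:R : fps K) (fD x) (fD y) => u c dx dy jj.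
    transitivity (u * c * (x ^+ i * y ^+ j * (x * dy - y * dx))).
      by rewrite jj mul1r.
    by rewrite !exprS; ring.
  by rewrite Um_fD mul0r.
have mi : (m %| i.+1)%N by rewrite -(dvdn_addl _ mj) addSn addnS -addn2.
case/dvdnP: mi => a Ea; case/dvdnP: mj => b Eb.
have a0 : (0 < a)%N by case: a Ea. have b0 : (0 < b)%N by case: b Eb.
exists (x ^+ a.-1 * y ^+ b.-1).
  have -> : ((i + j + 2) %/ m - 2 = 1 * a.-1 + 1 * b.-1)%N.
    have -> : (i + j + 2 = (a + b) * m)%N by lia.
    by rewrite mulnK //; lia.
  by apply: homM; apply: homX; [apply: hom_x|apply: hom_y].
have -> : x ^+ i * y ^+ j * wr = (x ^+ m.-1 * y ^+ m.-1 * wr) * (x ^+ a.-1 * y ^+ b.-1) ^+ m.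
  have -> : i = (m.-1 + a.-1 * m)%N by nia.
  have -> : j = (m.-1 + b.-1 * m)%N by nia.
  by rewrite exprMn !exprD !exprM; ring.
rewrite Um_frob; congr (_ * _).
have -> : x ^+ m.-1 * y ^+ m.-1 * wr =
    (y ^+ m.-1 * fD y) * x ^+ m - (x ^+ m.-1 * fD x) * y ^+ m.
  have E z : z ^+ m = z * z ^+ m.-1 :> fps K by rewrite -exprS prednK.
  by rewrite /wr !E; ring.
have E1 : Um (y ^+ m.-1 * fD y * x ^+ m) = x * fD y.
  by rewrite (Um_frob (y ^+ m.-1 * fD y) x) (red_log yy).
have E2 : Um (x ^+ m.-1 * fD x * y ^+ m) = y * fD x.
  by rewrite (Um_frob (x ^+ m.-1 * fD x) y) (red_log xx).
by rewrite /wr -E1 -E2; exact: UmB.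
Qed.

Lemma Um_hom d f : (m %| d + 2)%N -> hom d f ->
  exists2 g, hom ((d + 2) %/ m - 2) g & Um (f * wr) = g * wr.
Proof.
move=> md [s [sd ->]]; elim: s sd => [|p s IH] /=.
  move=> _; exists 0; first by exists [::]; rewrite big_nil.
  by rewrite big_nil !mul0r; apply: fpsP.
case/andP => pd /IH[g hg E].
have [h hh F] : exists2 h, hom ((d + 2) %/ m - 2) h &
    Um (x ^+ (d - p.2) * y ^+ p.2 * wr) = h * wr.
  by have := @Um_mon (d - p.2) p.2; rewrite subnK //; apply.
exists (p.1%:~R * h + g); first by apply: homD => //; apply: (homM (hom_int _) hh).
have UmZ (c : int) k : Um (c%:~R * k) = c%:~R * Um k.
  by rewrite -(rmorph_int cstK); apply: fpsP => n; rewrite co_Um !co_cst co_Um.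
by rewrite big_cons mulrDl UmD E /mon -!mulrA UmZ !mulrA F; ring.
Qed.

Lemma wr_neq0 : wr != 0.
Proof.
have m1 : (16%:R != 0 :> K).
  rewrite natr_K_eq0 (_ : 16 = 2 ^ 4)%N // Euclid_dvdX // andbT.
  by rewrite dvdn_prime2 //; apply/eqP => E; move: m_ge3; rewrite E.
have E : co (wron xx yy) 8 = 16.
  have -> : wron xx yy = 8 * sub 8 (tha * thb * (tha ^+ 4 - thb ^+ 4)).
    rewrite wron_xy xx.unlock yy.unlock; congr (_ * _).
    by rewrite (subM (tha * thb)) // (subM tha) // subD subN !subX.
  rewrite co_natl co_sub [(8 %| 8)%N]/= [(8 %/ 8)%N]/= (co1M (tha * thb)) (co0M tha) co_thb0 mulr0 mul0r add0r.
  by rewrite (co1M tha) coB !co0X co_tha0 co_thb0 co_thb1 mulr0 addr0 mul1r expr1n expr0n.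
apply/eqP => W; have : co wr 8 = 16%:R.
  have -> : wr = red (wron xx yy) by rewrite wrE wron_xy !rmorphM rmorphB !rmorphXn rmorph_nat.
  by have -> : co (red (wron xx yy)) 8 = (co (wron xx yy) 8)%:~R by []; rewrite E.
by rewrite W => /esym/eqP; apply/negP.
Qed.

Lemma main_mod : exists (r : nat) (s : seq (int * nat)),
  [/\ (0 < r <= 4)%N, (r < 6 * m - 6)%N, all (fun p => p.2 <= 6 * m - 6 - r)%N s &
   Um (red Fb) = red tht * red kap ^+ r.-1 * \sum_(p <- s) mon (6 * m - 6 - r) p].
Proof.
have m0 := m_gt0; have modd := m_odd; have hm := half_m.
(* [s8 * m = 8 e + 1] because [m^2 = 1] modulo 8; with [s8 = 2 r - 1], the series [F^s8 (x - y)^r]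
   is [tht kap^(r-1)]. *)
pose s8 := (m %% 8)%N; pose e := ((s8 * m - 1) %/ 8)%N; pose r := (s8./2.+1)%N.
have s8odd : odd s8 by rewrite /s8 odd_mod.
have Es : s8 = (r.*2 - 1)%N by rewrite /r; have := odd_double_half s8; rewrite s8odd; lia.
have s8lt : (s8 < 8)%N by rewrite /s8 ltn_mod.
have Ee : (s8 * m = 8 * e + 1)%N.
  have mE := divn_eq m 8; rewrite -/s8 in mE.
  have : ((s8 * m) %% 8 = 1)%N.
    rewrite /s8 modnMml; move: s8lt s8odd mE; rewrite /s8; set q := (m %/ 8)%N.
    case: (m %% 8)%N => [|[|[|[|[|[|[|[|//]]]]]]]] //= _ _ ->; lia.
  by rewrite /e; lia.
have s7 : (s8 * m <= 7 * m)%N by rewrite leq_mul2r; lia.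
have em : (e <= m.-1)%N by lia.
have E2 : (s8 * m + m = (m * r).*2)%N by apply: deg_arith2; lia.
have r4 : (0 < r <= 4)%N by rewrite /r; lia.
have ex : (m * r <= 4 * e + m.-1)%N by lia.
have r6 : (r < 6 * m - 6)%N by lia.
clearbody e r s8; clear s7 s8odd s8lt modd.
have md0 : (2 <= m * (m.*2 - r))%N by apply: deg_arith3; lia.
(* [Um] turns degree [m (2m - r) - 2] into [2m - r - 2], and the factor [Hs^2] raises this to
   [6m - 6 - r]. With [tht kap^(r-1)], of degree [r], the total is [6m - 6], that is weight
   [3m - 3]. *)
have dg2 : (m.*2 - r - 2 + 4 * m./2 * 2 = 6 * m - 6 - r)%N by lia.
pose c := x * y * (x ^+ 2 + y ^+ 2).
(* The exponent [m - 2] of [Hs] makes the degree congruent to [-2] modulo [m], as [Um_hom]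
   requires. *)
pose N1 := 8 ^+ m.-1 * 2 ^+ e * c ^+ (m.-1 - e) * (x - y) ^+ (4 * e + m.-1 - m * r)
   * (x + y) ^+ m.-1 * Hs x y ^+ (m - 2).
have homN1 : hom (m * (m.*2 - r) - 2) N1.
  apply: (@hom_cast (0 * m.-1 + 0 * e + (1 + 1 + 1 * 2) * (m.-1 - e)
     + 1 * (4 * e + m.-1 - m * r) + 1 * m.-1 + (4 * m./2) * (m - 2)))%N.
    have -> : (4 * m./2 = 2 * m.-1)%N by lia.
    by apply: deg_arith1; lia.
  rewrite /N1; apply: homM; last by apply: homX; apply: hom_Hs.
  apply: homM; last by apply: homX; apply: hom_xDy.
  apply: homM; last by apply: homX; apply: hom_xBy.
  apply: homM; first by apply: homM; apply: homX; apply: hom_nat.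
  apply: homX; apply: homM; first exact: homM hom_x hom_y.
  by apply: homD; apply: homX; [apply: hom_x|apply: hom_y].
have c8 : c = 2 * red Fb ^+ 8 * (x - y) ^+ 4.
  have E : red (2 * kap ^+ 4) = red (xx * yy * (xx ^+ 2 + yy ^+ 2)) by rewrite kap4.
  rewrite (rmorphM red 2) rmorph_nat (rmorphM red (xx * yy)) (rmorphM red xx yy)
    (rmorphD red (xx ^+ 2)) !rmorphXn in E.
  have F : red kap = red Fb ^+ 2 * (x - y).
    by rewrite -Fb_sq (rmorphM red (Fb ^+ 2)) rmorphXn rmorphB.
  have E' : 2 * red kap ^+ 4 = c := E.
  by rewrite -E' F; ring.
have key : red Fb * wr ^+ m = N1 * wr * (red Fb ^+ s8 * (x - y) ^+ r) ^+ m.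
  have E1 : wr = 8 * (c * ((x - y) * (x + y))) by rewrite wrE /c; ring.
  rewrite /N1 Hs_one expr1n mulr1.
  by rewrite (key_alg m0 em ex Ee E1 c8).
have md : (m %| m * (m.*2 - r) - 2 + 2)%N by rewrite subnK ?dvdn_mulr.
have [g hg Eg] := Um_hom md homN1.
have {hg} hg : hom (6 * m - 6 - r) (g * Hs x y ^+ 2).
  rewrite -dg2; move: hg; rewrite (subnK md0) (mulKn _ m0) => hg.
  by apply: homM hg _; apply: homX; apply: hom_Hs.
case: hg => s [ss Es'].
clear homN1 c8 md; clearbody N1 c.
have fr : red Fb ^+ s8 * (x - y) ^+ r = red tht * red kap ^+ r.-1.
  have T : red tht = red Fb * (x - y) by rewrite -Fb_tht (rmorphM red Fb) rmorphB.
  have F : red kap = red Fb ^+ 2 * (x - y).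
    by rewrite -Fb_sq (rmorphM red (Fb ^+ 2)) rmorphXn rmorphB.
  by case/andP: r4 => r1 _; rewrite T F Es (pow_alg (red Fb) (x - y) r1).
have fin : Um (red Fb) = red tht * red kap ^+ r.-1 * g.
  (* [wr * Um F = Um (F wr^m)], so the Wronskian is introduced on this side and cancelled at the
     end. *)
  apply: (fps_mulIf wr_neq0).
  rewrite -(Um_frob (red Fb) wr) key (Um_frob (N1 * wr)) Eg fr.
  by move: (red tht * _) wr => a b; ring.
exists r, s; rewrite fin; apply: (And4 r4 r6 ss).
by rewrite -Es' Hs_one expr1n mulr1.
Qed.
End ModM.

Local Open Scope classical_set_scope.
Local Open Scope ring_scope.
Local Open Scope complex_scope.

(** * Complex limits and evaluation of power series *)

Lemma leq_wexp2r (m n k : nat) : (m <= n)%N -> (m ^ k <= n ^ k)%N.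
Proof. by case: k => // k mn; rewrite leq_exp2r. Qed.

Lemma co_int (c : int) n : co (c%:~R : fps int) n = if n == 0%N then c else 0.
Proof.
case: c => k; first by rewrite (co_nat _ k) natz.
by rewrite NegzE mulrNz coN (co_nat _ k.+1); case: ifP; rewrite ?oppr0 // natz.
Qed.

Section Cnorm.
Variable R : realType.
Local Notation C := R[i].
Implicit Types z w q : C.

(** The norm of [R[i]] has values in [R[i]]; [cn] is the same modulus as an element of [R], where
    [lra] and [nra] work. *)
Definition cn z : R := Num.sqrt (complex.Re z ^+ 2 + complex.Im z ^+ 2).

Lemma normE z : `|z| = (cn z)%:C. Proof. exact: normc_def. Qed.
Lemma cn_ge0 z : 0 <= cn z. Proof. exact: sqrtr_ge0. Qed.
Lemma cnM z w : cn (z * w) = cn z * cn w.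
Proof. by apply: complexI; have := normrM z w; rewrite !normE => ->; rewrite rmorphM. Qed.
Lemma cnD z w : cn (z + w) <= cn z + cn w.
Proof. by have := ler_normD z w; rewrite !normE -rmorphD lecR. Qed.
Lemma cnN z : cn (- z) = cn z.
Proof. by apply: complexI; have := normrN z; rewrite !normE. Qed.
Lemma cnB z w : cn (z - w) <= cn z + cn w.
Proof. by rewrite -(cnN w) cnD. Qed.
Lemma cn_distC z w : cn (z - w) = cn (w - z). Proof. by rewrite -cnN opprB. Qed.
Lemma cn_tri y z w : cn (z - w) <= cn (z - y) + cn (y - w).
Proof. by rewrite -(subrKA y z) cnD. Qed.
Lemma cn0 : cn 0 = 0.
Proof. by apply: complexI; rewrite -normE normr0. Qed.
Lemma cn1 : cn 1 = 1.
Proof. by apply: complexI; rewrite -normE normr1. Qed.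
Lemma cn_eq0 z : (cn z == 0) = (z == 0).
Proof. by rewrite -(normr_eq0 z) normE; apply/eqP/eqP => [->//|E]; apply: complexI E. Qed.
Lemma cn_gt0 z : (0 < cn z) = (z != 0).
Proof. by rewrite lt_def cn_ge0 andbT cn_eq0. Qed.
Lemma cnV z : cn z^-1 = (cn z)^-1.
Proof. by apply: complexI; have := normfV z; rewrite !normE => ->; rewrite fmorphV. Qed.
Lemma cnX z n : cn (z ^+ n) = cn z ^+ n.
Proof. by elim: n => [|n IH]; rewrite ?expr0 ?cn1 // !exprS cnM IH. Qed.
Lemma cn_real (r : R) : cn r%:C = `|r|.
Proof. by rewrite /cn /= expr0n addr0 sqrtr_sqr. Qed.
Lemma cn_int (n : int) : cn n%:~R = `|n%:~R : R|.
Proof. by rewrite -cn_real rmorph_int. Qed.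
Lemma cn_nat (n : nat) : cn n%:R = n%:R.
Proof. by rewrite -(rmorph_nat (real_complex R)) cn_real ger0_norm. Qed.
Lemma cn_sum (I : Type) (r : seq I) (P : pred I) (F : I -> C) :
  cn (\sum_(i <- r | P i) F i) <= \sum_(i <- r | P i) cn (F i).
Proof.
elim/big_rec2: _ => [|i x y _ IH]; first by rewrite cn0.
by apply: le_trans (cnD _ _) _; rewrite lerD2l.
Qed.
Lemma Re_le_cn z : `|complex.Re z| <= cn z.
Proof. by rewrite -sqrtr_sqr ler_wsqrtr // lerDl sqr_ge0. Qed.
Lemma Im_le_cn z : `|complex.Im z| <= cn z.
Proof. by rewrite -sqrtr_sqr ler_wsqrtr // lerDr sqr_ge0. Qed.
Lemma cn_le_ReIm z : cn z <= `|complex.Re z| + `|complex.Im z|.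
Proof.
rewrite -[leRHS]ger0_norm ?addr_ge0 // -sqrtr_sqr ler_wsqrtr // sqrrD.
rewrite !real_normK ?num_real // addrAC lerDl mulrn_wge0 // mulr_ge0 //.
Qed.
Lemma cn_sqr z : cn z ^+ 2 = complex.Re z ^+ 2 + complex.Im z ^+ 2.
Proof. by rewrite sqr_sqrtr // addr_ge0 ?sqr_ge0. Qed.
Lemma cn_ge_sub z w : cn z - cn w <= cn (z + w).
Proof. by rewrite lerBlDr -[in leLHS](addrK w z) cnB. Qed.

Definition ctends (u : nat -> C) (l : C) :=
  forall e : R, 0 < e -> exists N, forall n, (N <= n)%N -> cn (u n - l) < e.

Lemma ctends_unique u l l' : ctends u l -> ctends u l' -> l = l'.
Proof.
move=> ul ul'; have [//|ne] := eqVneq l l'.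
have d0 : 0 < cn (l - l') by rewrite cn_gt0 subr_eq0.
have e0 : 0 < cn (l - l') / 2 by lra.
have [N HN] := ul _ e0; have [N' HN'] := ul' _ e0.
exfalso; have := cn_tri (u (N + N')%N) l l'; rewrite (cn_distC l (u _)).
have := HN _ (leq_addr N' N); have := HN' _ (leq_addl N N'); lra.
Qed.

Lemma ctends_cst l : ctends (fun=> l) l.
Proof. by move=> e e0; exists 0%N => n _; rewrite subrr cn0. Qed.
Lemma ctends_ext u v l : (forall n, u n = v n) -> ctends u l -> ctends v l.
Proof. by move=> uv; have -> : u = v by apply/funext. Qed.
Lemma ctendsD u v l k : ctends u l -> ctends v k -> ctends (fun n => u n + v n) (l + k).
Proof.
move=> ul vk e e0.
have e2 : 0 < e / 2 by lra.
have [N HN] := ul _ e2; have [N' HN'] := vk _ e2.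
exists (maxn N N') => n; rewrite geq_max => /andP[/HN h /HN' h'].
rewrite opprD addrACA; apply: le_lt_trans (cnD _ _) _; lra.
Qed.
Lemma ctendsZ c u l : ctends u l -> ctends (fun n => c * u n) (c * l).
Proof.
move=> ul e e0.
have c1 : 0 < cn c + 1 by apply: ltr_wpDl; rewrite ?cn_ge0.
have [N HN] := ul _ (divr_gt0 e0 c1).
exists N => n /HN; rewrite ltr_pdivlMr // => h; rewrite -mulrBr cnM.
apply: le_lt_trans h; rewrite mulrC mulrDr mulr1 lerDl; exact: cn_ge0.
Qed.
Lemma ctendsM u v l k : ctends u l -> ctends v k -> ctends (fun n => u n * v n) (l * k).
Proof.
move=> ul vk e e0; pose T := 1 + cn k + cn l.
have l0 := cn_ge0 l; have k0 := cn_ge0 k; have T0 : 0 < T by rewrite /T; lra.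
pose d := Num.min 1 (e / T).
have d0 : 0 < d by rewrite lt_min ltr01 divr_gt0.
have d1 : d <= 1 by rewrite ge_min lexx.
have dT : d * T <= e by rewrite -ler_pdivlMr // ge_min lexx orbT.
have [N HN] := ul _ d0; have [N' HN'] := vk _ d0.
exists (maxn N N') => n; rewrite geq_max => /andP[/HN h /HN' h'].
have -> : u n * v n - l * k = (u n - l) * (v n - k) + ((u n - l) * k + l * (v n - k)) by ring.
apply: lt_le_trans dT; apply: le_lt_trans (cnD _ _) _.
have := cnD ((u n - l) * k) (l * (v n - k)); rewrite !cnM.
have := cn_ge0 (u n - l); have := cn_ge0 (v n - k); rewrite /T.
move: (cn (u n - l)) (cn (v n - k)) h h' => x y xd yd y0 x0 E; nra.
Qed.
Lemma ctends_sub (s : nat -> nat) u l : (forall n, (n <= s n)%N) ->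
  ctends u l -> ctends (fun n => u (s n)) l.
Proof.
by move=> sn ul e /ul[N HN]; exists N => n Nn; apply: HN; apply: leq_trans (sn n).
Qed.
Lemma ctendsS u l : ctends (fun n => u n.+1) l -> ctends u l.
Proof. by move=> ul e /ul[N HN]; exists N.+1 => -[|n] // /HN. Qed.
Lemma ctends_cn u l B : ctends u l -> (forall n, cn (u n) <= B) -> cn l <= B.
Proof.
move=> ul uB; apply/ler_addgt0Pr => e /ul[N /(_ N (leqnn N)) h].
rewrite -(subrK (u N) l); apply: le_trans (cnD _ _) _; rewrite addrC cn_distC.
by apply: lerD => //; apply: ltW.
Qed.
Lemma ctends_squeeze u l (b : nat -> R) : (forall n, cn (u n - l) <= b n) ->
  b @ \oo --> (0 : R) -> ctends u l.
Proof.
move=> ub /cvgrPdist_lt b0 e e0; have [N _ HN] := b0 _ e0.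
exists N => n /= /HN; rewrite sub0r normrN => h; apply: le_lt_trans (ub n) _.
exact: le_lt_trans (ler_norm _) h.
Qed.
Lemma ctends_sum (I : Type) (r : seq I) (u : I -> nat -> C) (l : I -> C) :
  (forall i, ctends (u i) (l i)) ->
  ctends (fun n => \sum_(i <- r) u i n) (\sum_(i <- r) l i).
Proof.
move=> ul; elim: r => [|i r IH].
  by rewrite big_nil; apply: (ctends_ext (u := fun=> 0)) (ctends_cst 0) => n; rewrite big_nil.
rewrite big_cons; apply: (ctends_ext (u := fun n => u i n + \sum_(j <- r) u j n)).
  by move=> n; rewrite big_cons.
exact: ctendsD.
Qed.

Lemma geo_sum_le (rho : R) (a n : nat) : 0 <= rho < 1 ->
  \sum_(a <= i < n) rho ^+ i <= rho ^+ a / (1 - rho).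
Proof.
case/andP => r0 r1; have r10 : 0 < 1 - rho by rewrite subr_gt0.
case: (leqP a n) => an; last first.
  by rewrite big_geq ?(ltnW an) // mulr_ge0 ?exprn_ge0 // invr_ge0 ltW.
rewrite ler_pdivlMr // mulr_suml.
rewrite (eq_bigr (fun i => - rho ^+ i.+1 - - rho ^+ i)) => [|i _]; last by rewrite exprSr; ring.
rewrite (@telescope_sumr _ a n (fun i => - rho ^+ i) an).
by rewrite opprK addrC lerBlDr lerDl exprn_ge0.
Qed.

Lemma geo_cvg0 (K rho : R) : 0 <= rho < 1 -> (fun n => K * rho ^+ n) @ \oo --> (0 : R).
Proof.
case/andP => r0 r1; rewrite -(mulr0 K); apply: cvgM; first exact: cvg_cst.
by apply: cvg_expr; rewrite ger0_norm.
Qed.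

(* Completeness of C, through the real and imaginary parts. *)
Lemma ctends_geo (u : nat -> C) (M rho : R) : 0 <= rho < 1 ->
  (forall n, cn (u n.+1 - u n) <= M * rho ^+ n) ->
  exists l, ctends u l /\ forall N, cn (l - u N) <= M * rho ^+ N / (1 - rho).
Proof.
move=> r01 du; have [r0 r1] := andP r01.
have M0 : 0 <= M by have := du 0%N; rewrite expr0 mulr1; apply: le_trans (cn_ge0 _).
have part (p : C -> R) : (forall z w, p (z - w) = p z - p w) -> (forall z, `|p z| <= cn z) ->
    cvgn (fun n => p (u n)).
  move=> pB pn; pose d n := p (u n.+1) - p (u n).
  have sd n : series d n = p (u n) - p (u 0%N).
    by rewrite /series /= (@telescope_sumr _ 0 n (fun i => p (u i)) (leq0n n)).
  have cd : cvgn (series d).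
    apply: normed_cvg; apply: (series_le_cvg (v_ := fun n => M * rho ^+ n)) => [n|n|n|] /=.
    - exact: normr_ge0.
    - by rewrite mulr_ge0 // exprn_ge0.
    - by rewrite /d -pB; apply: le_trans (pn _) (du n).
    apply: is_cvg_geometric_series; by rewrite ger0_norm.
  have -> : (fun n => p (u n)) = (fun n => series d n + p (u 0%N)).
    by apply/funext => n; rewrite sd subrK.
  by apply: is_cvgD => //; apply: is_cvg_cst.
have cr := part (@complex.Re R) (fun z w => ltac:(by case: z; case: w)) Re_le_cn.
have ci := part (@complex.Im R) (fun z w => ltac:(by case: z; case: w)) Im_le_cn.
pose l := limn (fun n => complex.Re (u n)) +i* limn (fun n => complex.Im (u n)).
have ul : ctends u l.
  move=> e e0; have e2 : 0 < e / 2 by rewrite divr_gt0.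
  have [N _ HN] := (@cvgrPdist_lt _ _ _ _ _ _ _).1 cr _ e2.
  have [N' _ HN'] := (@cvgrPdist_lt _ _ _ _ _ _ _).1 ci _ e2.
  exists (maxn N N') => n; rewrite geq_max => /andP[/HN /= h /HN' /= h'].
  apply: le_lt_trans (cn_le_ReIm _) _; rewrite /l.
  have -> : complex.Re (u n - l) = complex.Re (u n) - limn (fun n => complex.Re (u n)) by case: (u n).
  have -> : complex.Im (u n - l) = complex.Im (u n) - limn (fun n => complex.Im (u n)) by case: (u n).
  rewrite distrC in h; rewrite distrC in h'; lra.
exists l; split=> // N.
have step k : cn (u (N + k)%N - u N) <= M * \sum_(N <= i < N + k) rho ^+ i.
  elim: k => [|k IH]; first by rewrite addn0 subrr cn0 big_geq ?mulr0.
  rewrite addnS big_nat_recr ?leq_addr //= mulrDr.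
  by apply: le_trans (cn_tri (u (N + k)%N) _ _) _; rewrite [leRHS]addrC; apply: lerD.
have ul' : ctends (fun k => u (N + k)%N - u N) (l - u N).
  apply: ctendsD; last exact: ctends_cst.
  by apply: (ctends_sub (s := fun k => (N + k)%N)) => // k; apply: leq_addl.
apply: ctends_cn ul' _ => k; apply: le_trans (step k) _.
by rewrite -mulrA ler_wpM2l // geo_sum_le.
Qed.

Lemma linexp_bounded (rho : R) n : 0 <= rho < 1 -> n.+1%:R * rho ^+ n <= (1 - rho)^-1.
Proof.
move=> r01; have [r0 r1] := andP r01.
have := @geo_sum_le rho 0 n.+1 r01; rewrite expr0 mul1r; apply: le_trans.
rewrite big_mkord mulr_natl -[X in _ *+ X]card_ord -sumr_const; apply: ler_sum => i _.
by apply: ler_wiXn2l => //; [apply: ltW|rewrite -ltnS].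
Qed.

(** With [rho = s^2], one of the two factors [s^n] absorbs one factor [n + 1], and the other serves
    the induction. *)
Lemma polexp_bounded (k : nat) (rho : R) : 0 <= rho < 1 ->
  exists2 M : R, 0 <= M & forall n, n.+1%:R ^+ k * rho ^+ n <= M.
Proof.
elim: k rho => [|k IH] rho r01; have [r0 r1] := andP r01.
  by exists 1 => // n; rewrite expr0 mul1r exprn_ile1 // ltW.
pose s := Num.sqrt rho.
have s0 : 0 <= s := sqrtr_ge0 _.
have ss : s * s = rho by rewrite -expr2 sqr_sqrtr.
have s01 : 0 <= s < 1.
  by rewrite s0 /= -(sqrtr1 R) ltr_sqrt.
have [M M0 HM] := IH _ s01; exists (M * (1 - s)^-1).
  by rewrite mulr_ge0 // invr_ge0 subr_ge0 ltW //; case/andP: s01.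
move=> n; rewrite -ss exprMn exprSr.
have -> : n.+1%:R ^+ k * n.+1%:R * (s ^+ n * s ^+ n) =
  (n.+1%:R ^+ k * s ^+ n) * (n.+1%:R * s ^+ n) by ring.
apply: ler_pM; rewrite ?mulr_ge0 ?exprn_ge0 //; exact: linexp_bounded.
Qed.

(** Polynomial growth of the coefficients is preserved by the ring operations and by [sub] and
    [ftw], and gives convergence on the whole open unit disc. *)
Definition pb (a : fps int) := exists A k : nat, forall n, (absz (co a n) <= A * n.+1 ^ k)%N.

Lemma absz_sum (I : Type) (r : seq I) (P : pred I) (F : I -> int) :
  (absz (\sum_(i <- r | P i) F i)%R <= \sum_(i <- r | P i) absz (F i))%N.
Proof.
elim/big_rec2: _ => // i x y _ IH; apply: leq_trans (_ : (absz (F i) + absz y <= _)%N); lia.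
Qed.

Lemma pbD a b : pb a -> pb b -> pb (a + b).
Proof.
move=> [A [k HA]] [B [l HB]]; exists (A + B)%N, (k + l)%N => n; rewrite coD.
have := HA n; have := HB n; rewrite expnD.
have : (0 < n.+1 ^ k)%N by rewrite expn_gt0. have : (0 < n.+1 ^ l)%N by rewrite expn_gt0.
move: (n.+1 ^ k)%N (n.+1 ^ l)%N => x y x0 y0 h h'.
have h1 : (A * x <= A * (x * y))%N by nia. have h2 : (B * y <= B * (x * y))%N by nia.
have tri (u v : int) : (absz (u + v)%R <= absz u + absz v)%N by lia.
by rewrite mulnDl; apply: leq_trans (tri _ _) _; apply: leq_add; apply: leq_trans; eauto.
Qed.
Lemma pbN a : pb a -> pb (- a).
Proof. by move=> [A [k HA]]; exists A, k => n; rewrite coN abszN. Qed.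
Lemma pbM a b : pb a -> pb b -> pb (a * b).
Proof.
move=> [A [k HA]] [B [l HB]]; exists (A * B)%N, (k + l + 1)%N => n; rewrite coM.
apply: leq_trans (absz_sum _ _ _) _.
apply: (@leq_trans (\sum_(i < n.+1) (A * n.+1 ^ k * (B * n.+1 ^ l)))%N).
  apply: leq_sum => i _; rewrite abszM; apply: leq_mul.
    apply: leq_trans (HA i) _; by rewrite leq_mul2l leq_wexp2r ?orbT // -ltnS.
  apply: leq_trans (HB _) _; by rewrite leq_mul2l leq_wexp2r ?orbT // ltnS leq_subr.
by rewrite sum_nat_const card_ord !expnD expn1; lia.
Qed.
Lemma pb_nat n : pb n%:R.
Proof. by exists n, 0%N => i; rewrite co_nat expn0 muln1; case: ifP => // _; rewrite natz. Qed.
Lemma pbX a n : pb a -> pb (a ^+ n).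
Proof. by move=> pa; elim: n => [|n IH]; rewrite ?exprS; [apply: (pb_nat 1)|apply: pbM]. Qed.
Lemma pb_sub j a : pb a -> pb (sub j a).
Proof.
move=> [A [k HA]]; exists A, k => n; rewrite co_sub; case: ifP => // _.
apply: leq_trans (HA _) _; by rewrite leq_mul2l leq_wexp2r ?orbT // ltnS leq_div.
Qed.
Lemma pb_ftw a : pb a -> pb (ftw a).
Proof.
by move=> [A [k HA]]; exists A, k => n; rewrite co_ftw abszM absz_sign mul1n.
Qed.
Lemma pb_sum (I : Type) (r : seq I) (F : I -> fps int) :
  (forall i, pb (F i)) -> pb (\sum_(i <- r) F i).
Proof. by move=> pF; elim/big_rec: _ => [|i a _]; [apply: (pb_nat 0)|apply: pbD]. Qed.
Lemma pb_int (c : int) : pb c%:~R.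
Proof. by case: c => n; rewrite ?NegzE ?mulrNz; [apply: pb_nat|apply/pbN/pb_nat]. Qed.
Definition tm (a : fps int) (q : C) n : C := (co a n)%:~R * q ^+ n.
Definition ps (a : fps int) (q : C) N : C := \sum_(n < N) tm a q n.
End Cnorm.

(** The default value 0 stands where the partial sums have no limit; for [pb] series and [cn q < 1]
    there is one. *)
HB.lock Definition ev (R : realType) (a : fps int) (q : R[i]) : R[i] :=
  xget 0 [set l | ctends (ps a q) l].

Section Evaluation.
Variable R : realType.
Local Notation C := R[i].
Implicit Types z w q : C.

Lemma pb_geo a (r : R) : pb a -> 0 <= r < 1 -> exists M rho : R,
  [/\ 0 <= M, 0 <= rho < 1 & forall n q, cn q <= r -> cn (tm a q n) <= M * rho ^+ n].
Proof.
move=> [A [k HA]] r01; have [r0 r1] := andP r01; pose s := Num.sqrt r.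
have s0 : 0 <= s := sqrtr_ge0 _.
have ss : s * s = r by rewrite -expr2 sqr_sqrtr.
have s01 : 0 <= s < 1 by rewrite s0 /= -(sqrtr1 R) ltr_sqrt.
have [M M0 HM] := polexp_bounded k s01.
exists (A%:R * M), s; split=> //; first by rewrite mulr_ge0.
move=> n q qr; rewrite cnM cnX cn_int.
have H1 : `|(co a n)%:~R : R| <= A%:R * n.+1%:R ^+ k.
  rewrite -natrX -natrM -intr_norm -abszE -pmulrn ler_nat; exact: HA.
have H2 : cn q ^+ n <= s ^+ n * s ^+ n.
  by rewrite -exprMn ss lerXn2r // nnegrE // cn_ge0.
apply: le_trans (ler_pM _ _ H1 H2) _; rewrite ?exprn_ge0 ?cn_ge0 //.
rewrite mulrA ler_wpM2r ?exprn_ge0 // -mulrA ler_wpM2l //; exact: HM.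
Qed.

Lemma ev_tends a q : pb a -> cn q < 1 -> ctends (ps a q) (ev a q).
Proof.
move=> pa q1; rewrite ev.unlock; apply: xgetPex.
have q01 : 0 <= cn q < 1 by rewrite cn_ge0.
have [M [rho [M0 r01 H]]] := pb_geo pa q01.
have [|l [ul _]] := @ctends_geo _ (ps a q) M rho r01; last by exists l.
by move=> n; rewrite /ps big_ord_recr /= addrAC subrr add0r; exact: H.
Qed.
Lemma evP a q l : pb a -> cn q < 1 -> ctends (ps a q) l -> ev a q = l.
Proof. by move=> pa q1; apply: ctends_unique; apply: ev_tends. Qed.

Lemma ev_tail a (r : R) : pb a -> 0 <= r < 1 -> exists M rho : R,
  [/\ 0 <= M, 0 <= rho < 1 & forall N q, cn q <= r ->
      cn (ev a q - ps a q N) <= M * rho ^+ N].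
Proof.
move=> pa r01; have [M [rho [M0 rho01 H]]] := pb_geo pa r01.
exists (M / (1 - rho)), rho; split=> //.
  by rewrite divr_ge0 // subr_ge0 ltW //; case/andP: rho01.
move=> N q qr; have q1 : cn q < 1 by case/andP: r01 => _; apply: le_lt_trans.
have [|l [ul E]] := @ctends_geo _ (ps a q) M rho rho01.
  by move=> n; rewrite /ps big_ord_recr /= addrAC subrr add0r; exact: H.
by rewrite (evP pa q1 ul) mulrAC; apply: E.
Qed.

Lemma evD a b q : pb a -> pb b -> cn q < 1 -> ev (a + b) q = ev a q + ev b q.
Proof.
move=> pa pb' q1; apply: evP => //; first exact: pbD.
apply: ctends_ext (ctendsD (ev_tends pa q1) (ev_tends pb' q1)) => n.
by rewrite /ps -big_split; apply: eq_bigr => i _; rewrite /tm coD rmorphD mulrDl.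
Qed.
Lemma evN a q : pb a -> cn q < 1 -> ev (- a) q = - ev a q.
Proof.
move=> pa q1; apply: evP => //; first exact: pbN.
apply: (ctends_ext (u := fun n => -1 * ps a q n)); last first.
  have -> : - ev a q = -1 * ev a q by rewrite mulN1r.
  by apply: ctendsZ; apply: ev_tends.
by move=> n; rewrite /ps mulr_sumr; apply: eq_bigr => i _; rewrite /tm coN rmorphN mulN1r mulNr.
Qed.
Lemma ev_nat k q : cn q < 1 -> ev k%:R q = k%:R.
Proof.
move=> q1; apply: evP => //; first exact: pb_nat.
move=> e e0; exists 1%N => -[//|n] _.
rewrite /ps big_ord_recl big1 ?addr0 => [|i _]; last by rewrite /tm co_nat /= mul0r.
by rewrite /tm co_nat /= expr0 mulr1 natz -pmulrn subrr cn0.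
Qed.
Lemma ev_int (c : int) q : cn q < 1 -> ev c%:~R q = c%:~R.
Proof.
move=> q1; case: c => n; first exact: ev_nat.
by rewrite NegzE !mulrNz evN ?ev_nat //; apply: pb_nat.
Qed.

(** The product of two partial sums and the partial sum of the product are compared as polynomials:
    they differ by terms of index [N] to [2N - 1], and the term of index [n] is at most [L s^n]. *)
Lemma evM a b q : pb a -> pb b -> cn q < 1 -> ev (a * b) q = ev a q * ev b q.
Proof.
move=> pa pb' q1; apply: evP => //; first exact: pbM.
have q01 : 0 <= cn q < 1 by rewrite cn_ge0.
have [Ma [ra [Ma0 ra01 Ha]]] := pb_geo pa q01.
have [Mb [rb [Mb0 rb01 Hb]]] := pb_geo pb' q01.
pose t := Num.max ra rb; pose s := Num.sqrt t.
have [[ra0 ra1] [rb0 rb1]] := (andP ra01, andP rb01).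
have t0 : 0 <= t by rewrite le_max ra0.
have t1 : t < 1 by rewrite gt_max ra1.
have s0 : 0 <= s := sqrtr_ge0 _.
have ss : s * s = t by rewrite -expr2 sqr_sqrtr.
have s01 : 0 <= s < 1 by rewrite s0 /= -(sqrtr1 R) ltr_sqrt.
pose L := Ma * Mb * (1 - s)^-1.
have s10 : 0 < 1 - s by rewrite subr_gt0; case/andP: s01.
have L0 : 0 <= L by rewrite /L !mulr_ge0 // invr_ge0 ltW.
pose p N : {poly C} := \poly_(i < N) (co a i)%:~R.
pose r N : {poly C} := \poly_(i < N) (co b i)%:~R.
have bnd N n : cn ((p N * r N)`_n * q ^+ n) <= L * s ^+ n.
  rewrite coefM mulr_suml; apply: le_trans (cn_sum _ _ _) _.
  apply: (@le_trans _ _ (\sum_(i < n.+1) (Ma * Mb * t ^+ n))).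
    apply: ler_sum => i _.
    have -> : (p N)`_i * (r N)`_(n - i) * q ^+ n =
        ((p N)`_i * q ^+ i) * ((r N)`_(n - i) * q ^+ (n - i)).
      by rewrite [RHS]mulrACA -exprD subnKC // -ltnS.
    have -> : Ma * Mb * t ^+ n = (Ma * t ^+ i) * (Mb * t ^+ (n - i)).
      by rewrite [RHS]mulrACA -exprD subnKC // -ltnS.
    rewrite cnM; apply: ler_pM; rewrite ?cn_ge0 //.
      rewrite coef_poly; case: ifP => _; last first.
        by rewrite mul0r cn0 mulr_ge0 ?exprn_ge0.
      apply: le_trans (Ha i q (lexx _)) _; rewrite ler_wpM2l // lerXn2r ?nnegrE //.
      by rewrite le_max lexx.
    rewrite coef_poly; case: ifP => _; last first.
      by rewrite mul0r cn0 mulr_ge0 ?exprn_ge0.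
    apply: le_trans (Hb _ q (lexx _)) _; rewrite ler_wpM2l // lerXn2r ?nnegrE //.
    by rewrite le_max lexx orbT.
  rewrite sumr_const card_ord -mulr_natl /L -ss exprMn.
  have -> : n.+1%:R * (Ma * Mb * (s ^+ n * s ^+ n)) =
    Ma * Mb * (n.+1%:R * s ^+ n) * s ^+ n by ring.
  rewrite ler_wpM2r ?exprn_ge0 // ler_wpM2l ?mulr_ge0 //; exact: linexp_bounded.
have dif N : cn (ps a q N * ps b q N - ps (a * b) q N) <= L * s ^+ N / (1 - s).
  have -> : ps a q N * ps b q N = (p N * r N).[q] by rewrite hornerM !horner_poly.
  rewrite (@horner_coef_wide _ (N + N)); last first.
    apply: leq_trans (size_polyMleq _ _) _; apply: leq_trans (leq_pred _) _.
    by apply: leq_add; apply: size_poly.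
  rewrite big_split_ord /=.
  have -> : ps (a * b) q N = \sum_(i < N) (p N * r N)`_i * q ^+ i.
    apply: eq_bigr => n _; rewrite /tm coM rmorph_sum coefM; congr (_ * _).
    apply: eq_bigr => i _; rewrite rmorphM /= !coef_poly.
    have iN : (i < N)%N by apply: leq_ltn_trans (ltn_ord n); rewrite -ltnS.
    have niN : (n - i < N)%N by apply: leq_ltn_trans (leq_subr _ _) (ltn_ord n).
    by rewrite iN niN.
  rewrite addrAC subrr add0r; apply: le_trans (cn_sum _ _ _) _.
  apply: (@le_trans _ _ (L * \sum_(N <= n < N + N) s ^+ n)); last first.
    by rewrite -mulrA ler_wpM2l // geo_sum_le.
  have -> : \sum_(N <= n < N + N) s ^+ n = \sum_(i < N) s ^+ (N + i).
    rewrite -{1}(add0n N) big_addn addnK big_mkord.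
    by apply: eq_bigr => i _; rewrite addnC.
  by rewrite mulr_sumr; apply: ler_sum => i _; apply: bnd.
have D : ctends (fun N => ps a q N * ps b q N - ps (a * b) q N) 0.
  apply: (ctends_squeeze (b := fun N => L / (1 - s) * s ^+ N)); last exact: geo_cvg0.
  by move=> N; rewrite subr0 mulrAC; apply: dif.
have := ctendsD (ctendsM (ev_tends pa q1) (ev_tends pb' q1)) (ctendsZ (-1) D).
by rewrite mulr0 addr0; apply: ctends_ext => N; ring.
Qed.

Lemma evX a n q : pb a -> cn q < 1 -> ev (a ^+ n) q = ev a q ^+ n.
Proof.
move=> pa q1; elim: n => [|n IH]; first by rewrite !expr0 (ev_nat 1).
by rewrite !exprS evM ?IH //; apply: pbX.
Qed.
Lemma ev_sum (I : Type) (r : seq I) (F : I -> fps int) q : (forall i, pb (F i)) ->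
  cn q < 1 -> ev (\sum_(i <- r) F i) q = \sum_(i <- r) ev (F i) q.
Proof.
move=> pF q1; elim: r => [|i r IH]; first by rewrite !big_nil (ev_nat 0).
by rewrite !big_cons evD ?IH //; apply: pb_sum.
Qed.
Lemma cnX_lt1 k q : (0 < k)%N -> cn q < 1 -> cn (q ^+ k) < 1.
Proof. by move=> k0 q1; rewrite cnX exprn_ilt1 ?cn_ge0 // -lt0n. Qed.

Lemma ev_sub k a q : (0 < k)%N -> pb a -> cn q < 1 -> ev (sub k a) q = ev a (q ^+ k).
Proof.
move=> k0 pa q1; have E N : ps (sub k a) q (k * N) = ps a (q ^+ k) N.
  elim: N => [|N IH]; first by rewrite muln0 /ps !big_ord0.
  rewrite [RHS]/ps big_ord_recr /= -/(ps a (q ^+ k) N) -IH mulnS addnC.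
  rewrite /ps big_split_ord /=; congr (_ + _); case: k k0 {IH} => // k _.
  rewrite big_ord_recl /= addn0 big1 ?addr0 => [|i _].
    by rewrite /tm co_sub dvdn_mulr // mulKn // exprM.
  rewrite /tm co_sub ifF ?mul0r //; apply/negP.
  rewrite dvdn_addr ?dvdn_mulr // => /dvdn_leq; rewrite /bump /= => /(_ isT).
  by have := ltn_ord i; lia.
have h := ev_tends pa (cnX_lt1 k0 q1).
have h' := ev_tends (pb_sub k pa) q1.
apply: (@ctends_unique _ (ps a (q ^+ k))) => //.
apply: ctends_ext (ctends_sub (s := fun N => (k * N)%N) _ h') => N //.
by rewrite leq_pmull.
Qed.
Lemma ev_ftw a q : pb a -> cn q < 1 -> ev (ftw a) q = ev a (- q).
Proof.
move=> pa q1; apply: evP => //; first exact: pb_ftw.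
apply: ctends_ext (ev_tends pa (_ : cn (- q) < 1)) => [N|]; last by rewrite cnN.
apply: eq_bigr => i _; rewrite /tm co_ftw rmorphM rmorphXn rmorphN1 exprNn; ring.
Qed.
Lemma pb_X : pb (X int).
Proof. by exists 1%N, 0%N => n; rewrite -[X int]expr1 coXn; case: eqP. Qed.
Lemma ev_X q : cn q < 1 -> ev (X int) q = q.
Proof.
move=> q1; apply: evP => //; first exact: pb_X.
move=> e e0; exists 2 => -[//|[//|n]] _.
rewrite /ps 2!big_ord_recl big1 ?addr0 => [|i _].
  by rewrite /tm -[X int]expr1 !coXn /= mul0r add0r expr1 mul1r subrr cn0.
by rewrite /tm -[X int]expr1 coXn /= mul0r.
Qed.
Lemma ev_bound a (r : R) : pb a -> 0 <= r < 1 ->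
  exists2 M : R, 0 <= M & forall q, cn q <= r -> cn (ev a q) <= M.
Proof.
move=> pa r01; have [M [rho [M0 _ H]]] := ev_tail pa r01; exists M => // q qr.
by have := H 0%N q qr; rewrite /ps big_ord0 subr0 expr0 mulr1.
Qed.
Lemma ev_small a (r : R) : pb a -> 0 <= r < 1 -> exists2 M : R, 0 <= M &
  forall q, cn q <= r -> cn (ev a q - (co a 0)%:~R) <= M * cn q.
Proof.
move=> pa r01.
pose b : fps int := Fps (fun n => co a n.+1).
have pb' : pb b.
  case: pa => A [k HA]; exists (A * 2 ^ k)%N, k => n; apply: leq_trans (HA n.+1) _.
  by rewrite -mulnA -expnMn leq_mul2l leq_wexp2r ?orbT //; lia.
have E : a = (co a 0)%:~R + X int * b.
  apply: fpsP => n; rewrite coD -[X int]expr1 coXnM co_int.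
  by case: n => [|n]; rewrite ?addr0 ?add0r //= subn1.
have [M M0 H] := ev_bound pb' r01; exists M => // q qr.
have q1 : cn q < 1 by case/andP: r01 => _; apply: le_lt_trans.
rewrite {1}E evD ?ev_int ?evM ?ev_X //; try (by apply: pb_X) ; try (by apply: pb_int);
  try (by apply: pbM => //; apply: pb_X).
by rewrite addrAC subrr add0r cnM mulrC ler_wpM2r ?cn_ge0 // H.
Qed.
End Evaluation.

(** * The exponential and the partial fractions of 1/sin^2 *)

Section Exp.
Variable R : realType.
Local Notation C := R[i].
Implicit Types z w s : C.

Lemma complex_ext (z w : C) : complex.Re z = complex.Re w -> complex.Im z = complex.Im w -> z = w.
Proof. by case: z => a b; case: w => c d /= -> ->. Qed.

Lemma cdivn z n : z / n%:R = (complex.Re z / n%:R) +i* (complex.Im z / n%:R).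
Proof.
have -> : (n%:R^-1 : C) = (n%:R^-1 : R)%:C by rewrite fmorphV rmorph_nat.
by case: z => a b; apply: complex_ext => /=; ring.
Qed.

Lemma cexpD z w : cexp (z + w) = cexp z * cexp w.
Proof.
case: z => a b; case: w => c d; rewrite /cexp /= expRD cosD sinD.
by apply: complex_ext => /=; ring.
Qed.
Lemma cexp0 : cexp 0 = 1 :> C.
Proof. by rewrite /cexp /= expR0 cos0 sin0 mul1r. Qed.
Lemma cn_cexp z : cn (cexp z) = expR (complex.Re z).
Proof.
rewrite /cexp cnM cn_real ger0_norm ?expR_ge0 //.
by rewrite {1}/cn /= cos2Dsin2 sqrtr1 mulr1.
Qed.
Lemma cexp_neq0 z : cexp z != 0.
Proof. by rewrite -cn_gt0 cn_cexp expR_gt0. Qed.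
Lemma cexpN z : cexp (- z) = (cexp z)^-1.
Proof.
apply: (mulIf (cexp_neq0 z)); rewrite mulVf ?cexp_neq0 //.
by rewrite -cexpD addNr cexp0.
Qed.
Lemma cexpX z n : cexp (n%:R * z) = cexp z ^+ n.
Proof.
elim: n => [|n IH]; first by rewrite mul0r cexp0.
by rewrite -natr1 mulrDl mul1r cexpD IH exprSr.
Qed.

Definition tpi : C := 0 +i* (2 * pi).
Lemma nomeE z : nome z = cexp (tpi * z). Proof. by []. Qed.
Lemma nomeD z w : nome (z + w) = nome z * nome w.
Proof. by rewrite !nomeE mulrDr cexpD. Qed.
Lemma nome_neq0 z : nome z != 0. Proof. exact: cexp_neq0. Qed.
Lemma nomeN z : nome (- z) = (nome z)^-1.
Proof. by rewrite !nomeE mulrN cexpN. Qed.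
Lemma nomeX z n : nome (n%:R * z) = nome z ^+ n.
Proof. by rewrite !nomeE mulrCA cexpX. Qed.
Lemma nome_quarter : nome (4^-1) = 'i :> C.
Proof.
have -> : (4^-1 : C) = (4^-1 : R)%:C by rewrite fmorphV rmorph_nat.
rewrite nomeE /cexp /tpi /=.
have -> : 0 * 4^-1 - 2 * pi * 0 = 0 :> R by ring.
have -> : 0 * 0 + 2 * pi * 4^-1 = pi / 2 :> R by field.
by rewrite expR0 cos_pihalf sin_pihalf mul1r.
Qed.
Lemma nome_half : nome (2^-1) = -1 :> C.
Proof.
have -> : (2^-1 : C) = 2%:R * 4^-1 by field.
by rewrite nomeX nome_quarter sqr_i.
Qed.
Lemma nome1 : nome 1 = 1 :> C.
Proof.
have E : (2%:R * 2^-1 : C) = 1 by field.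
by rewrite -{1}E nomeX nome_half sqrrN expr1n.
Qed.
Lemma nome_nat n : nome n%:R = 1 :> C.
Proof. by rewrite -[n%:R]mulr1 nomeX nome1 expr1n. Qed.
Lemma cn_nome z : cn (nome z) = expR (- (2 * pi * complex.Im z)).
Proof. by rewrite nomeE cn_cexp /tpi; case: z => a b /=; congr expR; ring. Qed.
Lemma nome_lt1 z : 0 < complex.Im z -> cn (nome z) < 1.
Proof.
move=> z0; rewrite cn_nome -expR0 ltr_expR oppr_lt0 !mulr_gt0 // ?pi_gt0 //.
Qed.
Lemma nome_le (B : R) z : B <= complex.Im z -> cn (nome z) <= expR (- (2 * pi * B)).
Proof.
by move=> Bz; rewrite cn_nome ler_expR lerN2 ler_wpM2l // mulr_ge0 // ltW // pi_gt0.
Qed.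

(** A bound of order [n] on the derivative gives one of order [n + 1] on the function. Iterated,
    this replaces Taylor expansions of sine, cosine and exponential. *)
Lemma mvt_bound (f df : R -> R) (K : R) (n : nat) (x : R) :
  (forall t : R, is_derive t (1 : R) f (df t)) -> f 0 = 0 ->
  (forall t, `|t| <= `|x| -> `|df t| <= K * `|t| ^+ n) -> 0 <= K ->
  `|f x| <= K * `|x| ^+ n.+1.
Proof.
move=> fd f0 dK K0.
have cf a b : {within `[a, b], continuous f}.
  by apply: derivable_within_continuous => t _; apply: ex_derive.
have [c cx ->] : exists2 c, `|c| <= `|x| & f x = df c * x.
  case: (leP 0 x) => x0.
    have [c] := MVT_segment x0 (fun t _ => fd t) (cf _ _).
    rewrite f0 !subr0 in_itv /= => /andP[c0 cx] ->; exists c => //.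
    by rewrite !ger0_norm //.
  have [c] := MVT_segment (ltW x0) (fun t _ => fd t) (cf _ _).
  rewrite f0 !sub0r in_itv /= => /andP[xc c0] E; exists c; last first.
    by rewrite mulrN in E; apply: oppr_inj.
  by rewrite !ler0_norm ?lerN2 //; apply: ltW.
rewrite normrM exprSr mulrA ler_wpM2r //; apply: le_trans (dK c cx) _.
by rewrite ler_wpM2l // lerXn2r // nnegrE.
Qed.

Lemma sin_bound1 (x : R) : `|sin x| <= `|x|.
Proof.
have := @mvt_bound sin cos 1 0 x; rewrite !mul1r expr1; apply => //; first exact: sin0.
by move=> t _; rewrite expr0 mulr1 ler_norml cos_le1 cos_geN1.
Qed.
Lemma cos_bound2 (x : R) : `|cos x - 1| <= `|x| ^+ 2.
Proof.
have := @mvt_bound (fun x => cos x - 1) (fun x => - sin x) 1 1 x; rewrite !mul1r; apply => //.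
- by move=> t; rewrite -[- sin t]subr0; apply: is_deriveB.
- by rewrite cos0 subrr.
by move=> t _; rewrite normrN mul1r expr1 sin_bound1.
Qed.
Lemma sin_bound3 (x : R) : `|sin x - x| <= `|x| ^+ 3.
Proof.
have := @mvt_bound (fun x => sin x - x) (fun x => cos x - 1) 1 2 x; rewrite !mul1r; apply => //.
- by rewrite sin0 subrr.
by move=> t _; rewrite mul1r cos_bound2.
Qed.

Definition E1 : R := expR 1.
Lemma E1_ge1 : 1 <= E1. Proof. by rewrite /E1 -expR0 ler_expR. Qed.

Lemma exp_bound1 (x : R) : `|x| <= 1 -> `|expR x - 1| <= E1 * `|x|.
Proof.
move=> x1; have := @mvt_bound (fun x => expR x - 1) expR E1 0 x; rewrite expr1; apply => //.
- by move=> t; rewrite -[expR t]subr0; apply: is_deriveB.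
- by rewrite expR0 subrr.
- move=> t tx; rewrite expr0 mulr1 ger0_norm ?expR_ge0 // ler_expR.
  by apply: le_trans (ler_norm _) _; apply: le_trans tx x1.
exact: expR_ge0.
Qed.
Lemma exp_bound2 (x : R) : `|x| <= 1 -> `|expR x - 1 - x| <= E1 * `|x| ^+ 2.
Proof.
move=> x1; have := @mvt_bound (fun x => expR x - 1 - x) (fun x => expR x - 1) E1 1 x; apply => //.
- move=> t; apply: is_deriveB; rewrite -[expR t]subr0; apply: is_deriveB.
- by rewrite expR0 subrr subr0.
- by move=> t tx; rewrite expr1 exp_bound1 // (le_trans tx).
exact: expR_ge0.
Qed.

Lemma is_derive_expRN (t : R) : is_derive t (1 : R) (fun x => expR (- x)) (- expR (- t)).
Proof.
have H := @is_derive1_comp R expR (@GRing.opp R) t (expR (- t)) (-1) _ _.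
by apply: is_derive_eq (H _ _) _; rewrite mulrN1.
Qed.
Lemma expN_bound1 (x : R) : `|x| <= 1 -> `|expR x - expR (- x)| <= 2 * E1 * `|x|.
Proof.
move=> x1; have h := exp_bound1 x1.
have h' : `|expR (- x) - 1| <= E1 * `|x| by rewrite -(normrN x) exp_bound1 // normrN.
have -> : expR x - expR (- x) = (expR x - 1) - (expR (- x) - 1) by ring.
apply: le_trans (ler_normB _ _) _; lra.
Qed.
Lemma expN_bound2 (x : R) : `|x| <= 1 -> `|expR x + expR (- x) - 2| <= 2 * E1 * `|x| ^+ 2.
Proof.
move=> x1; have := @mvt_bound (fun x => expR x + expR (- x) - 2) (fun x => expR x - expR (- x)) (2 * E1) 1 x.
apply => //.
- move=> t; rewrite -[expR t - _]subr0; apply: is_deriveB; apply: is_deriveD; exact: is_derive_expRN.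
- by rewrite oppr0 expR0; ring.
- by move=> t tx; rewrite expr1 expN_bound1 // (le_trans tx).
by rewrite mulr_ge0 // expR_ge0.
Qed.
Lemma expN_bound3 (x : R) : `|x| <= 1 -> `|expR x - expR (- x) - 2 * x| <= 2 * E1 * `|x| ^+ 3.
Proof.
move=> x1; have := @mvt_bound (fun x => expR x - expR (- x) - 2 * x)
  (fun x => expR x + expR (- x) - 2) (2 * E1) 2 x.
apply => //.
- move=> t; apply: is_deriveB.
    by rewrite -[expR (- t)]opprK; apply: is_deriveB; exact: is_derive_expRN.
  by apply: is_derive_eq; rewrite /= /GRing.scale /= mulr1.
- by rewrite oppr0 expR0; ring.
- by move=> t tx; rewrite expN_bound2 // (le_trans tx).
by rewrite mulr_ge0 // expR_ge0.
Qed.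
Lemma expN_lower (x : R) : `|x| <= `|expR x - expR (- x)|.
Proof.
wlog x0 : x / 0 <= x.
  move=> H; case: (leP 0 x) => [/H//|x0].
  by have := H (- x); rewrite normrN opprK distrC; apply; rewrite oppr_ge0 ltW.
apply: le_trans (ler_norm _); rewrite ger0_norm //.
have h1 := expR_ge1Dx x.
have : expR (- x) <= 1 by rewrite -expR0 ler_expR oppr_le0.
lra.
Qed.
(** As [pi <= 4], [u = y / 4] is at most [1/2], where the cubic bound gives [sin u >= 3u/4].
    Doubling twice brings in the factors [cos u] and [cos (2u)], both at least [1/2]. *)
Lemma sin_lower (y : R) : `|y| <= pi / 2 -> `|y| / 8 <= `|sin y|.
Proof.
wlog y0 : y / 0 <= y.
  move=> H; case: (leP 0 y) => [/H//|y0].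
  by rewrite -(normrN y) -(normrN (sin y)) -sinN => h; apply: H => //; rewrite oppr_ge0 ltW.
rewrite ger0_norm // => yp; apply: le_trans (ler_norm _).
have p4 : (pi : R) <= 4 by have := @pihalf_02 R; lra.
have yy : y = 2 * (2 * (y / 4)) by field.
set u := y / 4 in yy *.
have u0 : 0 <= u by rewrite /u; lra.
have u1 : u <= 1 / 2 by rewrite /u; lra.
have c2 (t : R) : 0 <= t -> t <= pi / 4 -> 1 / 2 <= cos t ^+ 2.
  move=> t0 t1; have : 0 <= cos (2 * t) by apply: cos_ge0_pihalf; lra.
  by rewrite (_ : 2 * t = t *+ 2) ?cos_mulr2n; lra.
have c1 (t : R) : 0 <= t -> t <= pi / 4 -> 1 / 2 <= cos t.
  move=> t0 t1; have h := c2 t t0 t1.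
  have : 0 <= cos t by apply: cos_ge0_pihalf; lra.
  have := cos_le1 t; nra.
have s1 : 3 / 4 * u <= sin u.
  have := sin_bound3 u; rewrite ler_norml => /andP[+ _]; rewrite ger0_norm // => h.
  have : u ^+ 3 <= u / 4 by rewrite !exprS expr0; nra.
  lra.
have cu := c1 u u0; have c2u := c1 (2 * u); rewrite yy.
have -> : sin (2 * (2 * u)) = 4 * sin u * cos u * cos (2 * u).
  have sd (t : R) : sin (2 * t) = 2 * sin t * cos t by rewrite mulr_natl sin_mulr2n; ring.
  by rewrite (sd (2 * u)) (sd u); ring.
have h1 : 1 / 2 <= cos u by apply: cu; rewrite /u; lra.
have h2 : 1 / 2 <= cos (2 * u) by apply: c2u; rewrite /u; lra.
have h3 : 1 / 4 <= cos u * cos (2 * u) by nra.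
have -> : 4 * sin u * cos u * cos (2 * u) = 4 * (sin u * (cos u * cos (2 * u))) by ring.
have h4 : 3 / 4 * u * (1 / 4) <= sin u * (cos u * cos (2 * u)) by apply: ler_pM => //; lra.
lra.
Qed.

Lemma cexp_bound2 : exists2 K : R, 0 <= K & forall s, cn s <= 1 -> cn (cexp s - 1 - s) <= K * cn s ^+ 2.
Proof.
exists (3 * E1 + 3 * E1); first by have := E1_ge1; lra.
move=> s s1; have xs := Re_le_cn s; have ys := Im_le_cn s.
apply: le_trans (cn_le_ReIm _) _.
case: s s1 xs ys => x y; set r := cn _ => r1 /= xs ys.
have x1 := le_trans xs r1; have r0 : 0 <= r := cn_ge0 _.
have E := E1_ge1.
have ex : expR x <= E1 by rewrite ler_expR (le_trans (ler_norm _)).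
have ex0 := expR_gt0 x.
have b2 := exp_bound2 x1; have b1 := exp_bound1 x1.
have c2 := cos_bound2 y; have s1 := sin_bound1 y.
have s3 : `|sin y - y| <= 2 * r ^+ 2.
  have y1 : `|y| <= 1 := le_trans ys r1.
  apply: le_trans (sin_bound3 y) _; have := normr_ge0 y; rewrite exprS expr2 -/(`|y| ^+ 2) => y0.
  have : `|y| ^+ 2 <= r ^+ 2 by rewrite lerXn2r // nnegrE.
  have := sqr_ge0 `|y|; nra.
have rr : `|x| ^+ 2 <= r ^+ 2 by rewrite lerXn2r // nnegrE.
have rr' : `|y| ^+ 2 <= r ^+ 2 by rewrite lerXn2r // nnegrE.
rewrite mulrDl; apply: lerD.
  have -> : expR x * cos y - 0 * sin y - 1 - x = (expR x - 1 - x) + expR x * (cos y - 1) by ring.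
  apply: le_trans (ler_normD _ _) _; rewrite normrM (ger0_norm (ltW ex0)).
  have := normr_ge0 (cos y - 1); have := sqr_ge0 r; nra.
have -> : expR x * sin y + 0 * cos y - 0 - y = expR x * (sin y - y) + (expR x - 1) * y by ring.
apply: le_trans (ler_normD _ _) _; rewrite !normrM (ger0_norm (ltW ex0)).
have h1 : expR x * `|sin y - y| <= E1 * (2 * r ^+ 2) by apply: ler_pM => //; apply: ltW.
have h2 : `|expR x - 1| * `|y| <= E1 * r * r.
  apply: ler_pM => //; apply: le_trans b1 _; rewrite ler_wpM2l //; lra.
lra.
Qed.

Lemma ctends_shift (u : nat -> C) l N : ctends (fun n => u (N + n)%N) l -> ctends u l.
Proof.
move=> ul e /ul[M HM]; exists (N + M)%N => n Mn.
by have := HM (n - N)%N; rewrite subnKC; [apply; lia|lia].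
Qed.

(** This is [pi^2 / sin(pi z)^2], written in the nome. *)
Definition rho z : C := tpi ^+ 2 * nome z / (1 - nome z) ^+ 2.

Lemma rho1 z : rho (z + 1) = rho z.
Proof. by rewrite /rho nomeD nome1 mulr1. Qed.
Lemma rho_nat z n : rho (z + n%:R) = rho z.
Proof. by rewrite /rho nomeD nome_nat mulr1. Qed.
Lemma rhoN z : rho (- z) = rho z.
Proof.
rewrite /rho nomeN; have n0 := nome_neq0 z.
have [->|n1] := eqVneq (nome z) 1; first by rewrite invr1.
have h : 1 - nome z != 0 by rewrite subr_eq0 eq_sym.
field; rewrite n0 h /= subr_eq0 n1 //.
Qed.

Lemma rho_double z : nome z != 1 -> rho (z / 2) + rho ((z + 1) / 2) = 4 * rho z.
Proof.
move=> z1; rewrite /rho mulrDl nomeD mul1r nome_half.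
have E : nome z = nome (z / 2) ^+ 2 by rewrite -nomeX; congr nome; field.
rewrite E in z1 *; move: (nome (z / 2)) z1 => v v1.
have h : (1 - v != 0) && (1 + v != 0).
  rewrite -negb_or -mulf_eq0 -subr_sqr expr1n subr_eq0 eq_sym //.
case/andP: h => h1 h2.
field; rewrite h1 /=.
have -> : 1 - v * -1 = 1 + v by ring.
rewrite h2 /= (_ : 1 - v ^+ 2 = (1 - v) * (1 + v)); last by ring.
by rewrite mulf_neq0.
Qed.

Lemma rho_iter n z : nome z != 1 ->
  \sum_(j < 2 ^ n) rho ((z + j%:R) / (2 ^ n)%:R) = (2 ^ n)%:R ^+ 2 * rho z.
Proof.
elim: n z => [|n IH] z z1.
  by rewrite expn0 big_ord_recl big_ord0 addr0 addr0 divr1 expr1n mul1r.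
rewrite expnS mul2n -addnn big_split_ord /= -big_split /=.
rewrite (eq_bigr (fun j : 'I_(2 ^ n) => 4 * rho ((z + j%:R) / (2 ^ n)%:R))) => [|j _].
  by rewrite -mulr_sumr IH // addnn -mul2n natrM; ring.
have n0 : (2 ^ n)%:R != 0 :> C by rewrite pnatr_eq0 expn_eq0.
rewrite -rho_double.
  rewrite addnn -mul2n natrM natrD; congr (rho _ + rho _); field; rewrite n0 //.
apply: contra z1 => /eqP E.
have : nome ((2 ^ n)%:R * ((z + j%:R) / (2 ^ n)%:R)) = 1 by rewrite nomeX E expr1n.
by rewrite mulrCA mulfV // mulr1 nomeD nome_nat mulr1 => ->.
Qed.

(* 1 / rho is the square of a sine, whose deviation from its linear part is cubic. *)
Lemma rho_near0 : exists2 K : R, 0 <= K & forall w, `|complex.Re w| <= 1 / 2 ->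
  `|complex.Im w| * pi <= 1 -> w != 0 -> cn (rho w - w ^- 2) <= K.
Proof.
pose K3 : R := 4 * E1 + 4 * E1 + 2.
have E := E1_ge1; have K30 : 0 <= K3 by rewrite /K3; lra.
pose K := cn (tpi ^+ 2) * (K3 * (10 * K3 + 4) * 16).
exists K; first by rewrite /K !mulr_ge0 ?cn_ge0 //; lra.
move=> w wr wi w0.
have p0 := @pi_gt0 R; have p4 : (pi : R) <= 4 by have := @pihalf_02 R; lra.
pose v := tpi * w / 2; pose D := cexp v - cexp (- v).
have tpi0 : tpi != 0 by rewrite -cn_gt0 /cn /= expr0n add0r sqrtr_sqr gtr0_norm // mulr_gt0.
have v0 : v != 0 by rewrite /v !mulf_neq0 // invr_eq0 pnatr_eq0.
have cv0 : 0 < cn v by rewrite cn_gt0.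
pose x := complex.Re v; pose y := complex.Im v.
have xE : x = - (pi * complex.Im w).
  by rewrite /x /v (cdivn _ 2) /tpi; case: (w) => a b /=; field.
have yE : y = pi * complex.Re w.
  by rewrite /y /v (cdivn _ 2) /tpi; case: (w) => a b /=; field.
have vE : v = x +i* y by rewrite /x /y; case: (v).
have x1 : `|x| <= 1 by rewrite xE normrN normrM gtr0_norm // mulrC.
have y1 : `|y| <= pi / 2 by rewrite yE normrM gtr0_norm //; have := normr_ge0 (complex.Re w); nra.
have xv := Re_le_cn v; have yv := Im_le_cn v; rewrite -/x in xv; rewrite -/y in yv.
have DE : D = ((expR x - expR (- x)) * cos y) +i* ((expR x + expR (- x)) * sin y).
  rewrite /D vE /cexp /= cosN sinN; apply: complex_ext => /=; ring.
(* [|D|^2 = (e^x - e^(-x))^2 + 4 sin(y)^2], and the two squares control [x] and [y] separately. *)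
have Dlow : cn v / 4 <= cn D.
  rewrite -(@ler_pXn2r _ 2%N) ?nnegrE ?cn_ge0 ?divr_ge0 ?cn_ge0 // expr_div_n !cn_sqr -/x -/y DE /=.
  have -> : ((expR x - expR (- x)) * cos y) ^+ 2 + ((expR x + expR (- x)) * sin y) ^+ 2 =
     (expR x - expR (- x)) ^+ 2 + 4 * (expR x * expR (- x)) * sin y ^+ 2.
    have -> : (expR x - expR (- x)) ^+ 2 = (expR x - expR (- x)) ^+ 2 * (cos y ^+ 2 + sin y ^+ 2).
      by rewrite cos2Dsin2 mulr1.
    ring.
  rewrite -expRD subrr expR0 mulr1.
  have h1 : x ^+ 2 <= (expR x - expR (- x)) ^+ 2.
    by rewrite -(real_normK (num_real x)) -(real_normK (num_real (_ - _))) lerXn2r ?nnegrE // expN_lower.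
  have h2 : (`|y| / 8) ^+ 2 <= sin y ^+ 2.
    by rewrite -(real_normK (num_real (sin y))) lerXn2r ?nnegrE ?divr_ge0 // sin_lower.
  rewrite expr_div_n real_normK ?num_real // in h2.
  have := sqr_ge0 x; have := sqr_ge0 y; lra.
have Dup : cn (D - 2 * v) <= K3 * cn v ^+ 3.
  apply: le_trans (cn_le_ReIm _) _; rewrite DE {1 2}vE.
  have -> : complex.Re ((((expR x - expR (- x)) * cos y) +i* ((expR x + expR (- x)) * sin y)) - 2 * (x +i* y)) =
     (expR x - expR (- x) - 2 * x) + (expR x - expR (- x)) * (cos y - 1).
     by rewrite mulr_natl mulr2n /=; ring.
  have -> : complex.Im ((((expR x - expR (- x)) * cos y) +i* ((expR x + expR (- x)) * sin y)) - 2 * (x +i* y)) =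
     (expR x + expR (- x) - 2) * sin y + 2 * (sin y - y).
     by rewrite mulr_natl mulr2n /=; ring.
  have b3 := expN_bound3 x1; have b2 := expN_bound2 x1; have b1 := expN_bound1 x1.
  have c2 := cos_bound2 y; have s1 := sin_bound1 y; have s3 := sin_bound3 y.
  set r := cn v in cv0 xv yv *.
  have rx n : `|x| ^+ n <= r ^+ n by rewrite lerXn2r // nnegrE // ltW.
  have ry n : `|y| ^+ n <= r ^+ n by rewrite lerXn2r // nnegrE // ltW.
  have h1 : `|expR x - expR (- x) - 2 * x| <= 2 * E1 * r ^+ 3.
    by apply: le_trans b3 _; rewrite ler_wpM2l // mulr_ge0 //; lra.
  have h2 : `|(expR x - expR (- x)) * (cos y - 1)| <= 2 * E1 * r ^+ 3.
    rewrite normrM exprS mulrA; apply: ler_pM => //.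
      by apply: le_trans b1 _; rewrite ler_wpM2l // mulr_ge0 //; lra.
    exact: le_trans c2 (ry 2%N).
  have h3 : `|(expR x + expR (- x) - 2) * sin y| <= 2 * E1 * r ^+ 3.
    rewrite normrM exprSr mulrA; apply: ler_pM => //.
      by apply: le_trans b2 _; rewrite ler_wpM2l // mulr_ge0 //; lra.
    exact: le_trans s1 yv.
  have h4 : `|2 * (sin y - y)| <= 2 * r ^+ 3.
    by rewrite normrM ger0_norm // ler_wpM2l // (le_trans s3).
  have := ler_normD (expR x - expR (- x) - 2 * x) ((expR x - expR (- x)) * (cos y - 1)).
  have := ler_normD ((expR x + expR (- x) - 2) * sin y) (2 * (sin y - y)).
  rewrite /K3; have := exprn_ge0 3 (ltW cv0); nra.
have cD0 : 0 < cn D by apply: lt_le_trans Dlow; rewrite divr_gt0.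
have D0 : D != 0 by rewrite -cn_gt0.
have rhoE : rho w = tpi ^+ 2 / D ^+ 2.
  rewrite /rho /D nomeE (_ : tpi * w = 2%:R * v); last by rewrite /v; field.
  rewrite cexpX cexpN; have c0 := cexp_neq0 v; rewrite /D cexpN in D0.
  move: (cexp v) c0 D0 => c c0 D0.
  have h : 1 - c ^+ 2 != 0.
    apply: contra D0 => /eqP h; have -> : c - c^-1 = - ((1 - c ^+ 2) / c) by field.
    by rewrite h mul0r oppr0.
  have -> : c - c^-1 = - ((1 - c ^+ 2) / c) by field.
  by field; rewrite c0 h.
have wE : w ^- 2 = tpi ^+ 2 / (2 * v) ^+ 2.
  by rewrite /v; field; rewrite w0 tpi0.
(* [D - 2v] is cubic in [v] and [D + 2v] linear, so the numerator has order 4, like the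
   denominator. *)
have -> : rho w - w ^- 2 = tpi ^+ 2 * (- ((D - 2 * v) * (D + 2 * v)) / (D ^+ 2 * (2 * v) ^+ 2)).
  by rewrite rhoE wE; field; rewrite D0 v0.
rewrite cnM /K ler_wpM2l ?cn_ge0 // cnM cnN cnV ler_pdivrMr; last first.
  by rewrite cn_gt0 mulf_neq0 // expf_neq0 // mulf_neq0 // pnatr_eq0.
rewrite (cnM (D - _)) (cnM (D ^+ 2)) (cnX D) (cnX (2 * v)) (cnM 2) (cn_nat _ 2).
have v10 : cn v ^+ 2 <= 10.
  have y2 : `|y| <= 2 by lra.
  rewrite cn_sqr -/x -/y -(real_normK (num_real x)) -(real_normK (num_real y)).
  have := normr_ge0 x; have := normr_ge0 y; nra.
have h : cn (D + 2 * v) <= (10 * K3 + 4) * cn v.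
  have -> : D + 2 * v = (D - 2 * v) + 4 * v by ring.
  apply: le_trans (cnD _ _) _; rewrite cnM (cn_nat _ 4) [leRHS]mulrDl lerD2r.
  apply: le_trans Dup _; rewrite exprSr mulrA ler_wpM2r ?cn_ge0 // mulrC ler_wpM2r //.
have hD : (cn v / 4) ^+ 2 <= cn D ^+ 2 by rewrite lerXn2r // nnegrE ?cn_ge0 // divr_ge0 // cn_ge0.
have H1 : cn (D - 2 * v) * cn (D + 2 * v) <= K3 * (10 * K3 + 4) * (cn v ^+ 2) ^+ 2.
  have -> : K3 * (10 * K3 + 4) * (cn v ^+ 2) ^+ 2 = (K3 * cn v ^+ 3) * ((10 * K3 + 4) * cn v) by ring.
  by apply: ler_pM => //; apply: cn_ge0.
apply: le_trans H1 _.
have -> : K3 * (10 * K3 + 4) * 16 * (cn D ^+ 2 * (2 * cn v) ^+ 2) =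
  K3 * (10 * K3 + 4) * (64 * (cn D ^+ 2 * cn v ^+ 2)) by ring.
apply: ler_wpM2l; first by rewrite mulr_ge0 //; lra.
move: hD; rewrite expr_div_n; move: (cn v ^+ 2) (cn D ^+ 2) (sqr_ge0 (cn v)) => a b a0 ab.
nra.
Qed.

(** Periodicity widens the strip from [1/2] to [3/4], which leaves room for the shift by [Re z] in
    [row_lim]. The constant 20 is [4^2 + 2^2], from [|w - 1| >= 1/4] and [|w| >= 1/2]. *)
Lemma rho_near : exists2 K : R, 0 <= K & forall w, `|complex.Re w| <= 3 / 4 ->
  `|complex.Im w| * pi <= 1 -> w != 0 -> cn (rho w - w ^- 2) <= K.
Proof.
have [K K0 H] := rho_near0.
have H' w : 0 <= complex.Re w -> complex.Re w <= 3 / 4 -> `|complex.Im w| * pi <= 1 -> w != 0 ->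
   cn (rho w - w ^- 2) <= K + 20.
  move=> w0 w1 wi wn; case: (leP (complex.Re w) (1 / 2)) => w2.
    by apply: le_trans (H w _ wi wn) _; [rewrite ger0_norm|lra].
  have E1' : complex.Re (w - 1) = complex.Re w - 1 by case: (w).
  have E2' : complex.Im (w - 1) = complex.Im w by case: (w) => a b /=; rewrite subr0.
  have c1 : 1 / 4 <= cn (w - 1) by apply: le_trans (Re_le_cn _); rewrite E1' ler0_norm; lra.
  have c2 : 1 / 2 <= cn w by apply: le_trans (Re_le_cn _); rewrite ger0_norm; lra.
  have n1 : w - 1 != 0 by rewrite -cn_gt0; lra.
  have h : cn (rho (w - 1) - (w - 1) ^- 2) <= K.
    by apply: H => //; rewrite ?E2' // E1' ler0_norm; lra.
  have -> : rho w - w ^- 2 = (rho (w - 1) - (w - 1) ^- 2) + ((w - 1) ^- 2 - w ^- 2).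
    by rewrite -(rho1 (w - 1)) subrK; ring.
  apply: le_trans (cnD _ _) _; apply: lerD => //.
  apply: le_trans (cnB _ _) _; rewrite !cnV !cnX.
  have : (cn (w - 1) ^+ 2)^-1 <= (16^-1)^-1.
    by rewrite lef_pV2 ?posrE ?exprn_gt0 //; [nra| lra].
  have : (cn w ^+ 2)^-1 <= (4^-1)^-1.
    by rewrite lef_pV2 ?posrE ?exprn_gt0 //; [nra| lra].
  rewrite !invrK; lra.
exists (K + 20); first lra.
move=> w wr wi wn; case: (leP 0 (complex.Re w)) => w0.
  by apply: H' => //; rewrite ger0_norm in wr.
have EN : complex.Re (- w) = - complex.Re w by case: (w).
have EI : complex.Im (- w) = - complex.Im w by case: (w).
rewrite -(rhoN w) -sqrrN; apply: H'; rewrite ?EN ?EI ?normrN ?oppr_eq0 //.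
  by rewrite oppr_ge0 ltW.
by rewrite ltr0_norm in wr.
Qed.

Definition row z k : C := \sum_(j < 2 ^ k.+1) (z + j%:R - (2 ^ k)%:R) ^- 2.

(** By [rho_iter], [rho z] is [M^-2] times a sum of [M = 2^(k+1)] values of [rho] at points of the
    strip. Replacing each value by [w^-2] costs at most [K], hence [K / M] in total. *)
Lemma row_lim z : nome z != 1 -> ctends (row z) (rho z).
Proof.
move=> z1; have [K K0 HK] := rho_near.
have p0 := @pi_gt0 R.
pose T := Num.max (`|complex.Re z| * 4) (`|complex.Im z| * pi).
have T0 : 0 <= T by rewrite le_max mulr_ge0.
have [N TN] : exists N : nat, T <= N%:R by exists (Num.bound T); apply/ltW/archi_boundP.
have big k : (N <= k)%N -> T <= (2 ^ k.+1)%:R.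
  move=> Nk; apply: le_trans TN _; rewrite ler_nat; apply: leq_trans Nk _.
  by apply: ltnW; apply: ltn_trans (ltnSn k) _; apply: ltn_expl.
have bnd k : (N <= k)%N -> cn (row z k - rho z) <= K / (2 ^ k.+1)%:R.
  move=> /big; set M := (2 ^ k.+1)%N => TM.
  have M0 : (0 : R) < M%:R by rewrite ltr0n expn_gt0.
  have Mn : (M%:R : C) != 0 by rewrite pnatr_eq0 expn_eq0.
  have z1' : nome (z - (2 ^ k)%:R) != 1 by rewrite nomeD nomeN nome_nat invr1 mulr1.
  have rE : rho z = rho (z - (2 ^ k)%:R) by rewrite -(rho_nat (z - _) (2 ^ k)) subrK.
  have iE := rho_iter k.+1 z1'; rewrite -/M -rE in iE.
  have -> : row z k - rho z = M%:R ^- 2 *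
     \sum_(j < M) (((z - (2 ^ k)%:R + j%:R) / M%:R) ^- 2 - rho ((z - (2 ^ k)%:R + j%:R) / M%:R)).
    rewrite sumrB iE mulrBr mulKf ?expf_neq0 // /row -/M mulr_sumr; congr (_ - _).
    apply: eq_bigr => j _; rewrite addrAC expr_div_n invf_div mulKf ?expf_neq0 //.
  rewrite cnM cnV cnX cn_nat.
  have -> : K / M%:R = M%:R ^- 2 * \sum_(j < M) K.
    by rewrite sumr_const card_ord -mulr_natr; field; rewrite gt_eqF.
  rewrite ler_wpM2l ?invr_ge0 ?exprn_ge0 //; apply: le_trans (cn_sum _ _ _) _.
  apply: ler_sum => j _; rewrite cn_distC; set w := _ / _.
  have wE : w = ((complex.Re z - (2 ^ k)%:R + j%:R) / M%:R) +i* (complex.Im z / M%:R).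
    rewrite /w cdivn -[(2 ^ k)%:R : C](rmorph_nat (real_complex R)) -[j%:R : C](rmorph_nat (real_complex R)).
    by case: (z) => a b /=; rewrite oppr0 !addr0.
  apply: HK.
  - rewrite wE /= normrM normfV (ger0_norm (ltW M0)) ler_pdivrMr //.
    have h4 : `|complex.Re z| * 4 <= M%:R by apply: le_trans TM; rewrite le_max lexx.
    have jM : (j%:R : R) <= M%:R by rewrite ler_nat ltnW.
    have j0 : 0 <= j%:R :> R by [].
    have ME : (M%:R : R) = 2 * (2 ^ k)%:R by rewrite /M expnS natrM.
    move: h4 jM j0 ME; move: (j%:R : R) ((2 ^ k)%:R : R) (M%:R : R) => a b c h4 ac a0 ME; rewrite ME in h4 ac *.
    move: h4; rewrite ler_norml ; case: (ler0P (complex.Re z)); lra.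
  - rewrite wE /= normrM normfV (ger0_norm (ltW M0)) mulrAC ler_pdivrMr // mul1r.
    by apply: le_trans TM; rewrite le_max lexx orbT.
  apply/eqP => w0; move/eqP: z1'; apply; move/eqP: w0.
  rewrite /w mulf_eq0 invr_eq0 (negPf Mn) orbF addr_eq0 => /eqP ->.
  by rewrite nomeN nome_nat invr1.
apply: (@ctends_shift _ _ N).
apply: (ctends_squeeze (b := fun n => K * 2^-1 ^+ n)).
  move=> n; apply: le_trans (bnd _ (leq_addr n N)) _; rewrite ler_wpM2l // exprVn.
  rewrite lef_pV2 ?posrE ?ltr0n ?expn_gt0 ?exprn_gt0 // -natrX ler_nat leq_exp2l //.
  by apply: leqW; apply: leq_addl.
by apply: geo_cvg0; lra.
Qed.

End Exp.

(** * Lambert series and the transformation of the fourth power of theta *)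

Definition sig : fps int := Fps (fun N => \sum_(k < N | (k.+1 %| N)%N) (k.+1%:R : int)).
Definition iden : fps int := Fps (fun n => n%:R).

Lemma sum_quarter (F : nat -> int) M : (forall k, ~~ (4 %| k.+1)%N -> F k = 0) ->
  \sum_(k < 4 * M) F k = \sum_(k < M) F (4 * k + 3)%N.
Proof.
move=> F0; elim: M => [|M IH]; first by rewrite muln0 !big_ord0.
have -> : (4 * M.+1 = (4 * M).+4)%N by lia.
rewrite !big_ord_recr /= IH.
rewrite !(F0 (4 * M)%N, F0 (4 * M).+1, F0 (4 * M).+2) ?addr0; try lia.
by congr (_ + F _); lia.
Qed.

Lemma Lam_sig : Lam = sig - 4 * sub 4 sig.
Proof.
apply: fpsP => N; rewrite coB co_natl co_sub /=.
suff E : \sum_(k < N | (k.+1 %| N)%N) k.+1%:R =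
    \sum_(k < N | (k.+1 %| N)%N && no4 k) k.+1%:R +
    4 * (if (4 %| N)%N then \sum_(k < N %/ 4 | (k.+1 %| N %/ 4)%N) k.+1%:R else 0) :> int.
  by rewrite E addrK.
rewrite (bigID (fun k : 'I_N => no4 k)) /=; congr (_ + _).
case: ifP => [/dvdnP[M ->]|h4]; last first.
  rewrite mulr0 big1 // => k /andP[kN]; rewrite /no4 negbK => k4.
  by rewrite (dvdn_trans k4 kN) in h4.
rewrite mulnK // mulr_sumr big_mkcond [in RHS]big_mkcond mulnC /=.
rewrite (@sum_quarter (fun k => if (k.+1 %| 4 * M)%N && ~~ no4 k then k.+1%:R else 0)).
  apply: eq_bigr => k _; have -> : (4 * k + 3).+1 = (4 * k.+1)%N by lia.
  by rewrite dvdn_pmul2l // /no4 negbK (_ : (4 * k + 3).+1 = 4 * k.+1)%N ?dvdn_mulr //;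
     [rewrite andbT; case: ifP => //; rewrite natrM | lia].
by move=> k; rewrite /no4 => ->; rewrite andbF.
Qed.

(** Reindexing by the involution [d -> N / d] of the divisors, with divisors shifted by one to fit
    the ordinal. *)
Lemma sig_rev N : co sig N = \sum_(k < N | (k.+1 %| N)%N) (N %/ k.+1)%:R.
Proof.
case: N => [|N] /=; first by rewrite !big_ord0.
pose h (k : 'I_N.+1) : 'I_N.+1 := inord (N.+1 %/ k.+1).-1.
have hE (k : 'I_N.+1) : (k.+1 %| N.+1)%N -> (h k).+1 = (N.+1 %/ k.+1)%N.
  move=> kN; have d0 : (0 < N.+1 %/ k.+1)%N by rewrite divn_gt0 // dvdn_leq.
  by rewrite inordK prednK //; apply: leq_trans (leq_div _ _) _.
rewrite (reindex_onto h h) /=; last first.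
  move=> k kN; apply: val_inj; apply: succn_inj; rewrite hE; last by rewrite hE // dvdn_div.
  by rewrite hE // divnA // mulKn.
apply: eq_big => [k|k /andP[hk /eqP E]]; last first.
  by rewrite hE // -E hE // dvdn_div.
apply/andP/idP => [[hk /eqP E]|kN].
  by rewrite -E hE // dvdn_div.
rewrite hE // dvdn_div //; split=> //; apply/eqP; apply: val_inj; apply: succn_inj.
by rewrite hE ?hE ?dvdn_div // divnA // mulKn.
Qed.

Lemma idenE : iden * (1 - X int) ^+ 2 = X int.
Proof.
have E : iden = X int * (iden + geo 1).
  apply: fpsP => -[|n]; rewrite -[X int]expr1 coXnM //= subn1 /=.
  by rewrite dvd1n -natr1.
have G : (1 - X int) * geo 1 = 1 by rewrite -[X int]expr1 geoE.
have H : (1 - X int) * iden = X int * geo 1 by rewrite mulrBl mul1r {1}E; ring.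
have -> : iden * (1 - X int) ^+ 2 = (1 - X int) * ((1 - X int) * iden) by ring.
by rewrite H mulrCA G mulr1.
Qed.

Section Lattice.
Variable R : realType.
Local Notation C := R[i].
Implicit Types z w q t : C.

Lemma pb_iden : pb iden.
Proof. by exists 1%N, 1%N => n /=; rewrite natz; lia. Qed.
Lemma sig_le N : (absz (co sig N) <= N * N)%N.
Proof.
rewrite /=; apply: leq_trans (absz_sum _ _ _) _.
apply: (@leq_trans (\sum_(k < N) N)%N); last by rewrite sum_nat_const card_ord.
by rewrite big_mkcond; apply: leq_sum => k _; case: ifP => // _; rewrite natz; apply: ltn_ord.
Qed.
Lemma pb_sig : pb sig.
Proof. by exists 1%N, 2%N => n; apply: leq_trans (sig_le n) _; lia. Qed.

Lemma geo_unif (A k : nat) (r : R) : 0 <= r < 1 -> exists M rho : R,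
  [/\ 0 <= M, 0 <= rho < 1 & forall a, (forall n, (absz (co a n) <= A * n.+1 ^ k)%N) ->
    forall n q, cn q <= r -> cn (tm a q n) <= M * rho ^+ n].
Proof.
move=> r01; pose b : fps int := Fps (fun n => (A * n.+1 ^ k)%N%:R).
have pbb : pb b by exists A, k => n /=; rewrite natz.
have [M [rho [M0 rho01 H]]] := pb_geo pbb r01.
exists M, rho; split=> // a aA n q qr; apply: le_trans (H n q qr).
rewrite /tm !cnM ler_wpM2r ?cn_ge0 // !cn_int -!intr_norm ler_int -!abszE /= natz absz_nat.
exact: aA.
Qed.

(** The constants depend on the coefficient bound and on [r] but not on the series, so that a whole
    sequence of remainders can be treated at once. *)
Lemma ev_vanish (A k : nat) (r : R) : 0 <= r < 1 -> exists M rho : R,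
  [/\ 0 <= M, 0 <= rho < 1 & forall a J, (forall n, (absz (co a n) <= A * n.+1 ^ k)%N) ->
    (forall n, (n < J)%N -> co a n = 0) ->
    forall q, cn q <= r -> cn (ev a q) <= M * rho ^+ J].
Proof.
move=> r01; have [M [rho [M0 rho01 H]]] := geo_unif A k r01.
exists (M / (1 - rho)), rho; split=> //.
  by rewrite divr_ge0 // subr_ge0 ltW //; case/andP: rho01.
move=> a J aA a0 q qr; have q1 : cn q < 1 by case/andP: r01 => _; apply: le_lt_trans.
have pa : pb a by exists A, k.
have [|l [ul E]] := @ctends_geo _ (ps a q) M rho rho01.
  by move=> n; rewrite /ps big_ord_recr /= addrAC subrr add0r; exact: H.
have := E J; rewrite (evP pa q1 ul) mulrAC.
rewrite (_ : ps a q J = 0) ?subr0 //.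
by rewrite /ps big1 // => i _; rewrite /tm a0 // mul0r.
Qed.

Definition lam (x : C) : C := x / (1 - x) ^+ 2.

Lemma neq1_cn (x : C) : cn x < 1 -> 1 - x != 0.
Proof. by apply: contraTneq => /eqP; rewrite subr_eq0 => /eqP <-; rewrite cn1 ltxx. Qed.

Lemma ev_iden x : cn x < 1 -> ev iden x = lam x.
Proof.
move=> x1; have := congr1 (fun f => ev f x) idenE.
have p1 : pb (1 - X int) by apply: pbD; [apply: (pb_nat 1)|apply/pbN/pb_X].
rewrite evM ?evX ?ev_X //; try exact: pbX; try exact: pb_iden.
rewrite evD ?evN ?ev_X ?(ev_nat 1) //; try exact: pb_X; try exact: (pb_nat 1);
  last by apply/pbN/pb_X.
move=> E; rewrite /lam -[X in X / _]E mulfK // expf_neq0 // neq1_cn //.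
Qed.

(** The partial sum is the value of a series that agrees with [sig] up to index [J]. The
    coefficients of the difference lie between 0 and [N^2], so its value is bounded by [M rho^J]. *)
Lemma lambert q : cn q < 1 -> ctends (fun J => \sum_(j < J) lam (q ^+ j.+1)) (ev sig q).
Proof.
move=> q1; have q01 : 0 <= cn q < 1 by rewrite cn_ge0.
have [M [rho [M0 rho01 H]]] := ev_vanish 1 2 q01.
apply: (ctends_squeeze (b := fun J => M * rho ^+ J)); last exact: geo_cvg0.
move=> J; pose a := \sum_(j < J) sub j.+1 iden.
have pa : pb a by apply: pb_sum => j; apply/pb_sub/pb_iden.
have aE N : co a N = \sum_(j < J | (j.+1 %| N)%N) (N %/ j.+1)%:R.
  rewrite co_sum [RHS]big_mkcond; apply: eq_bigr => j _; rewrite co_sub.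
  by case: ifP.
have -> : \sum_(j < J) lam (q ^+ j.+1) = ev a q.
  rewrite ev_sum //; last by move=> j; apply/pb_sub/pb_iden.
  apply: eq_bigr => j _; rewrite ev_sub ?ev_iden //; first exact: cnX_lt1.
  exact: pb_iden.
rewrite cn_distC -evN // -evD //; [|exact: pb_sig|exact: pbN].
have part N : (N <= J)%N -> co a N = co sig N.
  move=> NJ; rewrite aE sig_rev -!(big_mkord (fun k => (k.+1 %| N)%N) (fun k => (N %/ k.+1)%:R)).
  case: N NJ => [|N] NJ.
    by rewrite [RHS]big_geq // big1 // => k _; rewrite div0n.
  rewrite (@big_cat_nat _ _ _ N.+1) //= [X in _ + X]big_nat_cond [X in _ + X]big1 ?addr0 //.
  by move=> k /andP[/andP[Nk _] /dvdn_leq]; lia.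
apply: H (lexx _) => [N|N NJ]; last by rewrite coB part ?subrr // ltnW.
have sE : co sig N - co a N = ((absz (co sig N))%:Z - (absz (co a N))%:Z).
  by rewrite !abszE !ger0_norm // ?aE /=; apply: sumr_ge0.
have aN : (absz (co a N) <= absz (co sig N))%N.
  rewrite -lez_nat !abszE !ger0_norm; [|by rewrite /=; apply: sumr_ge0|by rewrite aE; apply: sumr_ge0].
  case: (leqP N J) => [/part -> //|JN]; rewrite aE sig_rev.
  rewrite -!(big_mkord (fun k => (k.+1 %| N)%N) (fun k => (N %/ k.+1)%:R)).
  rewrite [leRHS](@big_cat_nat _ _ _ J) //=; last exact: ltnW.
  by rewrite lerDl; apply: sumr_ge0.
rewrite coB sE; have := sig_le N; lia.
Qed.

Lemma sum_odd (F : nat -> C) J :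
  \sum_(u < J) F u.*2.+1 = \sum_(j < J.*2) F j.+1 - \sum_(j < J) F j.+1.*2.
Proof.
by rewrite (sum_double (fun j => F j.+1)) big_split /= addrK.
Qed.

Lemma lam_neg x : x ^+ 2 != 1 -> lam (- x) = - lam x + 4 * lam (x ^+ 2).
Proof.
move=> x1; have h : (1 - x != 0) && (1 + x != 0).
  by rewrite -negb_or -mulf_eq0 -subr_sqr expr1n subr_eq0 eq_sym.
case/andP: h => h1 h2; rewrite /lam opprK.
have -> : 1 - x ^+ 2 = (1 - x) * (1 + x) by ring.
by field; rewrite h1 h2.
Qed.

Lemma cn_neq1 (x : C) : cn x < 1 -> x != 1.
Proof. by apply: contraTneq => ->; rewrite cn1 ltxx. Qed.

Lemma lambert_sub d q : (0 < d)%N -> cn q < 1 ->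
  ctends (fun J => \sum_(j < J) lam (q ^+ (d * j.+1))) (ev sig (q ^+ d)).
Proof.
move=> d0 q1; apply: ctends_ext (lambert (cnX_lt1 d0 q1)) => J.
by apply: eq_bigr => j _; rewrite exprM.
Qed.

Lemma ctends_dbl (u : nat -> C) l : ctends u l -> ctends (fun n => u n.*2) l.
Proof. by apply: ctends_sub => n; rewrite -addnn leq_addr. Qed.

Lemma lambert_odd q : cn q < 1 ->
  ctends (fun J => \sum_(u < J) lam (q ^+ u.*2.+1)) (ev sig q - ev sig (q ^+ 2)).
Proof.
move=> q1; have := ctendsD (ctends_dbl (lambert q1)) (ctendsZ (-1) (@lambert_sub 2 q isT q1)).
rewrite mulN1r; apply: ctends_ext => J; rewrite (sum_odd (fun j => lam (q ^+ j))) mulN1r.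
by congr (_ - _); apply: eq_bigr => j _; rewrite mul2n.
Qed.

(** In the Lambert series, [q -> -q] fixes the terms of even index and changes those of odd index by
    [lam_neg]. *)
Lemma sig_neg q : cn q < 1 ->
  ev sig (- q) = - ev sig q + 6 * ev sig (q ^+ 2) - 4 * ev sig (q ^+ 4).
Proof.
move=> q1; have qN1 : cn (- q) < 1 by rewrite cnN.
have q2 := cnX_lt1 (isT : (0 < 2)%N) q1.
have h1 := lambert_odd q1; have h2 := lambert_odd q2.
have h3 := @lambert_sub 2 q isT q1.
have := ctendsD (ctendsD (ctendsZ (-1) h1) (ctendsZ 4 h2)) h3.
rewrite -exprM; set l := (X in ctends _ X) => hl.
have -> : - ev sig q + 6 * ev sig (q ^+ 2) - 4 * ev sig (q ^+ 4) = l by rewrite /l; ring.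
apply: ctends_unique (ctends_dbl (lambert qN1)) _; apply: ctends_ext hl => J.
rewrite (sum_double (fun j => lam ((- q) ^+ j.+1))) big_split /=; congr (_ + _); last first.
  by apply: eq_bigr => j _; congr lam; rewrite -doubleS -mul2n !exprM sqrrN.
rewrite !mulr_sumr -big_split; apply: eq_bigr => j _ /=.
rewrite mulN1r -exprM mulnC exprM -lam_neg; last first.
  by rewrite -exprM cn_neq1 // cnX_lt1 // muln_gt0.
by congr lam; rewrite -[in RHS]mulN1r exprMn -signr_odd /= odd_double expr1 mulN1r.
Qed.

Lemma pb_gs (e : nat -> nat) : pb (gs e).
Proof.
exists 1%N, 1%N => n; rewrite /= mul1n expn1; apply: leq_trans (absz_sum _ _ _) _.
by apply: (@leq_trans (\sum_(k < n.+1) 1)%N); [apply: leq_sum => k _; case: eqP|rewrite sum_nat_const card_ord muln1].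
Qed.
Lemma pb_phi : pb phi.
Proof. by apply: pbD; [apply: (pb_nat 1)|apply: pbM; [apply: (pb_nat 2)|apply: pb_gs]]. Qed.
Lemma pb_psi : pb psi. Proof. exact: pb_gs. Qed.

Lemma phi4_sig q : cn q < 1 -> ev phi q ^+ 4 = 1 + 8 * (ev sig q - 4 * ev sig (q ^+ 4)).
Proof.
move=> q1; rewrite -evX //; last exact: pb_phi.
rewrite four_squares Lam_sig.
have p4 : pb (4 * sub 4 sig) by apply: pbM; [apply: (pb_nat 4)|apply/pb_sub/pb_sig].
have p5 : pb (sig - 4 * sub 4 sig) by apply: pbD; [apply: pb_sig|apply: pbN].
rewrite evD //; [|exact: (pb_nat 1)|by apply: pbM => //; apply: (pb_nat 8)].
rewrite (ev_nat 1) // evM //; last exact: (pb_nat 8).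
rewrite (ev_nat 8) // evD //; [|exact: pb_sig|exact: pbN].
by rewrite evN // evM ?(ev_nat 4) ?ev_sub //; [exact: pb_sig|exact: (pb_nat 4)|apply/pb_sub/pb_sig].
Qed.

Lemma phi4_diff q : cn q < 1 -> ev phi q ^+ 4 - ev phi (- q) ^+ 4 =
  16 * (ev sig q - 3 * ev sig (q ^+ 2) + 2 * ev sig (q ^+ 4)).
Proof.
move=> q1; rewrite !phi4_sig ?cnN // sig_neg // (_ : (- q) ^+ 4 = q ^+ 4); last by ring.
by ring.
Qed.
Lemma phi4_neg q : cn q < 1 -> ev phi (- q) ^+ 4 =
  1 + 8 * (- ev sig q + 6 * ev sig (q ^+ 2) - 8 * ev sig (q ^+ 4)).
Proof.
move=> q1; rewrite !phi4_sig ?cnN // sig_neg // (_ : (- q) ^+ 4 = q ^+ 4); last by ring.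
by ring.
Qed.

(** * Interchange of summations for a double series with cubic decay *)

Section Fubini.
Variables (h : nat -> nat -> C) (K : R).
Hypothesis K0 : 0 <= K.
Hypothesis hK : forall u v, cn (h u v) <= K / (u + v + 1)%:R ^+ 3.

Lemma tele_sum (f : nat -> R) N M : (N <= M)%N ->
  (forall u, (N <= u < M)%N -> f u <= u%:R^-1 - u.+1%:R^-1) ->
  \sum_(N <= u < M) f u <= N%:R^-1.
Proof.
move=> NM H; rewrite big_nat; apply: le_trans (ler_sum _ H) _; rewrite -big_nat.
have -> : \sum_(N <= u < M) (u%:R^-1 - u.+1%:R^-1 : R) = N%:R^-1 - M%:R^-1.
  rewrite -[RHS]opprB -(@telescope_sumr _ N M (fun u => u%:R^-1)) // -sumrN.
  by apply: eq_bigr => u _; rewrite opprB.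
by rewrite lerBlDr lerDl invr_ge0.
Qed.

Lemma sum_shift (F : nat -> R) u J : \sum_(u <= w < u + J) F w = \sum_(v < J) F (u + v)%N.
Proof.
elim: J => [|J IH]; first by rewrite addn0 big_geq // big_ord0.
by rewrite addnS big_nat_recr ?leq_addr //= IH big_ord_recr.
Qed.

(** [(u+v+1)^-3] is at most [(u+1)^-1] times [((u+v)(u+v+1))^-1], and the second factor telescopes
    in [v]. *)
Lemma inner_sum u J : (0 < u)%N -> \sum_(v < J) K / (u + v + 1)%:R ^+ 3 <= K * (u%:R^-1 - u.+1%:R^-1).
Proof.
move=> u0; rewrite -mulr_sumr ler_wpM2l //.
have u0' : 0 < u%:R :> R by rewrite ltr0n.
have -> : u%:R^-1 - u.+1%:R^-1 = u.+1%:R^-1 * u%:R^-1 :> R.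
  by rewrite -natr1; field; rewrite gt_eqF //= gt_eqF // ltr_wpDl // ltW.
apply: (@le_trans _ _ (u.+1%:R^-1 * \sum_(u <= w < u + J) (w%:R^-1 - w.+1%:R^-1))); last first.
  rewrite ler_wpM2l ?invr_ge0 //; apply: tele_sum => //; exact: leq_addr.
rewrite sum_shift mulr_sumr; apply: ler_sum => v _.
rewrite addn1 (addnC u).
have v0 : 0 <= v%:R :> R by [].
rewrite -!natr1 natrD; move: (u%:R : R) (v%:R : R) u0' v0 => a b a0 b0.
have e1 : 0 < b + a by lra. have e2 : 0 < b + a + 1 by lra. have e3 : 0 < a + 1 by lra.
have -> : (b + a)^-1 - (b + a + 1)^-1 = ((b + a) * (b + a + 1))^-1 by field; rewrite !gt_eqF.
rewrite -invfM lef_pV2 ?posrE ?exprn_gt0 ?mulr_gt0 //.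
nra.
Qed.

(** The error does not depend on the number [J] of columns, so rows and columns may be cut off at
    the same [2^n]. *)
Lemma column_error (Q : nat -> C) N J : (0 < N)%N ->
  (forall v, ctends (fun n => \sum_(u < 2 ^ n) h u v) (Q v)) ->
  cn (\sum_(v < J) Q v - \sum_(v < J) \sum_(u < N) h u v) <= K / N%:R.
Proof.
move=> N0 HQ.
have L : ctends (fun n => \sum_(v < J) \sum_(u < 2 ^ n) h u v - \sum_(v < J) \sum_(u < N) h u v)
   (\sum_(v < J) Q v - \sum_(v < J) \sum_(u < N) h u v).
  by apply: ctendsD; [apply: ctends_sum|apply: ctends_cst].
apply: (ctends_cn (ctends_sub (s := fun n => (N + n)%N) _ L)) => [n|n]; first exact: leq_addl.
have NM : (N <= 2 ^ (N + n))%N.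
  by apply: leq_trans (leq_addr n N) _; apply: ltnW; apply: ltn_expl.

have E v : \sum_(u < 2 ^ (N + n)) h u v - \sum_(u < N) h u v = \sum_(N <= u < 2 ^ (N + n)) h u v.
  rewrite -!(big_mkord xpredT (fun u => h u v)) (@big_cat_nat _ _ _ N) //=.
  by rewrite addrAC subrr add0r.
rewrite -sumrB (eq_bigr (fun v : 'I_J => \sum_(N <= u < 2 ^ (N + n)) h u v)) => [|v _]; last exact: E.
rewrite exchange_big /=.
apply: le_trans (cn_sum _ _ _) _.
apply: (@le_trans _ _ (K * \sum_(N <= u < 2 ^ (N + n)) (u%:R^-1 - u.+1%:R^-1))); last first.
  by rewrite ler_wpM2l //; apply: tele_sum.
rewrite mulr_sumr !big_nat; apply: ler_sum => u /andP[Nu _].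
apply: le_trans (cn_sum _ _ _) _; apply: le_trans (inner_sum J (leq_trans N0 Nu)).
by apply: ler_sum.
Qed.
End Fubini.

Lemma fubini_double (h : nat -> nat -> C) (K : R) (P Q : nat -> C) (p q : C) : 0 <= K ->
  (forall u v, cn (h u v) <= K / (u + v + 1)%:R ^+ 3) ->
  (forall u, ctends (fun n => \sum_(v < 2 ^ n) h u v) (P u)) ->
  (forall v, ctends (fun n => \sum_(u < 2 ^ n) h u v) (Q v)) ->
  ctends (fun N => \sum_(u < N) P u) p -> ctends (fun N => \sum_(v < N) Q v) q -> p = q.
Proof.
move=> K0 hK HP HQ Hp Hq.
have hK' u v : cn (h v u) <= K / (u + v + 1)%:R ^+ 3 by rewrite (addnC u).
have e2 n : (n <= 2 ^ n)%N by apply: ltnW; apply: ltn_expl.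
have Hp' := ctends_sub e2 Hp; have Hq' := ctends_sub e2 Hq.
have D : ctends (fun n => \sum_(u < 2 ^ n) P u - \sum_(v < 2 ^ n) Q v) 0.
  apply: (ctends_squeeze (b := fun n => 2 * K * 2^-1 ^+ n)); last by apply: geo_cvg0; lra.
  move=> n; have N0 : (0 < 2 ^ n)%N by rewrite expn_gt0.
  have b1 := column_error K0 hK (2 ^ n) N0 HQ.
  have b2 := column_error K0 hK' (2 ^ n) N0 HP.
  rewrite exchange_big /= in b2; rewrite subr0.
  apply: le_trans (cn_tri (\sum_(v < 2 ^ n) \sum_(u < 2 ^ n) h u v) _ _) _.
  rewrite (cn_distC _ (\sum_(v < 2 ^ n) Q v)) exprVn -natrX; move: b1 b2.
  by rewrite [X in _ -> _ -> _ <= X]mulrAC [X in _ -> _ -> _ <= X](_ : _ = K / (2 ^ n)%:R + K / (2 ^ n)%:R); [move=> b1 b2; apply: lerD|field].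
have := ctendsD D Hq'; rewrite add0r => Hpq.
by apply: ctends_unique Hp' _; apply: ctends_ext Hpq => n; rewrite subrK.
Qed.

(** * The alternating lattice sum and the inversion law of theta^4 *)

Section Slaw.
Variable t : C.
Hypothesis t0 : 0 < complex.Im t.

Definition lat (a j : int) : C := a%:~R * t + 2 * j%:~R.
(** The inverse squares are not summable over the lattice; pairing an even [j] with the next odd one
    gives cubic decay. In [lath], [a] runs through [2u + 1] and its opposite, [l] through [v] and
    [-(v + 1)], so that natural numbers [u], [v] cover everything once. *)
Definition latg (a l : int) : C := (lat a (2 * l)) ^- 2 - (lat a (2 * l + 1)) ^- 2.
Definition lath (u v : nat) : C :=
  (latg u.*2.+1 v + latg u.*2.+1 (- v.+1%:Z)) + (latg (- u.*2.+1%:Z) v + latg (- u.*2.+1%:Z) (- v.+1%:Z)).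

Lemma rowE z n : row z n = \sum_(v < 2 ^ n) ((z + v%:R) ^- 2 + (z - v.+1%:R) ^- 2).
Proof.
rewrite /row expnS mul2n -addnn big_split_ord /= big_split /= addrC; congr (_ + _).
  by apply: eq_bigr => v _; rewrite natrD addrA addrAC addrK.
rewrite (reindex_inj rev_ord_inj) /=; apply: eq_bigr => v _; congr (_ ^- 2).
by rewrite natrB //; ring.
Qed.

Lemma t_neq0 : t != 0.
Proof. by apply: contraTneq t0 => ->; rewrite ltxx. Qed.

Lemma lat_lower : exists2 c : R, 0 < c & forall a j : int,
  c * (absz a + absz j)%:R <= cn (lat a j).
Proof.
pose y := complex.Im t; pose T := y^-1 + 1 + cn t / y.
have y0 : 0 < y by []. have yV : 0 < y^-1 by rewrite invr_gt0.
have T0 : 0 < T by rewrite /T; have : 0 <= cn t / y by [rewrite divr_ge0 ?cn_ge0 ?ltW]; lra.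
exists T^-1; first by rewrite invr_gt0.
move=> a j; rewrite mulrC ler_pdivrMr //.
have aE : cn (a%:~R : C) = (absz a)%:R by rewrite cn_int -intr_norm -abszE -pmulrn.
have jE : cn (j%:~R : C) = (absz j)%:R by rewrite cn_int -intr_norm -abszE -pmulrn.
have ha : (absz a)%:R * y <= cn (lat a j).
  apply: le_trans (Im_le_cn _); rewrite -aE cn_int -[y]gtr0_norm // -normrM.
  have -> : complex.Im (lat a j) = a%:~R * y; last by [].
  rewrite /lat /y -!(rmorph_int (real_complex R)) -[2 : C](rmorph_nat (real_complex R)).
  by case: (t) => b c /=; ring.
have hj : (absz j)%:R <= cn (lat a j) + (absz a)%:R * cn t.
  rewrite -jE -aE -cnM; apply: (@le_trans _ _ (cn (2 * j%:~R : C))).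
    by rewrite cnM (cn_nat _ 2) ler_peMl ?cn_ge0 // ler1n.
  by have -> : 2 * j%:~R = lat a j - a%:~R * t; [rewrite /lat; ring|apply: cnB].
have h1 : (absz a)%:R <= cn (lat a j) / y by rewrite ler_pdivlMr.
rewrite natrD /T !mulrDr mulr1; have := cn_ge0 t.
have h2 : (absz a)%:R * cn t <= cn (lat a j) / y * cn t by rewrite ler_wpM2r ?cn_ge0.
have -> : cn (lat a j) * (cn t / y) = cn (lat a j) / y * cn t by rewrite mulrCA mulrC mulrAC.
lra.
Qed.

Lemma latg_bound : exists2 K : R, 0 <= K & forall (a l : int) (u v : nat),
  (absz a = u.*2.+1)%N -> (v <= absz (2 * l)%R)%N -> (v <= absz (2 * l + 1)%R)%N ->
  cn (latg a l) <= K / (u + v + 1)%:R ^+ 3.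
Proof.
have [c c0 H] := lat_lower; exists (4 / c ^+ 3); first by rewrite divr_ge0 // exprn_ge0 // ltW.
move=> a l u v aE v1 v2; rewrite /latg.
set s : R := (u + v + 1)%:R; have s0 : 0 < s by rewrite ltr0n addn1.
have low j : (v <= absz j)%N -> c * s <= cn (lat a j).
  move=> vj; apply: le_trans (H a j); rewrite ler_wpM2l ?(ltW c0) // ler_nat aE; lia.
have h1 := low _ v1; have h2 := low _ v2.
have E : lat a (2 * l + 1) = lat a (2 * l) + 2 by rewrite /lat intrD; ring.
rewrite {}E in h2 *; move: (lat a (2 * l)) h1 h2 => w h1 h2.
have cs : 0 < c * s by rewrite mulr_gt0.
have w0 : w != 0 by rewrite -cn_gt0 (lt_le_trans cs).
have w2 : w + 2 != 0 by rewrite -cn_gt0 (lt_le_trans cs).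
have -> : w ^- 2 - (w + 2) ^- 2 = 2 * (w^-1 * (w + 2) ^- 2 + w ^- 2 * (w + 2)^-1).
  by field; rewrite w0 w2.
have i1 : cn w^-1 <= (c * s)^-1 by rewrite cnV lef_pV2 // posrE // (lt_le_trans cs).
have i2 : cn (w + 2)^-1 <= (c * s)^-1 by rewrite cnV lef_pV2 // posrE // (lt_le_trans cs).
have -> : 4 / c ^+ 3 / s ^+ 3 = 2 * ((c * s)^-1 * (c * s)^-1 ^+ 2 + (c * s)^-1 ^+ 2 * (c * s)^-1).
  by field; rewrite !gt_eqF.
rewrite cnM (cn_nat _ 2) ler_wpM2l //; apply: le_trans (cnD _ _) _.
have sq x : cn x^-1 <= (c * s)^-1 -> cn (x ^- 2) <= (c * s)^-1 ^+ 2.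
  by move=> h; rewrite -exprVn cnX lerXn2r // nnegrE ?cn_ge0 // invr_ge0 ltW.
apply: lerD; rewrite cnM; apply: ler_pM => //; try exact: cn_ge0; exact: sq.
Qed.

Lemma lath_bound : exists2 K : R, 0 <= K & forall u v, cn (lath u v) <= K / (u + v + 1)%:R ^+ 3.
Proof.
have [K K0 H] := latg_bound; exists (4 * K); first by rewrite mulr_ge0.
move=> u v; rewrite /lath.
have h1 : cn (latg u.*2.+1 v) <= K / (u + v + 1)%:R ^+ 3 by apply: H; lia.
have h2 : cn (latg u.*2.+1 (- v.+1%:Z)) <= K / (u + v + 1)%:R ^+ 3 by apply: H; lia.
have h3 : cn (latg (- u.*2.+1%:Z) v) <= K / (u + v + 1)%:R ^+ 3 by apply: H; lia.
have h4 : cn (latg (- u.*2.+1%:Z) (- v.+1%:Z)) <= K / (u + v + 1)%:R ^+ 3 by apply: H; lia.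
rewrite -mulrA; apply: le_trans (cnD _ _) _.
have := cnD (latg u.*2.+1 v) (latg u.*2.+1 (- v.+1%:Z)).
have := cnD (latg (- u.*2.+1%:Z) v) (latg (- u.*2.+1%:Z) (- v.+1%:Z)).
lra.
Qed.

Lemma Im_int_mul (a : int) (z : C) : complex.Im (a%:~R * z) = a%:~R * complex.Im z.
Proof. by rewrite -(rmorph_int (real_complex R)); case: z => b c /=; ring. Qed.

Lemma nome_neq1 (z : C) : complex.Im z != 0 -> nome z != 1.
Proof.
move=> z0; apply: contra z0 => /eqP E.
have := congr1 (@cn R) E; rewrite cn_nome cn1 => h.
have /expR_inj/eqP : expR (- (2 * pi * complex.Im z)) = expR 0 by rewrite h expR0.
rewrite oppr_eq0.
by rewrite !mulf_eq0 pnatr_eq0 /= (gt_eqF (pi_gt0 R)).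
Qed.

Lemma rho_half (z : C) : nome (2 * z) != 1 -> rho (z + 2^-1) = 4 * rho (2 * z) - rho z.
Proof.
move=> h; rewrite -(rho_double h); have -> : 2 * z / 2 = z by field.
by have -> : (2 * z + 1) / 2 = z + 2^-1; [field|ring].
Qed.

(** With [z = a t / 4], even and odd [j] contribute [rho z / 16] and [rho (z + 1/2) / 16];
    [rho_half] expresses the second by [rho z] and [rho (2z)]. *)
Lemma row_latg (a : int) : a != 0 ->
  ctends (fun n => \sum_(v < 2 ^ n) (latg a v + latg a (- v.+1%:Z)))
    (8^-1 * rho (a%:~R * t / 4) - 4^-1 * rho (a%:~R * t / 2)).
Proof.
move=> a0; set z := a%:~R * t / 4.
have zE : 2 * z = a%:~R * t / 2 by rewrite /z; field.
have zI : complex.Im z != 0.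
  rewrite /z (cdivn _ 4) /= Im_int_mul !mulf_neq0 ?invr_eq0 ?pnatr_eq0 ?intr_eq0 //.
  by rewrite gt_eqF.
have zI2 : complex.Im (2 * z) != 0.
  by rewrite (Im_int_mul 2) mulf_neq0 // intr_eq0.
have zI3 : complex.Im (z + 2^-1) != 0.
  suff -> : complex.Im (z + 2^-1) = complex.Im z by [].
  have -> : (2^-1 : C) = (2^-1 : R)%:C by rewrite fmorphV rmorph_nat.
  by case: (z) => b c /=; rewrite addr0.
have H := ctendsZ (16^-1) (ctendsD (row_lim (nome_neq1 zI)) (ctendsZ (-1) (row_lim (nome_neq1 zI3)))).
rewrite -zE.
have -> : 8^-1 * rho z - 4^-1 * rho (2 * z) = 16^-1 * (rho z + -1 * rho (z + 2^-1)).
  rewrite rho_half; last exact: nome_neq1.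
  by move: (rho z) (rho (2 * z)) => r1 r2; field.
apply: ctends_ext H => n; rewrite !rowE mulN1r -sumrB mulr_sumr.
have eV (w w' : C) : w = 4 * w' -> w ^- 2 = 16^-1 * w' ^- 2.
  by move=> ->; rewrite exprMn invfM; congr (_ * _); rewrite -natrX.
apply: eq_bigr => v _; rewrite /latg.
rewrite (eV (lat a (2 * (v : nat)%:Z)) (z + v%:R)); last by rewrite /lat /z intrM -pmulrn; field.
rewrite (eV (lat a (2 * (v : nat)%:Z + 1)) (z + 2^-1 + v%:R)); last by rewrite /lat /z intrD intrM -pmulrn; field.
rewrite (eV (lat a (2 * - v.+1%:Z)) (z - v.+1%:R)); last by rewrite /lat /z intrM intrN -pmulrn; field.
rewrite (eV (lat a (2 * - v.+1%:Z + 1)) (z + 2^-1 - v.+1%:R)); last by rewrite /lat /z intrD intrM intrN -pmulrn; field.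
move: ((z + v%:R) ^- 2) ((z + 2^-1 + v%:R) ^- 2) ((z - v.+1%:R) ^- 2) ((z + 2^-1 - v.+1%:R) ^- 2) => x1 x2 x3 x4.
by ring.
Qed.

Local Notation Q := (nome (t / 4)).
Local Notation q := (nome (- t^-1)).

Lemma rho_lam (z : C) : rho z = tpi R ^+ 2 * lam (nome z).
Proof. by rewrite /rho /lam mulrA. Qed.

Lemma Im_divn (z : C) n : complex.Im (z / n%:R) = complex.Im z / n%:R.
Proof. by rewrite cdivn. Qed.
Lemma Q_lt1 : cn Q < 1.
Proof. by apply: nome_lt1; rewrite Im_divn divr_gt0. Qed.
Lemma Im_Vneg (z : C) : complex.Im (- z^-1) = complex.Im z / cn z ^+ 2.
Proof.
by rewrite cn_sqr; case: z => a b /=; rewrite opprK.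
Qed.
Lemma q_lt1 : cn q < 1.
Proof. by apply: nome_lt1; rewrite Im_Vneg divr_gt0 // exprn_gt0 // cn_gt0 t_neq0. Qed.

Definition rowP u : C := 4^-1 * (tpi R ^+ 2 * (lam (Q ^+ u.*2.+1) - 2 * lam (Q ^+ (2 * u.*2.+1)))).

Lemma row_lath u : ctends (fun n => \sum_(v < 2 ^ n) lath u v) (rowP u).
Proof.
have n0 : u.*2.+1%:Z != 0 by []. have n0' : - u.*2.+1%:Z != 0 by rewrite oppr_eq0.
have := ctendsD (row_latg n0) (row_latg n0').
have e1 : rho (u.*2.+1%:~R * t / 4) = tpi R ^+ 2 * lam (Q ^+ u.*2.+1).
  by rewrite rho_lam -mulrA -pmulrn nomeX.
have e2 : rho (u.*2.+1%:~R * t / 2) = tpi R ^+ 2 * lam (Q ^+ (2 * u.*2.+1)).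
  by rewrite rho_lam -nomeX; congr (_ * lam (nome _)); rewrite natrM -pmulrn; field.
rewrite intrN !mulNr !rhoN e1 e2.
have -> : forall A B c : C, 8^-1 * (c * A) - 4^-1 * (c * B) + (8^-1 * (c * A) - 4^-1 * (c * B)) =
  4^-1 * (c * (A - 2 * B)) by move=> A B c; field.
by apply: ctends_ext => n; rewrite -big_split.
Qed.

(** The sum of [(a t + 2 j)^-2] over all odd [a], because
    [(2u + 1) t + 2 j = 2 t (u + 1/2 + j / t)]. *)
Definition colr (j : int) : C := (4 * t ^+ 2)^-1 * rho (2^-1 + j%:~R / t).

Lemma nome_half_ne (j : int) : nome (2^-1 + j%:~R / t) != 1.
Proof.
have [->|j0] := eqVneq j 0.
  by rewrite mul0r addr0 nome_half eq_sym -subr_eq0 opprK -(natrD _ 1 1) pnatr_eq0.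
apply: nome_neq1.
have -> : complex.Im (2^-1 + j%:~R / t) = - (j%:~R * complex.Im (- t^-1)).
  rewrite -Im_int_mul mulrN; move: (j%:~R / t) => w.
  have -> : (2^-1 : C) = (2^-1 : R)%:C by rewrite fmorphV rmorph_nat.
  by case: w => b c /=; rewrite add0r opprK.
by rewrite oppr_eq0 mulf_neq0 ?intr_eq0 // Im_Vneg gt_eqF // divr_gt0 // exprn_gt0 // cn_gt0 t_neq0.
Qed.

Lemma odd_cast u : (u.*2.+1%:Z)%:~R = 2 * u%:R + 1 :> C.
Proof. by rewrite -pmulrn -addn1 natrD -mul2n natrM. Qed.

Lemma col_lat (j : int) :
  ctends (fun n => \sum_(u < 2 ^ n) ((lat u.*2.+1 j) ^- 2 + (lat (- u.*2.+1%:Z) j) ^- 2)) (colr j).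
Proof.
apply: ctends_ext (ctendsZ ((4 * t ^+ 2)^-1) (row_lim (nome_half_ne j))) => n.
have tn := t_neq0.
have eV (w w' : C) : w = 2 * t * w' -> w ^- 2 = (4 * t ^+ 2)^-1 * w' ^- 2.
  by move=> ->; rewrite exprMn invfM; congr (_^-1 * _); ring.
rewrite rowE mulr_sumr; apply: eq_bigr => u _; rewrite mulrDr; congr (_ + _); symmetry; apply: eV.
  by rewrite /lat odd_cast; field.
by rewrite /lat intrN odd_cast -[u.+1%:R]natr1; field.
Qed.

Lemma colrN j : colr (- j) = colr j.
Proof.
rewrite /colr; congr (_ * _); rewrite -rhoN -rho1; congr rho; rewrite intrN; field.
exact: t_neq0.
Qed.

Lemma colr_nat (j : nat) : colr j = (4 * t ^+ 2)^-1 * (tpi R ^+ 2 * lam (- q ^+ j)).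
Proof.
rewrite -colrN /colr rho_lam; congr (_ * (_ * lam _)).
rewrite nomeD nome_half mulN1r -nomeX intrN -pmulrn; congr (- nome _).
by rewrite mulNr mulrN.
Qed.

Definition colQ v : C := (4 * t ^+ 2)^-1 * (tpi R ^+ 2 *
  (lam (- q ^+ v.*2) - 2 * lam (- q ^+ v.*2.+1) + lam (- q ^+ v.*2.+2))).

Lemma col_lath v : ctends (fun n => \sum_(u < 2 ^ n) lath u v) (colQ v).
Proof.
have e1 := col_lat (2 * v%:Z); have e2 := col_lat (2 * v%:Z + 1).
have e3 := col_lat (2 * - v.+1%:Z); have e4 := col_lat (2 * - v.+1%:Z + 1).
have c1 : colr (2 * v%:Z) = colr v.*2 by congr colr; lia.
have c2 : colr (2 * v%:Z + 1) = colr v.*2.+1 by congr colr; lia.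
have c3 : colr (2 * - v.+1%:Z) = colr v.*2.+2 by rewrite -colrN; congr colr; lia.
have c4 : colr (2 * - v.+1%:Z + 1) = colr v.*2.+1 by rewrite -colrN; congr colr; lia.
rewrite c1 in e1; rewrite c2 in e2; rewrite c3 in e3; rewrite c4 in e4.
have := ctendsD (ctendsD e1 (ctendsZ (-1) e2)) (ctendsD e3 (ctendsZ (-1) e4)).
rewrite /colQ !colr_nat.
move: (lam _) (lam _) (lam _) => L3 L2 L1.
have -> : (4 * t ^+ 2)^-1 * (tpi R ^+ 2 * L1) + -1 * ((4 * t ^+ 2)^-1 * (tpi R ^+ 2 * L2)) +
  ((4 * t ^+ 2)^-1 * (tpi R ^+ 2 * L3) + -1 * ((4 * t ^+ 2)^-1 * (tpi R ^+ 2 * L2))) =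
  (4 * t ^+ 2)^-1 * (tpi R ^+ 2 * (L1 - 2 * L2 + L3)).
  by move: ((4 * t ^+ 2)^-1) (tpi R ^+ 2) => a b; ring.
apply: ctends_ext => n; rewrite !mulN1r -!sumrB -big_split; apply: eq_bigr => u _ /=.
rewrite /lath /latg.
by move: (_ ^- 2) (_ ^- 2) (_ ^- 2) (_ ^- 2) (_ ^- 2) (_ ^- 2) (_ ^- 2) (_ ^- 2) => *; ring.
Qed.

Lemma rowP_sum : ctends (fun N => \sum_(u < N) rowP u)
  (4^-1 * (tpi R ^+ 2 * (ev sig Q - 3 * ev sig (Q ^+ 2) + 2 * ev sig (Q ^+ 4)))).
Proof.
have Q1 := Q_lt1; have Q2 := cnX_lt1 (isT : (0 < 2)%N) Q1.
have := ctendsZ (4^-1) (ctendsZ (tpi R ^+ 2) (ctendsD (lambert_odd Q1) (ctendsZ (-2) (lambert_odd Q2)))).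
rewrite -[Q ^+ 2 ^+ 2]exprM.
have -> : forall s1 s2 s4 : C, s1 - s2 + -2 * (s2 - s4) = s1 - 3 * s2 + 2 * s4 by move=> *; ring.
apply: ctends_ext => n; rewrite !mulr_sumr -big_split /= !mulr_sumr; apply: eq_bigr => u _.
rewrite /rowP -exprM; move: (lam _) (lam _) => *; congr (_ * (_ * _)); ring.
Qed.

(** With [L j = lam (- q^j)], the columns add up to twice the even terms minus twice the odd ones,
    plus [L 0 - L (2J)]. The boundary value [L 0 = lam (-1) = -1/4] supplies the constant term of
    the four square formula, and [L (2J)] tends to 0. *)
Lemma colQ_sum : ctends (fun N => \sum_(v < N) colQ v)
  ((4 * t ^+ 2)^-1 * (tpi R ^+ 2 * (- (4^-1 * ev phi (- q) ^+ 4)))).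
Proof.
have q1 := q_lt1; have q2 := cnX_lt1 (isT : (0 < 2)%N) q1.
pose L j := lam (- q ^+ j).
have LE j : (0 < j)%N -> L j = - lam (q ^+ j) + 4 * lam (q ^+ (2 * j)).
  by move=> j0; rewrite /L lam_neg -?exprM mulnC // cn_neq1 // cnX_lt1 // muln_gt0.
have L0 : L 0%N = - 4^-1.
  by rewrite /L expr0 /lam opprK -(natrD _ 1 1) -natrX mulN1r.
have He : ctends (fun J => \sum_(v < J) L v.*2.+2) (- ev sig (q ^+ 2) + 4 * ev sig (q ^+ 4)).
  have := ctendsD (ctendsZ (-1) (@lambert_sub 2 q isT q1)) (ctendsZ 4 (@lambert_sub 4 q isT q1)).
  rewrite mulN1r; apply: ctends_ext => J; rewrite !mulr_sumr -big_split; apply: eq_bigr => v _ /=.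
  by rewrite LE // mulN1r -doubleS -mul2n mulnA.
have Ho : ctends (fun J => \sum_(v < J) L v.*2.+1)
    (- (ev sig q - ev sig (q ^+ 2)) + 4 * (ev sig (q ^+ 2) - ev sig (q ^+ 4))).
  have := ctendsD (ctendsZ (-1) (lambert_odd q1)) (ctendsZ 4 (lambert_odd q2)).
  rewrite mulN1r -exprM; apply: ctends_ext => J; rewrite !mulr_sumr -big_split; apply: eq_bigr => v _ /=.
  by rewrite LE // mulN1r -exprM.
have Hz : ctends (fun J => L J.*2) 0.
  apply: ctendsS.
  have := ctendsD (ctends_sub (s := S) leqnSn He) (ctendsZ (-1) He); rewrite mulN1r subrr.
  by apply: ctends_ext => J; rewrite big_ord_recr /= mulN1r addrAC subrr add0r.
have := ctendsZ ((4 * t ^+ 2)^-1) (ctendsZ (tpi R ^+ 2)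
  (ctendsD (ctendsD (ctendsZ 2 He) (ctendsZ (-2) Ho)) (ctendsD (ctends_cst (- 4^-1)) (ctendsZ (-1) Hz)))).
rewrite phi4_neg //.
have -> : forall s1 s2 s4 : C, 2 * (- s2 + 4 * s4) + -2 * (- (s1 - s2) + 4 * (s2 - s4)) +
   (- 4^-1 + -1 * 0) = - (4^-1 * (1 + 8 * (- s1 + 6 * s2 - 8 * s4))) by move=> *; field.
apply: ctends_ext => J; rewrite -!mulr_sumr; congr (_ * (_ * _)).
elim: J => [|J IH]; first by rewrite !big_ord0 double0 L0; ring.
rewrite !big_ord_recr /= -IH doubleS /L.
by move: (\sum_(i < J) _) (\sum_(i < J) _) (lam _) (lam _) (lam _) => *; ring.
Qed.

(** Rows give the difference of fourth powers at [Q], columns the fourth power at [- q]; the common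
    factor [tpi^2] cancels. *)
Lemma phi_slaw : ev phi (- q) ^+ 4 = - (t ^+ 2 / 4) * (ev phi Q ^+ 4 - ev phi (- Q) ^+ 4).
Proof.
have [K K0 HK] := lath_bound.
have := fubini_double K0 HK row_lath col_lath rowP_sum colQ_sum.
rewrite phi4_diff; last exact: Q_lt1.
have p0 : tpi R ^+ 2 != 0.
  rewrite expf_neq0 // -cn_gt0 /cn /= expr0n add0r sqrtr_sqr gtr0_norm.
    by rewrite mulr_gt0 // pi_gt0.
  by rewrite mulr_gt0 // pi_gt0.
move: (ev phi _) (ev sig Q - _ + _) (tpi R ^+ 2) p0 t_neq0 => f s p p0 tn E.
have : p * (f ^+ 4) = p * (- (t ^+ 2 / 4) * (16 * s)).
  have -> : p * f ^+ 4 = - (16 * t ^+ 2) * ((4 * t ^+ 2)^-1 * (p * - (4^-1 * f ^+ 4))) by field.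
  by rewrite -E; field.
exact: mulfI.
Qed.
End Slaw.
End Lattice.

(** * Holomorphy of power series in the nome *)

Section Holomorphy.
Variable R : realType.
Local Notation C := R[i].
Implicit Types z w q : C.

Definition ccont (f : C -> C) z := forall e : R, 0 < e ->
  exists2 d : R, 0 < d & forall w, cn (w - z) < d -> cn (f w - f z) < e.
(** A derivative with quadratic remainder: it composes by elementary estimates, and power series
    have it inside the disc. *)
Definition cder (f : C -> C) z (l : C) := exists K d : R, [/\ 0 <= K, 0 < d &
  forall w, cn (w - z) < d -> cn (f w - f z - l * (w - z)) <= K * cn (w - z) ^+ 2].

Lemma ccont_cst (c : C) z : ccont (fun=> c) z.
Proof. by move=> e e0; exists 1 => // w _; rewrite subrr cn0. Qed.
Lemma ccontM (f g : C -> C) z : ccont f z -> ccont g z -> ccont (fun w => f w * g w) z.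
Proof.
move=> cf cg e e0; pose T := 1 + cn (g z) + cn (f z).
have l0 := cn_ge0 (f z); have k0 := cn_ge0 (g z); have T0 : 0 < T by rewrite /T; lra.
pose d := Num.min 1 (e / T).
have d0 : 0 < d by rewrite lt_min ltr01 divr_gt0.
have d1 : d <= 1 by rewrite ge_min lexx.
have dT : d * T <= e by rewrite -ler_pdivlMr // ge_min lexx orbT.
have [a a0 Ha] := cf _ d0; have [b b0 Hb] := cg _ d0.
exists (Num.min a b); first by rewrite lt_min a0.
move=> w; rewrite lt_min => /andP[/Ha h /Hb h'].
have -> : f w * g w - f z * g z = (f w - f z) * (g w - g z) + ((f w - f z) * g z + f z * (g w - g z)) by ring.
apply: lt_le_trans dT; apply: le_lt_trans (cnD _ _) _.
have := cnD ((f w - f z) * g z) (f z * (g w - g z)); rewrite !cnM.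
have := cn_ge0 (f w - f z); have := cn_ge0 (g w - g z); rewrite /T.
move: (cn (f w - f z)) (cn (g w - g z)) h h' => x y xd yd y0 x0 E; nra.
Qed.
Lemma ccontV (f : C -> C) z : f z != 0 -> ccont f z -> ccont (fun w => (f w)^-1) z.
Proof.
move=> f0 cf e e0; have c0 : 0 < cn (f z) by rewrite cn_gt0.
pose d := Num.min (cn (f z) / 2) (e * cn (f z) ^+ 2 / 2).
have d0 : 0 < d by rewrite lt_min !divr_gt0 // mulr_gt0 // exprn_gt0.
have [a a0 Ha] := cf _ d0; exists a => // w /Ha; rewrite lt_min => /andP[h1 h2].
have w2 : cn (f z) / 2 < cn (f w).
  have := cn_ge_sub (f z) (f w - f z); rewrite (addrC (f z)) subrK; lra.
have w0 : f w != 0 by rewrite -cn_gt0; lra.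
have -> : (f w)^-1 - (f z)^-1 = - (f w - f z) / (f w * f z) by field; rewrite w0 f0.
rewrite cnM cnN cnV cnM ltr_pdivrMr; last by rewrite mulr_gt0 // cn_gt0.
apply: lt_trans h2 _; rewrite -mulrA ltr_pM2l //; nra.
Qed.
Lemma ccont_comp (f g : C -> C) z : ccont g z -> ccont f (g z) -> ccont (fun w => f (g w)) z.
Proof.
move=> cg cf e /cf[d d0 Hd]; have [a a0 Ha] := cg _ d0.
by exists a => // w /Ha /Hd.
Qed.

Lemma cder_lip (f : C -> C) z l : cder f z l -> exists K d : R, [/\ 0 <= K, 0 < d &
  forall w, cn (w - z) < d -> cn (f w - f z) <= K * cn (w - z)].
Proof.
move=> [K [d [K0 d0 H]]]; exists (K + cn l), (Num.min 1 d); split.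
- by rewrite addr_ge0 ?cn_ge0.
- by rewrite lt_min ltr01.
move=> w; rewrite lt_min => /andP[w1 /H h].
have -> : f w - f z = (f w - f z - l * (w - z)) + l * (w - z) by rewrite subrK.
apply: le_trans (cnD _ _) _; rewrite cnM mulrDl lerD2r; apply: le_trans h _.
rewrite ler_wpM2l // expr2 ler_piMr ?cn_ge0 // ltW //.
Qed.
Lemma cder_ccont (f : C -> C) z l : cder f z l -> ccont f z.
Proof.
move=> /cder_lip[K [d [K0 d0 H]]] e e0.
exists (Num.min d (e / (K + 1))); first by rewrite lt_min d0 divr_gt0 // ltr_wpDl.
move=> w; rewrite lt_min => /andP[/H h]; rewrite ltr_pdivlMr ?ltr_wpDl // => h2.
have := cn_ge0 (w - z); nra.
Qed.
Lemma cder_comp (f g : C -> C) z k l : cder g z k -> cder f (g z) l ->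
  cder (fun w => f (g w)) z (l * k).
Proof.
move=> cg [Kf [df [Kf0 df0 Hf]]]; have [L [e [L0 e0 HL]]] := cder_lip cg.
have [d d0 Hd] := cder_ccont cg df0; case: cg => Kg [dg [Kg0 dg0 Hg]].
exists (Kf * L ^+ 2 + cn l * Kg), (Num.min d (Num.min e dg)); split.
- by rewrite addr_ge0 // mulr_ge0 ?cn_ge0 // exprn_ge0.
- by rewrite !lt_min d0 e0 dg0.
move=> w; rewrite !lt_min => /and3P[/Hd h1 /HL h2 /Hg h3].
have -> : f (g w) - f (g z) - l * k * (w - z) =
  (f (g w) - f (g z) - l * (g w - g z)) + l * (g w - g z - k * (w - z)) by ring.
apply: le_trans (cnD _ _) _; rewrite mulrDl; apply: lerD.
  apply: le_trans (Hf _ h1) _; rewrite -mulrA ler_wpM2l // -exprMn lerXn2r ?nnegrE ?cn_ge0 //.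
  by rewrite mulr_ge0 // cn_ge0.
by rewrite cnM -mulrA ler_wpM2l ?cn_ge0.
Qed.

Lemma cder_nome z : cder (@nome R) z (tpi R * nome z).
Proof.
have [K K0 HK] := cexp_bound2 R; pose T := cn (tpi R) + 1.
have T0 : 0 < T by rewrite /T ltr_wpDl ?cn_ge0.
exists (cn (nome z) * K * cn (tpi R) ^+ 2), T^-1; split.
- by rewrite !mulr_ge0 ?cn_ge0 // exprn_ge0 ?cn_ge0.
- by rewrite invr_gt0.
move=> w; rewrite -[T^-1]mul1r ltr_pdivlMr // => wT.
have -> : nome w - nome z - tpi R * nome z * (w - z) =
    nome z * (cexp (tpi R * (w - z)) - 1 - tpi R * (w - z)).
  rewrite -nomeE; have {1}-> : w = z + (w - z) by rewrite addrC subrK.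
  by rewrite nomeD; ring.
rewrite (cnM (nome z)).
have -> : cn (nome z) * K * cn (tpi R) ^+ 2 * cn (w - z) ^+ 2 =
  cn (nome z) * (K * (cn (tpi R) * cn (w - z)) ^+ 2) by ring.
rewrite ler_wpM2l ?cn_ge0 // -cnM; apply: HK.
rewrite cnM; have := cn_ge0 (w - z); rewrite /T in wT; lra.
Qed.

Lemma pow_remainder (q p : C) (r : R) n : cn q <= r -> cn p <= r ->
  cn (p ^+ n.+2 - q ^+ n.+2 - n.+2%:R * q ^+ n.+1 * (p - q)) <= n.+2%:R ^+ 2 * r ^+ n * cn (p - q) ^+ 2.
Proof.
move=> qr pr; have r0 : 0 <= r := le_trans (cn_ge0 q) qr.
have h0 : 0 <= cn (p - q) ^+ 2 by rewrite exprn_ge0 ?cn_ge0.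
elim: n => [|n IH].
  have -> : p ^+ 2 - q ^+ 2 - 2%:R * q ^+ 1 * (p - q) = (p - q) ^+ 2 by ring.
  by rewrite cnX expr0 mulr1 -natrX ler_peMl // ler1n.
have -> : p ^+ n.+3 - q ^+ n.+3 - n.+3%:R * q ^+ n.+2 * (p - q) =
   p * (p ^+ n.+2 - q ^+ n.+2 - n.+2%:R * q ^+ n.+1 * (p - q)) + n.+2%:R * q ^+ n.+1 * (p - q) ^+ 2.
  rewrite -[n.+3%:R]natr1 !(exprS _ n.+2) !(exprS q n.+1).
  by move: (p ^+ n.+2) (q ^+ n.+1) (n.+2%:R) => a b c; ring.
apply: le_trans (cnD _ _) _; rewrite !cnM !cnX cn_nat.
have h1 : cn p * cn (p ^+ n.+2 - q ^+ n.+2 - n.+2%:R * q ^+ n.+1 * (p - q)) <=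
  r * (n.+2%:R ^+ 2 * r ^+ n * cn (p - q) ^+ 2) by apply: ler_pM; rewrite ?cn_ge0.
have h2 : n.+2%:R * cn q ^+ n.+1 * cn (p - q) ^+ 2 <= n.+2%:R * r ^+ n.+1 * cn (p - q) ^+ 2.
  by rewrite ler_wpM2r // ler_wpM2l // lerXn2r // nnegrE // cn_ge0.
apply: le_trans (lerD h1 h2) _.
rewrite -[n.+3%:R]natr1 (exprS r n); have := exprn_ge0 n r0.
have : 0 <= n.+2%:R :> R by [].
move: (n.+2%:R : R) (r ^+ n) (cn (p - q) ^+ 2) h0 => a b c c0 a0 b0.
have : 0 <= r * b * c by rewrite !mulr_ge0.
have -> : r * (a ^+ 2 * b * c) + a * (r * b) * c = (a ^+ 2 + a) * (r * b * c) by ring.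
have -> : (a + 1) ^+ 2 * (r * b) * c = (a + 1) ^+ 2 * (r * b * c) by ring.
move: (r * b * c) => D D0; rewrite ler_wpM2r //; nra.
Qed.

(** The radius [r] lies half way between [|q|] and 1. By [pow_remainder], the coefficient-wise
    remainders are dominated by the terms of the series [b] at [r], whose coefficients carry the
    factor [(n + 2)^2]. *)
Lemma cder_ev (a : fps int) q : pb a -> cn q < 1 ->
  cder (ev a) q (ev (Fps (fun n => co a n.+1 *+ n.+1)) q).
Proof.
move=> pa q1; set a' := Fps _; pose r := (1 + cn q) / 2.
have q0 := cn_ge0 q; have r01 : 0 <= r < 1 by rewrite /r; apply/andP; split; lra.
have r0 : 0 <= r by case/andP: r01.
have pa' : pb a'.
  case: pa => A [k HA]; exists (A * 2 ^ k)%N, k.+1 => n /=; rewrite -mulr_natr abszM natz absz_nat.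
  apply: leq_trans (leq_mul (HA n.+1) (leqnn _)) _; rewrite expnSr mulnA leq_mul2r; apply/orP; right.
  by rewrite -mulnA -expnMn leq_mul2l leq_wexp2r ?orbT //; lia.
pose b : fps int := Fps (fun n => co a n.+2 * (n.+2 ^ 2)%N%:R).
have pb' : pb b.
  case: pa => A [k HA]; exists (A * 3 ^ k * 9)%N, (k + 2)%N => n /=; rewrite abszM natz absz_nat.
  apply: leq_trans (leq_mul (HA n.+2) (leqnn _)) _; rewrite expnD.
  have h1 : (n.+3 ^ k <= 3 ^ k * n.+1 ^ k)%N by rewrite -expnMn leq_wexp2r //; lia.
  have h2 : (n.+2 ^ 2 <= 9 * n.+1 ^ 2)%N by nia.
  apply: leq_trans (leq_mul (leq_mul (leqnn A) h1) h2) _.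
  by move: (3 ^ k)%N (n.+1 ^ k)%N (n.+1 ^ 2)%N => x y z; nia.
have [M [rho [M0 rho01 HM]]] := pb_geo pb' r01.
exists (M / (1 - rho)), ((1 - cn q) / 2); split.
- by rewrite divr_ge0 // subr_ge0 ltW //; case/andP: rho01.
- lra.
move=> p pq; have pr : cn p <= r.
  have := cnD q (p - q); rewrite (addrC q) subrK /r; lra.
have qr : cn q <= r by rewrite /r; lra.
have p1 : cn p < 1 by case/andP: r01 => _; apply: le_lt_trans.
have L : ctends (fun N => ps a p N.+2 - ps a q N.+2 - ps a' q N.+1 * (p - q))
    (ev a p - ev a q - ev a' q * (p - q)).
  have sS : forall n, (n <= n.+1)%N by []. have sSS : forall n, (n <= n.+2)%N by move=> n; apply: leq_trans (leqnSn n) (leqnSn _).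
  have h1 := ctends_sub sSS (ev_tends pa p1); have h2 := ctends_sub sSS (ev_tends pa q1).
  have h3 := ctends_sub sS (ev_tends pa' q1).
  have := ctendsD (ctendsD h1 (ctendsZ (-1) h2)) (ctendsZ (- (p - q)) h3).
  have -> : ev a p + -1 * ev a q + - (p - q) * ev a' q = ev a p - ev a q - ev a' q * (p - q) by ring.
  by apply: ctends_ext => N; ring.
apply: ctends_cn L _ => N.
have -> : ps a p N.+2 - ps a q N.+2 - ps a' q N.+1 * (p - q) =
  \sum_(n < N) (co a n.+2)%:~R * (p ^+ n.+2 - q ^+ n.+2 - n.+2%:R * q ^+ n.+1 * (p - q)).
  elim: N => [|N IH].
    rewrite big_ord0 /ps !big_ord_recl !big_ord0 /tm /= /bump /= !expr0 !addr0 mulr1n; ring.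
  rewrite /ps in IH *; rewrite big_ord_recr [in RHS]big_ord_recr /= -IH.
  rewrite [X in _ - X - _]big_ord_recr [X in _ - X * _]big_ord_recr /= /tm /=.
  rewrite -[in X in _ - X]mulr_natr rmorphM /= natz -pmulrn.
  by move: (\sum_(i < _) _) (\sum_(i < _) _) (\sum_(i < _) _) => x y z; ring.
apply: le_trans (cn_sum _ _ _) _.
apply: (@le_trans _ _ ((M * \sum_(0 <= n < 0 + N) rho ^+ n) * cn (p - q) ^+ 2)); last first.
  rewrite ler_wpM2r ?exprn_ge0 ?cn_ge0 // ler_wpM2l //.
  by apply: le_trans (geo_sum_le 0 N rho01) _; rewrite expr0 mul1r.
rewrite add0n big_mkord mulr_sumr mulr_suml; apply: ler_sum => n _; rewrite cnM.
apply: le_trans (ler_wpM2l (cn_ge0 _) (pow_remainder n qr pr)) _.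
rewrite mulrA ler_wpM2r ?exprn_ge0 ?cn_ge0 //.
have := HM n (r%:C); rewrite cn_real ger0_norm // lexx => /(_ isT); apply: le_trans.
rewrite /tm cnM cnX cn_real (ger0_norm r0) /= rmorphM /= cnM natz -pmulrn cn_nat natrX.
by rewrite !mulrA.
Qed.

Lemma pos_real (e : C) : 0 < e -> e = (complex.Re e)%:C /\ 0 < complex.Re e.
Proof. by case: e => x y; rewrite ltcE /= => /andP[/eqP -> ->]. Qed.

Lemma cder_derivable (f : C -> C) z l : cder f z l -> derivable (f : C^o -> C^o) z 1.
Proof.
move=> [K [d [K0 d0 H]]]; rewrite /derivable; apply/cvg_ex; exists (l : C^o).
apply/cvgrPdist_lt => e e0.
have [eE r0] := pos_real e0.
pose b := Num.min d (complex.Re e / (K + 1)).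
have b0 : 0 < b by rewrite lt_min d0 divr_gt0 // ltr_wpDl.
near=> h.
have h0 : h != 0 by near: h; exact: nbhs_dnbhs_neq.
have hb : cn h < b.
  suff : `|h| < b%:C by rewrite normE ltcR.
  by near: h; apply: dnbhs0_lt; rewrite ltcR.
have -> : l - h^-1 *: (f (h *: 1 + z) - f z) = - ((f (h + z) - f z - l * h) / h).
  by rewrite /GRing.scale /= mulr1; field.
rewrite eE normE ltcR cnN cnM cnV.
move: hb; rewrite lt_min => /andP[hd]; rewrite ltr_pdivlMr ?ltr_wpDl // => he.
have := H (h + z); rewrite addrK => /(_ hd) h2.
have c0 : 0 < cn h by rewrite cn_gt0.
rewrite ltr_pdivrMr //; apply: le_lt_trans h2 _; rewrite expr2; nra.
Unshelve. all: by end_near.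
Qed.

Lemma holomorphic_ev (a : fps int) : pb a ->
  holomorphic_on (@upper_half_plane R) (fun z => ev a (nome z)).
Proof.
move=> pa z z0; apply: cder_derivable; apply: cder_comp (cder_nome z) _.
by apply: cder_ev => //; apply: nome_lt1.
Qed.

Lemma qexpansion_ev (a : fps int) : pb a ->
  has_int_qexpansion (fun z : C => ev a (nome z)) (co a).
Proof.
move=> pa z z0; have T := ev_tends pa (nome_lt1 z0).
apply/cvgrPdist_lt => e e0.
have [eE r0] := pos_real e0.
have [N HN] := T _ r0; exists N => // n /= /HN h.
rewrite eE normE ltcR cn_distC; apply: le_lt_trans h; rewrite le_eqVlt; apply/orP; left; apply/eqP.
by rewrite /series /= big_mkord.
Qed.

(** On the segment from [z] to [w], inside the half-plane, the real part of [h] is continuous with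
    values 1 and -1; a change of sign would force a zero. *)
Lemma sign_const (h : C -> C) : (forall z, 0 < complex.Im z -> ccont h z) ->
  (forall z, 0 < complex.Im z -> h z ^+ 2 = 1) ->
  forall z w, 0 < complex.Im z -> 0 < complex.Im w -> h z = h w.
Proof.
move=> hc h1 z w z0 w0.
have h2 x : 0 < complex.Im x -> h x = 1 \/ h x = -1.
  by move=> /h1/eqP; rewrite sqrf_eq1 => /orP[]/eqP; [left|right].
pose g (s : R) : C := z + s%:C * (w - z).
have gI s : complex.Im (g s) = complex.Im z + s * (complex.Im w - complex.Im z).
  by rewrite /g; case: (z) => a b; case: (w) => c d /=; ring.
have g0 s : 0 <= s <= 1 -> 0 < complex.Im (g s).
  move=> /andP[s0 s1]; rewrite gI.
  move: (complex.Im z) (complex.Im w) z0 w0 => a b a0 b0.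
  have -> : a + s * (b - a) = (1 - s) * a + s * b by ring.
  case: (ltP s (1 / 2)) => hs; nra.
pose f (s : R) : R := complex.Re (h (g s)).
have cf : {within `[0, 1], continuous f}.
  apply: continuous_in_subspaceT => s; rewrite inE /= in_itv /= => s01.
  apply/cvgrPdist_lt => e e0.
  have [d d0 Hd] := hc _ (g0 _ s01) _ e0.
  have T0 : 0 < cn (w - z) + 1 by rewrite ltr_wpDl ?cn_ge0.
  near=> x.
  have xd : `|s - x| < d / (cn (w - z) + 1).
    by near: x; apply: cvgr_dist_lt; rewrite ?divr_gt0 //; exact: cvg_id.
  have E : g x - g s = (x - s)%:C * (w - z) by rewrite /g rmorphB /=; ring.
  have := Hd (g x); rewrite E cnM cn_real distrC => H.
  have {}H : cn (h (g x) - h (g s)) < e.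
    apply: H; rewrite ltr_pdivlMr // in xd; have := normr_ge0 (s - x); have := cn_ge0 (w - z); nra.
  rewrite distrC; apply: le_lt_trans H; apply: le_trans (Re_le_cn _).
  by rewrite /f; case: (h (g x)) => a b; case: (h (g s)).
have gz : g 0 = z by rewrite /g mul0r addr0.
have gw : g 1 = w by rewrite /g mul1r addrC subrK.
have [z1|z1] := h2 z z0; have [w1|w1] := h2 w w0; rewrite z1 w1 //; exfalso.
  have [||s s01 fs] := @IVT R f 0 1 0 _ cf; rewrite ?ler01 //.
    by rewrite /f gz gw z1 w1 /= ge_min le_max; apply/andP; split; apply/orP; [right|left]; lra.
  rewrite in_itv /= in s01; move: fs; rewrite /f; case: (h2 _ (g0 _ s01)) => -> /=; lra.
have [||s s01 fs] := @IVT R f 0 1 0 _ cf; rewrite ?ler01 //.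
  by rewrite /f gz gw z1 w1 /= ge_min le_max; apply/andP; split; apply/orP; [left|right]; lra.
rewrite in_itv /= in s01; move: fs; rewrite /f; case: (h2 _ (g0 _ s01)) => -> /=; lra.
Unshelve. all: by end_near.
Qed.
End Holomorphy.

(** * Theta functions on the upper half-plane *)

Lemma pb_tha : pb tha. Proof. by rewrite tha.unlock; apply/pb_sub/pb_phi. Qed.
Lemma pb_om : pb om.
Proof. by apply: pbM; [apply: pb_X|apply/pb_sub/pb_psi]. Qed.
Lemma pb_thb : pb thb.
Proof. by rewrite thb.unlock; apply: pbM; [apply: (pb_nat 2)|apply: pb_om]. Qed.

Lemma ftw_phi_sq : ftw phi * phi = sub 2 (ftw phi) ^+ 2.
Proof.
rewrite phiB phiD subD subN.
have -> : (tha - thb) * (tha + thb) = tha ^+ 2 - thb ^+ 2 by ring.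
by rewrite tha_sq thb_sq; ring.
Qed.

(* TA t = theta_3 and TB t = theta_2 for q = e(t); TU is their ratio
   and, below, TG t = eta(4 t) / eta(t). *)
HB.lock Definition TA (R : realType) (t : R[i]) : R[i] := ev phi (nome t).
HB.lock Definition TB (R : realType) (t : R[i]) : R[i] := ev thb (nome (t / 4)).

Section Theta.
Variable R : realType.
Local Notation C := R[i].
Implicit Types z w q t s : C.
Local Notation "'I' z" := (complex.Im z) (at level 10).

(** A zero at [q] propagates to all [q^(2^n)]. These tend to 0, where the value of [f] is close to
    its constant term 1. *)
Lemma ev_neq0 (f : fps int) q : pb f -> co f 0 = 1 -> cn q < 1 ->
  (forall x : C, cn x < 1 -> ev f x = 0 -> ev f (x ^+ 2) = 0) -> ev f q != 0.
Proof.
move=> pf f0 q1 H; apply/negP => /eqP E.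
have q01 : 0 <= cn q < 1 by rewrite cn_ge0.
have [M M0 HM] := ev_small pf q01.
have Z n : ev f (q ^+ (2 ^ n)) = 0.
  elim: n => [|n IH]; first by rewrite expn0 expr1.
  by rewrite expnSr exprM; apply: H => //; apply: cnX_lt1; rewrite ?expn_gt0.
have T : ctends (fun n => q ^+ n) 0.
  apply: (ctends_squeeze (b := fun n => 1 * cn q ^+ n)); last exact: geo_cvg0.
  by move=> n; rewrite subr0 cnX mul1r.
have e0 : 0 < (M + 1)^-1 by rewrite invr_gt0; lra.
have [N HN] := T _ e0.
have := HN (2 ^ N)%N (ltnW (ltn_expl N (isT : (1 < 2)%N))); rewrite subr0 => h.
have qq : cn (q ^+ (2 ^ N)) <= cn q.
  by rewrite cnX ler_iXnr ?cn_ge0 ?ltW // expn_gt0.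
have := HM _ qq; rewrite Z f0 sub0r cnN cn1 => h2.
have := cn_ge0 (q ^+ (2 ^ N)); move: (cn (q ^+ (2 ^ N))) h h2 => c h h2 c0.
have : c * (M + 1) < 1 by rewrite -lter_pdivlMr //; [rewrite mul1r|lra].
lra.
Qed.

Lemma phiN_neq0 q : cn q < 1 -> ev phi (- q) != 0.
Proof.
move=> q1; rewrite -ev_ftw //; last exact: pb_phi.
have pf : pb (ftw phi) := pb_ftw pb_phi.
apply: ev_neq0 => //; first by rewrite co_ftw expr0 mul1r co_phi0.
move=> x x1 E; have := congr1 (fun f => ev f x) ftw_phi_sq.
rewrite evM ?E ?mul0r //; last exact: pb_phi.
rewrite evX ?ev_sub //; last exact: pb_sub.
by move/esym/eqP; rewrite expf_eq0 => /eqP.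
Qed.
Lemma phi_neq0 q : cn q < 1 -> ev phi q != 0.
Proof. by move=> q1; rewrite -(opprK q) phiN_neq0 // cnN. Qed.
Lemma psi_neq0 q : cn q < 1 -> ev psi q != 0.
Proof.
move=> q1; apply: ev_neq0 => //; [exact: pb_psi|exact: co_psi0|].
move=> x x1 E; have := congr1 (fun f => ev f x) psi_sq.
rewrite evX ?E ?expr0n //; last exact: pb_psi.
rewrite evM ?ev_sub //; [|exact: pb_psi|exact: pb_phi|exact/pb_sub/pb_psi].
by move/esym/eqP; rewrite mulf_eq0 (negPf (phi_neq0 x1)) => /eqP.
Qed.

Lemma Im_divn4 t : 0 < I t -> 0 < I (t / 4).
Proof. by move=> t0; rewrite (Im_divn t 4) divr_gt0. Qed.
Lemma Im_mul2 t : 0 < I t -> 0 < I (2 * t).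
Proof. by move=> t0; rewrite (Im_int_mul 2) mulr_gt0. Qed.
Lemma Im_S t : 0 < I t -> 0 < I (- t^-1).
Proof. by move=> t0; rewrite Im_Vneg divr_gt0 // exprn_gt0 // cn_gt0 t_neq0. Qed.

Lemma TA_tha t : 0 < I t -> TA t = ev tha (nome (t / 4)).
Proof.
move=> t0; rewrite TA.unlock tha.unlock ev_sub //; [|exact: pb_phi|exact/nome_lt1/Im_divn4].
by rewrite -nomeX; congr (ev _ (nome _)); field.
Qed.
Lemma TADB t : 0 < I t -> TA t + TB t = ev phi (nome (t / 4)).
Proof.
move=> t0; rewrite TA_tha // TB.unlock phiD evD //; [exact: pb_tha|exact: pb_thb|exact/nome_lt1/Im_divn4].
Qed.
Lemma TABB t : 0 < I t -> TA t - TB t = ev phi (- nome (t / 4)).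
Proof.
move=> t0; have q1 := nome_lt1 (Im_divn4 t0).
rewrite TA_tha // TB.unlock -ev_ftw //; last exact: pb_phi.
rewrite phiB evD ?evN //; [exact: pb_thb|exact: pb_tha|exact/pbN/pb_thb].
Qed.
Lemma TA_neq0 t : 0 < I t -> TA t != 0.
Proof. by move=> t0; rewrite TA.unlock phi_neq0 // nome_lt1. Qed.
Lemma TB_neq0 t : 0 < I t -> TB t != 0.
Proof.
move=> t0; have q1 := nome_lt1 (Im_divn4 t0).
rewrite TB.unlock thb.unlock evM //; [|exact: (pb_nat 2)|exact: pb_om].
rewrite (ev_nat 2) // /om evM ?ev_X ?ev_sub //; try exact: pb_X; try exact: pb_psi; last exact/pb_sub/pb_psi.
apply: mulf_neq0; first by rewrite pnatr_eq0.
by apply: mulf_neq0; [apply: nome_neq0|apply/psi_neq0/cnX_lt1].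
Qed.
Lemma TADB_neq0 t : 0 < I t -> TA t + TB t != 0.
Proof. by move=> t0; rewrite TADB // phi_neq0 // nome_lt1 // Im_divn4. Qed.
Lemma TABB_neq0 t : 0 < I t -> TA t - TB t != 0.
Proof. by move=> t0; rewrite TABB // phiN_neq0 // nome_lt1 // Im_divn4. Qed.

Lemma nome_half_arg t : nome (2 * t / 4) = nome (t / 4) ^+ 2.
Proof. by rewrite -nomeX; congr nome; rewrite mulrA. Qed.

Lemma TA_dbl t : 0 < I t -> TA t ^+ 2 = TA (2 * t) ^+ 2 + TB (2 * t) ^+ 2.
Proof.
move=> t0; have q1 := nome_lt1 (Im_divn4 t0).
have pa := pb_tha; have pb' := pb_thb.
have := congr1 (fun f => ev f (nome (t / 4))) tha_sq.
rewrite evX // evD //; [|exact/pbX/pb_sub|exact/pbX/pb_sub].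
rewrite evX ?evX ?ev_sub //; [|exact/pb_sub|exact/pb_sub].
by rewrite -nome_half_arg -!TA_tha ?Im_mul2 // TB.unlock.
Qed.
Lemma TB_dbl t : 0 < I t -> TB t ^+ 2 = 2 * TA (2 * t) * TB (2 * t).
Proof.
move=> t0; have q1 := nome_lt1 (Im_divn4 t0).
have pa := pb_tha; have pb' := pb_thb.
have := congr1 (fun f => ev f (nome (t / 4))) thb_sq.
rewrite evX // evM //; [|by apply: pbM; [exact: (pb_nat 2)|exact/pb_sub]|exact/pb_sub].
rewrite evM ?(ev_nat 2) ?ev_sub //; [|exact: (pb_nat 2)|exact/pb_sub].
by rewrite -nome_half_arg -!TA_tha ?Im_mul2 // TB.unlock.
Qed.

Lemma TAB4 t : 0 < I t -> TA t ^+ 4 - TB t ^+ 4 = (TA (2 * t) ^+ 2 - TB (2 * t) ^+ 2) ^+ 2.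
Proof.
move=> t0; have -> : TA t ^+ 4 - TB t ^+ 4 = (TA t ^+ 2) ^+ 2 - (TB t ^+ 2) ^+ 2 by ring.
by rewrite (TA_dbl t0) (TB_dbl t0); ring.
Qed.

(** This is [phi_slaw] in terms of theta_3 and theta_2: on the left
    [theta_4^4 = theta_3^4 - theta_2^4], on the right [phi(Q)] and [phi(-Q)] are [TA + TB] and
    [TA - TB]. *)
Lemma slaw4 t : 0 < I t -> TA (- t^-1) ^+ 4 - TB (- t^-1) ^+ 4 =
  - (2 * t ^+ 2) * (TA t * TB t * (TA t ^+ 2 + TB t ^+ 2)).
Proof.
move=> t0; set s := - t^-1; have s0 : 0 < I s := Im_S t0.
have -> : TA s ^+ 4 - TB s ^+ 4 = ev phi (- nome s) ^+ 4.
  rewrite TAB4 //; have s2 := Im_mul2 s0.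
  have -> : TA (2 * s) ^+ 2 - TB (2 * s) ^+ 2 = (TA (2 * (2 * s)) - TB (2 * (2 * s))) ^+ 2.
    by rewrite (TA_dbl s2) (TB_dbl s2); ring.
  rewrite TABB ?Im_mul2 // -exprM; congr (ev _ (- nome _) ^+ _); by field.
by rewrite (phi_slaw t0) -TADB // -TABB //; field.
Qed.

Definition TU t : C := TB t / TA t.


Lemma TAB_dbl t : 0 < I t -> TA t ^+ 2 + TB t ^+ 2 = (TA (2 * t) + TB (2 * t)) ^+ 2.
Proof. by move=> t0; rewrite (TA_dbl t0) (TB_dbl t0); ring. Qed.
Lemma TAB_dblN t : 0 < I t -> TA t ^+ 2 - TB t ^+ 2 = (TA (2 * t) - TB (2 * t)) ^+ 2.
Proof. by move=> t0; rewrite (TA_dbl t0) (TB_dbl t0); ring. Qed.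

(** [slaw4] is also used at [2t], whose image [-1/(2t)] is half of [-1/t]; the duplication formulas
    bring this second relation back to [t]. Dividing the two determines the ratio [TB / TA] at
    [-1/t] up to sign. *)
Lemma S_sq t : 0 < I t ->
  (TA (- t^-1) ^+ 2 - TB (- t^-1) ^+ 2) ^+ 2 = - (4 * t ^+ 2) * (TA t * TB t) ^+ 2 /\
  (TA (- t^-1) * (TA t - TB t)) ^+ 2 = (TB (- t^-1) * (TA t + TB t)) ^+ 2.
Proof.
move=> t0; set s := - t^-1; have s0 : 0 < I s := Im_S t0.
pose r := - (2 * t)^-1; have t2 := Im_mul2 t0; have r0 : 0 < I r := Im_S t2.
have tn := t_neq0 t0.
have rs : 2 * r = s by rewrite /r /s; field.
have E1 : TA s ^+ 4 - TB s ^+ 4 = - (2 * t ^+ 2) * (TA t * TB t * (TA t ^+ 2 + TB t ^+ 2)) := slaw4 t0.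
have E2 : (TA s ^+ 2 - TB s ^+ 2) ^+ 2 = - (4 * t ^+ 2) * (TA t * TB t) ^+ 2.
  have := slaw4 t2; rewrite -/r (TAB4 r0) rs => ->.
  have -> : (TA t * TB t) ^+ 2 = TA t ^+ 2 * TB t ^+ 2 by ring.
  by rewrite (TA_dbl t0) (TB_dbl t0); ring.
split=> //.
have D0 : TA s ^+ 2 - TB s ^+ 2 != 0.
  by rewrite subr_sqr mulf_neq0 ?TABB_neq0 ?TADB_neq0.
move: (TA s) (TB s) (TA t) (TB t) E1 E2 D0 => X Y x y E1 E2 D0.
have F : (X ^+ 2 + Y ^+ 2) * (2 * (x * y)) = (X ^+ 2 - Y ^+ 2) * (x ^+ 2 + y ^+ 2).
  apply: (mulfI D0); rewrite [LHS]mulrA.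
  have -> : (X ^+ 2 - Y ^+ 2) * (X ^+ 2 + Y ^+ 2) = X ^+ 4 - Y ^+ 4 by ring.
  by rewrite E1 [RHS]mulrA -expr2 E2; ring.
have : (X * (x - y)) ^+ 2 - (Y * (x + y)) ^+ 2 = (X ^+ 2 - Y ^+ 2) * (x ^+ 2 + y ^+ 2) -
   (X ^+ 2 + Y ^+ 2) * (2 * (x * y)) by ring.
by rewrite F subrr => /subr0_eq.
Qed.

(* S_sq leaves a sign, which the duplication formula from 2t to t fixes. *)
Lemma S_lin t : 0 < I t -> TA (- t^-1) * (TA t - TB t) = TB (- t^-1) * (TA t + TB t).
Proof.
move=> t0; set s := - t^-1; have s0 : 0 < I s := Im_S t0.
pose r := - (2 * t)^-1; have t2 := Im_mul2 t0; have r0 : 0 < I r := Im_S t2.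
have tn := t_neq0 t0.
have rs : 2 * r = s by rewrite /r /s; field.
have [_ E] := S_sq t0; have [_] := S_sq t2; rewrite -/s in E *; rewrite -/r.
rewrite !exprMn -(TAB_dbl t0) -(TAB_dblN t0) (TA_dbl r0) (TB_dbl r0) rs => F.
have P0 : TA s * (TA t - TB t) != 0 by rewrite mulf_neq0 ?TA_neq0 ?TABB_neq0.
have Q0 : TA t ^+ 2 + TB t ^+ 2 != 0 by rewrite (TAB_dbl t0) expf_neq0 ?TADB_neq0.
have R0 : 2 * (TA s * (TA t - TB t)) * (TA t ^+ 2 + TB t ^+ 2) != 0.
  by rewrite !mulf_neq0 ?pnatr_eq0 // -?mulf_eq0 ?(negPf P0); rewrite ?TA_neq0 ?TABB_neq0.
move: (TA s) (TB s) (TA t) (TB t) E F R0 => X Y x y E F R0.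
apply: (mulfI R0).
(* [2 (x^2 + y^2) = (x + y)^2 + (x - y)^2]. Using [E] on one of the two terms produces the factor
   [X^2 + Y^2], which [F], the relation at [2t], turns into [2 X Y]. *)
have -> : 2 * (X * (x - y)) * (x ^+ 2 + y ^+ 2) * (X * (x - y)) =
  (X * (x - y)) ^+ 2 * (x + y) ^+ 2 + (X * (x - y)) ^+ 2 * (x - y) ^+ 2 by ring.
rewrite {2}E.
have -> : (X * (x - y)) ^+ 2 * (x + y) ^+ 2 + (Y * (x + y)) ^+ 2 * (x - y) ^+ 2 =
  (X ^+ 2 + Y ^+ 2) * (x ^+ 2 - y ^+ 2) * ((x - y) * (x + y)) by ring.
by rewrite F; ring.
Qed.

(** By [S_lin], [4 x y X^2 = (X^2 - Y^2) (x + y)^2], and [S_sq] gives the square of [X^2 - Y^2]. *)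
Lemma A4_S t : 0 < I t -> TA (- t^-1) ^+ 4 = - (t ^+ 2 / 4) * (TA t + TB t) ^+ 4.
Proof.
move=> t0; set s := - t^-1; have s0 : 0 < I s := Im_S t0.
have [E _] := S_sq t0; have L := S_lin t0; rewrite -/s in E L.
have N0 : 4 * (TA t * TB t) != 0 by rewrite !mulf_neq0 ?pnatr_eq0 ?TA_neq0 ?TB_neq0.
have H0 := TADB_neq0 t0.
move: (TA s) (TB s) (TA t) (TB t) E L N0 H0 => X Y x y E L N0 H0.
have -> : X ^+ 4 = (X ^+ 2 * (4 * (x * y))) ^+ 2 / (4 * (x * y)) ^+ 2.
  by rewrite exprMn mulfK ?expf_neq0 // -exprM.
have -> : X ^+ 2 * (4 * (x * y)) = (X ^+ 2 - Y ^+ 2) * (x + y) ^+ 2.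
  rewrite mulrBl -(exprMn _ Y) -L; ring.
rewrite exprMn E; have [x0 y0] : x != 0 /\ y != 0.
  by move: N0; rewrite !mulf_eq0 !negb_or => /and3P[].
by field; rewrite x0 y0.
Qed.
Lemma TU_S t : 0 < I t -> TU (- t^-1) = (1 - TU t) / (1 + TU t).
Proof.
move=> t0; have L := S_lin t0; have H0 := TADB_neq0 t0; have A0 := TA_neq0 t0.
have X0 := TA_neq0 (Im_S t0); rewrite /TU.
move: (TA (- t^-1)) (TB (- t^-1)) (TA t) (TB t) L H0 A0 X0 => X Y x y L H0 A0 X0.
have -> : (1 - y / x) / (1 + y / x) = (X * (x - y)) / (X * (x + y)) by field; rewrite A0 H0 X0.
by rewrite L; field; rewrite H0 X0.
Qed.

Lemma nome_periodic t n : nome (t + n%:R) = nome t.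
Proof. by rewrite nomeD nome_nat mulr1. Qed.
Lemma Im_addr t (x : R) : I (t + x%:C) = I t.
Proof. by case: t => a b /=; rewrite addr0. Qed.
Lemma Im_addn t n : I (t + n%:R) = I t.
Proof. by rewrite -(rmorph_nat (real_complex R)) Im_addr. Qed.

Lemma TA_T t : TA (t + 1) = TA t.
Proof. by rewrite TA.unlock (nome_periodic t 1). Qed.
Lemma TB_T t : 0 < I t -> TB (t + 1) = 'i * TB t.
Proof.
move=> t0; have q1 := nome_lt1 (Im_divn4 t0).
have q1' : cn (nome ((t + 1) / 4)) < 1 by apply/nome_lt1/Im_divn4; rewrite (Im_addn t 1).
have px := pb_X; have pp := pb_psi; have po := pb_om; have pp8 := pb_sub 8 pp.
have E : nome ((t + 1) / 4) = 'i * nome (t / 4) by rewrite mulrDl nomeD mul1r nome_quarter mulrC.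
rewrite TB.unlock thb.unlock !evM ?(ev_nat 2) // ?ev_X ?ev_sub //; try exact: (pb_nat 2).
by rewrite E exprMn (_ : 'i ^+ 8 = 1) ?mul1r; [ring|rewrite (exprM _ 2 4) sqr_i; ring].
Qed.
Lemma TU_T t : 0 < I t -> TU (t + 1) = 'i * TU t.
Proof. by move=> t0; rewrite /TU TA_T TB_T // mulrA. Qed.

(** ** The weight zero factor *)

Definition TG t : C := nome (t / 8) * ev psi (- nome t) / ev phi (- nome t).

Definition z8 : C := nome (8^-1).

Lemma TG_T t : TG (t + 1) = z8 * TG t.
Proof. by rewrite /TG (nome_periodic t 1) mulrDl nomeD mul1r -/z8; ring. Qed.
Lemma TG_neq0 t : 0 < I t -> TG t != 0.
Proof.
move=> t0; apply: mulf_neq0; last by rewrite invr_eq0 phiN_neq0 // nome_lt1.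
by apply: mulf_neq0; [apply: nome_neq0|rewrite psi_neq0 // cnN nome_lt1].
Qed.

(** The square of [TG] is a translate of the ratio [TU], so the transformation laws of [TU] give
    those of [TG] up to sign. *)
Lemma TG_sq t : 0 < I t -> TG t ^+ 2 = z8 / 2 * TU (t - 2^-1).
Proof.
move=> t0; have q1 := nome_lt1 t0; have qN1 : cn (- nome t) < 1 by rewrite cnN.
have hI : I (t - 2^-1) = I t.
  have -> : (- 2^-1 : C) = (- 2^-1 : R)%:C by rewrite rmorphN fmorphV rmorph_nat.
  exact: Im_addr.
have h1 := nome_lt1 (Im_divn4 (_ : 0 < I (t - 2^-1))); rewrite hI in h1; have {}h1 := h1 t0.
have px := pb_X; have pp := pb_psi; have po := pb_om; have pp8 := pb_sub 8 pp.
have f0 := phiN_neq0 q1.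
have E : nome (t - 2^-1) = - nome t by rewrite nomeD nomeN nome_half invrN1 mulrN1.
rewrite /TU TA.unlock TB.unlock thb.unlock !evM ?(ev_nat 2) // ?ev_X ?ev_sub //; try exact: (pb_nat 2).
have -> : nome ((t - 2^-1) / 4) ^+ 8 = nome t ^+ 2.
  rewrite -!nomeX; have -> : 8%:R * ((t - 2^-1) / 4) = 2%:R * t - 1 by field.
  by rewrite nomeD nomeN nome1 invr1 mulr1.
have -> : nome ((t - 2^-1) / 4) = nome (t / 8) ^+ 2 / z8.
  by rewrite -nomeX -nomeN -nomeD; congr nome; field.
rewrite E /TG expr_div_n exprMn.
have -> : ev psi (- nome t) ^+ 2 = ev phi (- nome t) * ev psi (nome t ^+ 2).
  by rewrite -evX // psi_sq evM ?ev_sub ?sqrrN //; [exact: pb_phi|exact: pb_sub].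
have z0 : z8 != 0 := nome_neq0 _.
by move: (ev phi _) f0 (ev psi _) (nome (t / 8)) z8 z0 => f f0 p n z z0; field; rewrite f0 z0.
Qed.
End Theta.

(** * Modular transformations *)

Section Modular.
Variable R : realType.
Local Notation C := R[i].
Implicit Types z w q t s : C.
Local Notation "'I' z" := (complex.Im z) (at level 10).

Lemma ccont_id z : ccont (fun w : C => w) z.
Proof. by move=> e e0; exists e. Qed.

Lemma ccont_TG t : 0 < I t -> ccont (@TG R) t.
Proof.
move=> t0; have q1 : cn (- nome t) < 1 by rewrite cnN nome_lt1.
have cN : ccont (fun w : C => - nome w) t.
  have := ccontM (ccont_cst (-1) t) (cder_ccont (cder_nome t)).
  by have -> : (fun w : C => -1 * nome w) = (fun w => - nome w) by apply/funext => w; rewrite mulN1r.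
have c8 : ccont (fun w : C => nome (w / 8)) t.
  apply: (ccont_comp (g := fun w => w / 8)); first exact: ccontM (ccont_id t) (ccont_cst _ t).
  exact: cder_ccont (cder_nome _).
apply: ccontM; first apply: ccontM => //.
  by apply: ccont_comp cN (cder_ccont (cder_ev pb_psi q1)).
apply: ccontV; first by rewrite phiN_neq0 // nome_lt1.
by apply: ccont_comp cN (cder_ccont (cder_ev pb_phi q1)).
Qed.

Lemma Im_W t : 0 < I t -> 0 < I (- (4 * t)^-1).
Proof. by move=> t0; apply: Im_S; rewrite (Im_int_mul 4) mulr_gt0. Qed.

Lemma z8_sq : z8 R ^+ 2 = 'i.
Proof. by rewrite /z8 -nomeX -nome_quarter; congr nome; field. Qed.
Lemma z8_8 : z8 R ^+ 8 = 1.
Proof. by rewrite /z8 -nomeX mulfV ?pnatr_eq0 // nome1. Qed.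
Lemma z8_neq0 : z8 R != 0. Proof. exact: nome_neq0. Qed.

Lemma TU_neq0 t : 0 < I t -> TU t != 0.
Proof. by move=> t0; rewrite mulf_neq0 ?invr_eq0 ?TA_neq0 ?TB_neq0. Qed.
Lemma TUD_neq0 t : 0 < I t -> 1 + TU t != 0.
Proof.
move=> t0; have A0 := TA_neq0 t0; have := TADB_neq0 t0; apply: contra => /eqP E.
have -> : TA t + TB t = TA t * (1 + TU t) by rewrite /TU; field.
by rewrite E mulr0.
Qed.

Lemma i_neq0 : 'i != 0 :> C.
Proof. by rewrite eq_complex /= oner_eq0 andbF. Qed.

(* u(M s) = 1 / (i u(s)) for M = S T^2 S T *)
Lemma TU_M s : 0 < I s -> TU s * TU (- ((s + 1) / (2 * s + 1))) = - 'i.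
Proof.
move=> s0; have s1 : 0 < I (s + 1) by rewrite (Im_addn s 1).
have s2 : 0 < I (- (s + 1)^-1) := Im_S s1.
have s3 : 0 < I (- (s + 1)^-1 + 1) by rewrite (Im_addn _ 1).
have s4 : 0 < I (- (s + 1)^-1 + 1 + 1) by rewrite (Im_addn _ 1).
have n1 := t_neq0 s1; have n4 := t_neq0 s4.
have n5 : 2 * s + 1 != 0.
  have -> : 2 * s + 1 = (s + 1) * (- (s + 1)^-1 + 1 + 1) by field.
  by rewrite mulf_neq0.
have -> : - ((s + 1) / (2 * s + 1)) = - (- (s + 1)^-1 + 1 + 1)^-1.
  by congr (- _); have -> : - (s + 1)^-1 + 1 + 1 = (2 * s + 1) / (s + 1); [field|rewrite invf_div].
have H := TUD_neq0 s4; have H2 := TUD_neq0 s1.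
rewrite (TU_S s4); rewrite TU_T // TU_T // in H *; rewrite (TU_S s1) in H *.
have u0 := TU_neq0 s0.
rewrite TU_T // in H H2 *; move: (TU s) u0 H H2 => u u0 H H2.
have i2 : 'i * 'i = -1 :> C by rewrite -expr2 sqr_i.
have i0 := i_neq0.
rewrite !(mulrA 'i 'i) i2 !mulN1r opprK in H *.
have K1 : 1 + (1 - 'i * u) / (1 + 'i * u) = 2 / (1 + 'i * u) by field.
have K2 : 1 - (1 - 'i * u) / (1 + 'i * u) = 2 * 'i * u / (1 + 'i * u) by field.
rewrite K1 K2.
have -> : u * (2 / (1 + 'i * u) / (2 * 'i * u / (1 + 'i * u))) = 'i^-1 by field; rewrite H2 u0 i0.
by apply: (mulfI i0); rewrite mulfV // mulrN i2 opprK.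
Qed.

Lemma TG_W_sq t : 0 < I t -> (2 * TG t * TG (- (4 * t)^-1)) ^+ 2 = 1.
Proof.
move=> t0; have w0 := Im_W t0; have tn := t_neq0 t0.
have -> : (2 * TG t * TG (- (4 * t)^-1)) ^+ 2 = 2 ^+ 2 * TG t ^+ 2 * TG (- (4 * t)^-1) ^+ 2 by ring.
rewrite (TG_sq t0) (TG_sq w0).
have s0 : 0 < I (t - 2^-1).
  have -> : (- 2^-1 : C) = (- 2^-1 : R)%:C by rewrite rmorphN fmorphV rmorph_nat.
  by rewrite Im_addr.
have E : - (4 * t)^-1 - 2^-1 = - ((t - 2^-1 + 1) / (2 * (t - 2^-1) + 1)).
  have -> : 2 * (t - 2^-1) + 1 = 2 * t by field.
  by field.
have := TU_M s0; rewrite -E; move: (TU _) (TU _) => v u H.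
have -> : 2 ^+ 2 * (z8 R / 2 * u) * (z8 R / 2 * v) = z8 R ^+ 2 * (u * v) by field.
by rewrite H z8_sq mulrN -expr2 sqr_i opprK.
Qed.

Lemma TG_W_const t s : 0 < I t -> 0 < I s ->
  2 * TG t * TG (- (4 * t)^-1) = 2 * TG s * TG (- (4 * s)^-1).
Proof.
move=> t0 s0; apply: (sign_const (h := fun z => 2 * TG z * TG (- (4 * z)^-1))) => // z z0; last exact: TG_W_sq.
apply: ccontM; first by apply: ccontM; [exact: ccont_cst|exact: ccont_TG].
apply: (ccont_comp (g := fun z => - (4 * z)^-1)); last exact/ccont_TG/Im_W.
have -> : (fun z : C => - (4 * z)^-1) = (fun z => -1 * (4 * z)^-1) by apply/funext => w; rewrite mulN1r.
apply: ccontM; first exact: ccont_cst.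
apply: ccontV; first by rewrite mulf_neq0 ?pnatr_eq0 // t_neq0.
by apply: ccontM; [exact: ccont_cst|exact: ccont_id].
Qed.

(** [V = W T^-1 W] with [W t = -1/(4t)]. The constant of [TG_W_const] enters once for each [W] and
    cancels, leaving the factor from [T]. *)
Lemma TG_V t : 0 < I t -> TG (t / (4 * t + 1)) = z8 R * TG t.
Proof.
move=> t0; have w0 := Im_W t0; have tn := t_neq0 t0.
set s := - (4 * t)^-1 - 1.
have s0 : 0 < I s.
  by rewrite /s -[- 1](rmorphN1 (real_complex R)) Im_addr.
have sn := t_neq0 s0.
have n1 : 4 * t + 1 != 0.
  have -> : 4 * t + 1 = - (4 * t * s) by rewrite /s; field.
  by rewrite oppr_eq0 !mulf_neq0 ?pnatr_eq0.
have E : - (4 * s)^-1 = t / (4 * t + 1).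
  have -> : s = - (4 * t + 1) / (4 * t) by rewrite /s; field.
  by field; rewrite n1 tn.
have := TG_W_const t0 s0; rewrite E.
have -> : TG (- (4 * t)^-1) = z8 R * TG s by rewrite -TG_T /s subrK.
have G0 := TG_neq0 s0; move: (TG s) G0 => g g0 H.
apply: (mulfI g0); apply: (mulfI (_ : 2 != 0 :> C)); first by rewrite pnatr_eq0.
by rewrite mulrA -H; ring.
Qed.

(** [V = S T^-4 S]: the laws of [TU] and [TA] under [V] follow from those under [S], because [T^4]
    fixes both functions. *)
Lemma S_V t : 0 < I t -> t / (4 * t + 1) = - (- t^-1 - 4)^-1.
Proof.
move=> t0; have tn := t_neq0 t0.
have s0 : 0 < I (- t^-1 - 4).
  have -> : (- 4 : C) = (- 4 : R)%:C by rewrite rmorphN rmorph_nat.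
  by rewrite Im_addr Im_S.
have n1 : 4 * t + 1 != 0.
  have -> : 4 * t + 1 = - (t * (- t^-1 - 4)) by field.
  by rewrite oppr_eq0 mulf_neq0 ?t_neq0.
have -> : - t^-1 - 4 = - (4 * t + 1) / t by field.
by field; rewrite n1 tn.
Qed.

Lemma TU_Tn t n : 0 < I t -> TU (t + n%:R) = 'i ^+ n * TU t.
Proof.
move=> t0; elim: n => [|n IH]; first by rewrite addr0 mul1r.
by rewrite -natr1 addrA TU_T ?Im_addn // IH exprS mulrA.
Qed.
Lemma TA_Tn t n : TA (t + n%:R) = TA t.
Proof. by elim: n => [|n IH]; rewrite ?addr0 // -natr1 addrA TA_T. Qed.

Lemma i4 : 'i ^+ 4 = 1 :> C.
Proof. by rewrite (exprM _ 2 2) sqr_i sqrrN expr1n. Qed.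

Lemma V_arg t : 0 < I t -> 0 < I (- t^-1 - 4).
Proof.
move=> t0; have -> : (- 4 : C) = (- 4 : R)%:C by rewrite rmorphN rmorph_nat.
by rewrite Im_addr Im_S.
Qed.

Lemma TU_V t : 0 < I t -> TU (t / (4 * t + 1)) = TU t.
Proof.
move=> t0; have s0 := Im_S t0; have r0 := V_arg t0.
rewrite S_V // (TU_S r0).
have -> : TU (- t^-1 - 4) = TU (- t^-1).
  by rewrite -[in RHS](subrK 4 (- t^-1)) (TU_Tn 4 r0) i4 mul1r.
by rewrite -(TU_S s0) invrN opprK invrK.
Qed.
Lemma TA_V t : 0 < I t -> TA (t / (4 * t + 1)) ^+ 4 = (4 * t + 1) ^+ 2 * TA t ^+ 4.
Proof.
move=> t0; have s0 := Im_S t0; have r0 := V_arg t0; have tn := t_neq0 t0.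
rewrite S_V // (A4_S r0).
have Aeq : TA (- t^-1 - 4) = TA (- t^-1) by rewrite -[in RHS](subrK 4 (- t^-1)) TA_Tn.
have Ueq : TU (- t^-1 - 4) = TU (- t^-1).
  by rewrite -[in RHS](subrK 4 (- t^-1)) (TU_Tn 4 r0) i4 mul1r.
have AU (x : C) : 0 < I x -> TA x + TB x = TA x * (1 + TU x).
  by move=> x0; rewrite /TU mulrDr mulr1 mulrCA mulfV ?mulr1 // TA_neq0.
rewrite (AU _ r0) Aeq Ueq exprMn (A4_S t0) (AU _ t0) (TU_S t0).
have H := TUD_neq0 t0; move: (TA t) (TU t) H => A u H.
by field; rewrite H tn.
Qed.

(** ** The group generated by T and V *)

Definition mob (a b c d : int) t : C := (a%:~R * t + b%:~R) / (c%:~R * t + d%:~R).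
Definition aut (c d : int) t : C := c%:~R * t + d%:~R.

Lemma Im_intD t (n : int) : I (t + n%:~R) = I t.
Proof. by rewrite -(rmorph_int (real_complex R)) Im_addr. Qed.

Lemma aut_neq0 (c d : int) t : 0 < I t -> (c != 0) || (d != 0) -> aut c d t != 0.
Proof.
move=> t0 cd; have [c0|c0] := eqVneq c 0.
  by rewrite /aut c0 mul0r add0r intr_eq0; rewrite c0 eqxx in cd.
apply/eqP => E; have := congr1 (@complex.Im R) E.
rewrite /aut Im_intD Im_int_mul /= => /eqP; rewrite mulf_eq0 intr_eq0 (negPf c0) /=.
by rewrite gt_eqF.
Qed.

Lemma det_cd (a b c d : int) : a * d - b * c = 1 -> (c != 0) || (d != 0).
Proof.
move=> D; rewrite -negb_and; apply/negP => /andP[/eqP c0 /eqP d0].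
by move: D; rewrite c0 d0 !mulr0 subrr.
Qed.

Lemma int_unit (a d : int) : a * d = 1 -> (a = 1 /\ d = 1) \/ (a = -1 /\ d = -1).
Proof.
move=> D; have : (absz a * absz d == 1)%N by rewrite -abszM D.
by rewrite muln_eq1 => /andP[/eqP a1 /eqP d1]; nia.
Qed.

Lemma Im_mob (a b c d : int) t : 0 < I t -> a * d - b * c = 1 -> 0 < I (mob a b c d t).
Proof.
move=> t0 D; have n0 := aut_neq0 t0 (det_cd D).
suff -> : I (mob a b c d t) = I t / cn (aut c d t) ^+ 2 by rewrite divr_gt0 // exprn_gt0 // cn_gt0.
have [c0|c0] := eqVneq c 0.
  move: D n0; rewrite {}c0 mulr0 subr0 /mob /aut !mul0r !add0r => D n0.
  have [[-> ->]|[-> ->]] : (a = 1 /\ d = 1) \/ (a = -1 /\ d = -1) by apply: int_unit.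
    by rewrite divr1 mul1r Im_intD cn1 expr1n divr1.
  rewrite invrN1 mulrN1 !mulN1r opprD opprK -intrN Im_intD cnN cn1 expr1n divr1 //.
have -> : mob a b c d t = a%:~R / c%:~R - (c%:~R * aut c d t)^-1.
  have cC : c%:~R != 0 :> C by rewrite intr_eq0.
  have DC : b%:~R = (a%:~R * d%:~R - 1) / c%:~R :> C.
    by apply: (canRL (mulfK cC)); rewrite -!intrM -[1]/(1%:~R) -intrB; congr (_%:~R); lia.
  have : t = (aut c d t - d%:~R) / c%:~R by rewrite /aut; field.
  rewrite /mob DC -/(aut c d t); move: (aut c d t) n0 => u u0 ->.
  by field; rewrite cC u0.
have -> : (a%:~R / c%:~R : C) = (a%:~R / c%:~R : R)%:C by rewrite rmorphM fmorphV !rmorph_int.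
rewrite addrC Im_addr Im_Vneg Im_int_mul cnM exprMn /aut Im_intD Im_int_mul cn_int real_normK ?num_real //.
have cR : c%:~R != 0 :> R by rewrite intr_eq0.
have uR : cn (c%:~R * t + d%:~R) != 0 by rewrite cn_eq0.
by field; rewrite cR uR.
Qed.

Lemma z8_mod (m n : int) : (8 %| m - n)%Z -> z8 R ^ m = z8 R ^ n.
Proof.
move=> /dvdzP[k E]; have -> : m = n + 8 * k by lia.
by rewrite expfzDr ?z8_neq0 // -exprz_exp; rewrite (_ : z8 R ^ 8 = 1) ?exp1rz ?mulr1 //; exact: z8_8.
Qed.
Lemma i_mod (m n : int) : (4 %| m - n)%Z -> ('i : C) ^ m = 'i ^ n.
Proof.
move=> /dvdzP[k E]; have -> : m = n + 4 * k by lia.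
by rewrite expfzDr ?i_neq0 // -exprz_exp; rewrite (_ : ('i : C) ^ 4 = 1) ?exp1rz ?mulr1 //; exact: i4.
Qed.

(** Exponent of the eighth root of unity by which the matrix with rows [(a, b)] and [(4e, d)] acts
    on [TG]. What characterises it is that, for determinant 1, it grows by 1 modulo 8 under right
    multiplication by [T] and by [V]. *)
Definition gexp (a b e d : int) : int := b * d * (1 + 4 * e ^+ 2) + e * (2 * d - a).

Definition law (a b e d : int) t :=
  [/\ TA (mob a b (4 * e) d t) ^+ 4 = aut (4 * e) d t ^+ 2 * TA t ^+ 4,
      TU (mob a b (4 * e) d t) = 'i ^ (b * d) * TU t
    & TG (mob a b (4 * e) d t) = z8 R ^ gexp a b e d * TG t].

Lemma dvd_even (x : int) : (2 %| x * (x + 1))%Z.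
Proof.
have [k [->|->]] : exists k, x = 2 * k \/ x = 2 * k + 1.
  exists (x %/ 2)%Z; have := divz_eq x 2; have := ltz_pmod x (isT : 0 < 2 :> int).
  have := modz_ge0 x (isT : 2 != 0 :> int); lia.
  by rewrite -mulrA dvdz_mulr.
by apply/dvdzP; exists ((2 * k + 1) * (k + 1)); ring.
Qed.

Lemma det_odd (a b e d : int) : a * d - b * (4 * e) = 1 -> exists k l, a = 2 * k + 1 /\ d = 2 * l + 1.
Proof.
move=> D.
have od x : exists k, x = 2 * k \/ x = 2 * k + 1 :> int.
  exists (x %/ 2)%Z; have := divz_eq x 2; have := ltz_pmod x (isT : 0 < 2 :> int).
  have := modz_ge0 x (isT : 2 != 0 :> int); lia.
have [k Hk] := od a; have [l Hl] := od d; exists k, l.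
case: Hk => Hk; first by exfalso; have : 2 * (k * d - b * (2 * e)) = 1 by [rewrite -[RHS]D Hk; ring]; lia.
case: Hl => Hl //; exfalso; have : 2 * (a * l - b * (2 * e)) = 1 by [rewrite -[RHS]D Hl; ring]; lia.
Qed.

Lemma lawT (a b e d : int) t : 0 < I t -> a * d - b * (4 * e) = 1 ->
  law a b e d (t + 1) <-> law a (b + a) e (d + 4 * e) t.
Proof.
move=> t0 D; rewrite /law.
have -> : mob a (b + a) (4 * e) (d + 4 * e) t = mob a b (4 * e) d (t + 1).
  by rewrite /mob !intrD; congr (_ / _); ring.
have -> : aut (4 * e) (d + 4 * e) t = aut (4 * e) d (t + 1) by rewrite /aut intrD; ring.
have -> : ('i : C) ^ ((b + a) * (d + 4 * e)) = 'i ^ (b * d) * 'i.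
  rewrite -[X in _ = _ * X]expr1z -expfzDr ?i_neq0 //; apply: i_mod; apply/dvdzP.
  by exists (b * e + e * (b + a)); lia.
have -> : z8 R ^ gexp a (b + a) e (d + 4 * e) = z8 R ^ gexp a b e d * z8 R.
  rewrite -[X in _ = _ * X]expr1z -expfzDr ?z8_neq0 //; apply: z8_mod; apply/dvdzP.
  have [k [_ [ak _]]] := det_odd D; have /dvdzP[l el] := dvd_even e.
  (* After substituting [a d = 1 + 4 b e] and [a = 2k + 1], all terms are multiples of 8 except
     [4 e (e + 1)], where [e (e + 1)] is even. *)
  exists (b * e + 4 * b * e ^+ 3 + 2 * a * e ^+ 3 + e ^+ 2 + k * e + l + (a * d - b * (4 * e) - 1) * 0).
  have ad : a * d = 1 + 4 * (b * e) by lia.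
  have -> : gexp a (b + a) e (d + 4 * e) - (gexp a b e d + 1) =
     (a * d + 4 * b * e + 4 * (a * e)) * (1 + 4 * e ^+ 2) + 8 * e ^+ 2 - 1 by rewrite /gexp; ring.
  rewrite ad mulr0 addr0; have -> : (b * e + 4 * b * e ^+ 3 + 2 * a * e ^+ 3 + e ^+ 2 + k * e + l) * 8 =
    8 * (b * e + 4 * b * e ^+ 3 + 2 * a * e ^+ 3 + e ^+ 2 + k * e) + 4 * (l * 2) by ring.
  by rewrite -el ak; ring.
by rewrite TA_T TU_T // TG_T !mulrA.
Qed.

Lemma V_pos t : 0 < I t -> 0 < I (t / (4 * t + 1)).
Proof. by move=> t0; rewrite S_V // Im_S // V_arg. Qed.
Lemma V_neq0 t : 0 < I t -> 4 * t + 1 != 0.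
Proof. by move=> t0; have := @aut_neq0 4 1 t t0 isT. Qed.

Lemma lawV (a b e d : int) t : 0 < I t -> a * d - b * (4 * e) = 1 ->
  law a b e d (t / (4 * t + 1)) <-> law (a + 4 * b) b (e + d) d t.
Proof.
move=> t0 D; rewrite /law; have n0 := V_neq0 t0.
have D' : (a + 4 * b) * d - b * (4 * (e + d)) = 1 by rewrite -[RHS]D; ring.
have n1 := aut_neq0 t0 (det_cd D').
have n1' : (4 * (e + d))%:~R * t + d%:~R != 0 :> C := n1.
have -> : mob (a + 4 * b) b (4 * (e + d)) d t = mob a b (4 * e) d (t / (4 * t + 1)).
  rewrite /mob.
  have -> : a%:~R * (t / (4 * t + 1)) + b%:~R = ((a + 4 * b)%:~R * t + b%:~R) / (4 * t + 1) :> C.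
    by rewrite intrD intrM; field.
  have -> : (4 * e)%:~R * (t / (4 * t + 1)) + d%:~R = ((4 * (e + d))%:~R * t + d%:~R) / (4 * t + 1) :> C.
    by rewrite !intrM intrD; field.
  by move: (_ + _) (_ + _) n1' (_ + _) n0 => x y y0 z z0; field; rewrite y0 z0.
have -> : aut (4 * (e + d)) d t ^+ 2 * TA t ^+ 4 = aut (4 * e) d (t / (4 * t + 1)) ^+ 2 * TA (t / (4 * t + 1)) ^+ 4.
  by rewrite TA_V // mulrA -exprMn; congr (_ ^+ 2 * _); rewrite /aut !intrM intrD; field.
have -> : z8 R ^ gexp (a + 4 * b) b (e + d) d = z8 R ^ gexp a b e d * z8 R.
  rewrite -[X in _ = _ * X]expr1z -expfzDr ?z8_neq0 //; apply: z8_mod; apply/dvdzP.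
  have [_ [k [_ dk]]] := det_odd D; have /dvdzP[l kl] := dvd_even k.
  have ad : a * d = 1 + 4 * (b * e) by lia.
  (* Here [d] odd makes [d^2 - 1] divisible by 8. *)
  exists (b * e * d ^+ 2 - b * e + (2 * b * d + 1) * 2 * l).
  have -> : gexp (a + 4 * b) b (e + d) d - (gexp a b e d + 1) =
     8 * (b * e * d ^+ 2) + 4 * b * d * (d ^+ 2 - 1) - 4 * (b * e) + 2 * (d ^+ 2 - 1) - a * d + 1 by rewrite /gexp; ring.
  have d2 : d ^+ 2 - 1 = 8 * l by rewrite dk; have -> : (2 * k + 1) ^+ 2 - 1 = 4 * (k * (k + 1)) by [ring]; rewrite kl; ring.
  by rewrite ad d2; ring.
by rewrite TU_V // TG_V // !mulrA.
Qed.

Lemma Im_subn t n : I (t - n%:R) = I t.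
Proof. by have := Im_intD t (- n%:Z); rewrite intrN -pmulrn. Qed.

Lemma Gamma04_translation (a b d : int) t : 0 < I t -> a * d = 1 -> law a b 0 d t.
Proof.
move: {2}(absz b) (leqnn (absz b)) => n; elim: n b t => [|n IH] b t bn t0 D.
  have -> : b = 0 by lia.
  rewrite /law /gexp /mob /aut !mulr0 !mul0r !add0r !addr0 expr0z expr0z !mul1r.
  have [[-> ->]|[-> ->]] : (a = 1 /\ d = 1) \/ (a = -1 /\ d = -1) by apply: int_unit.
    by rewrite mul1r divr1 expr1n mul1r.
  by rewrite invrN1 mulrN1 !mulN1r opprK sqrrN expr1n mul1r.
have [b0|b0] := eqVneq b 0; first by apply: IH => //; rewrite b0.
have a1 : a = 1 \/ a = -1 by have := int_unit D; lia.
case: (boolP (0 <= b * a)) => ba.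
  have ba' : (absz (b - a)%R <= n)%N by case: a1 => ?; subst a; lia.
  have := @lawT a (b - a) 0 d t t0; rewrite !mulr0 addr0 subr0 => /(_ D); rewrite subrK => <-.
  by apply: IH => //; rewrite (Im_addn t 1).
have ba' : (absz (b + a)%R <= n)%N by case: a1 => ?; subst a; lia.
have t1 : 0 < I (t - 1) by rewrite (Im_subn t 1).
have := @lawT a b 0 d (t - 1) t1; rewrite !mulr0 addr0 subr0 => /(_ D); rewrite subrK => ->.
exact: IH.
Qed.

(** Euclid's algorithm on the bottom row: [T] changes [d] by [4e], [V] changes [e] by [d]. For
    [e <> 0] one of them or its inverse lowers [|4e| + |d|]; the stationary case [|4e| = 2|d|] is
    excluded by [d] being odd. Each step also moves [t], hence the generality in [t]. *)
Lemma Gamma04_law (a b e d : int) t : 0 < I t -> a * d - b * (4 * e) = 1 -> law a b e d t.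
Proof.
move: {2}(absz (4 * e)%R + absz d)%N (leqnn (absz (4 * e)%R + absz d)%N) => n.
elim: n a b e d t => [|n IH] a b e d t en t0 D.
  by have : e = 0 /\ d = 0 by [lia]; case=> e0 d0; move: D; rewrite e0 d0 !mulr0 subrr.
have [e0|e0] := eqVneq e 0.
  by move: D; rewrite e0 !mulr0 subr0 => D; apply: Gamma04_translation.
have [_ [k [_ dk]]] := det_odd D.
have t1 : 0 < I (t - 1) by rewrite (Im_subn t 1).
have t2 : 0 < I (t + 1) by rewrite (Im_addn t 1).
case: (ltnP (absz (4 * e)%R) (absz d).*2) => ed.
  case: (boolP (0 <= e * d)) => sg.
    have := @lawT a (b - a) e (d - 4 * e) t t0; rewrite !subrK => <-; last by rewrite -[RHS]D; ring.
    by apply: IH => //; [nia|rewrite -[RHS]D; ring].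
  have := @lawT a b e d (t - 1) t1 D; rewrite subrK => ->.
  by apply: IH => //; [nia|rewrite -[RHS]D; ring].
have V0 := V_pos t0.
case: (boolP (0 <= e * d)) => sg.
  have := @lawV (a - 4 * b) b (e - d) d t t0; rewrite !subrK => <-; last by rewrite -[RHS]D; ring.
  by apply: IH => //; [nia|rewrite -[RHS]D; ring].
(* [s] is the preimage of [t] under [V], for the step in which [e] and [d] have opposite signs. *)
pose s := mob 1 0 (-4) 1 t.
have s0 : 0 < I s by apply: Im_mob.
have E : s / (4 * s + 1) = t.
  have n0 : 1 - 4 * t != 0.
    by have := @aut_neq0 (-4) 1 t t0 isT; rewrite /aut intrN mulNr addrC.
  have sE : s = t / (1 - 4 * t) by rewrite /s /mob mul1r addr0 intrN mulNr addrC.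
  have -> : 4 * s + 1 = (1 - 4 * t)^-1 by rewrite sE; field.
  by rewrite sE invrK mulfVK.
have := @lawV a b e d s s0 D; rewrite E => ->.
by apply: IH => //; [nia|rewrite -[RHS]D; ring].
Qed.

(** ** Behaviour under the full modular group *)

(** Fourth powers avoid a choice of square root in the automorphy factor. Every element of the full
    modular group mixes [TA] and [TB] linearly, with constants depending on the matrix alone; this
    controls all cusps at once. *)
Definition linear_law (a b c d : int) := exists n11 n12 n21 n22 : C, forall t, 0 < I t ->
  TA (mob a b c d t) ^+ 4 = aut c d t ^+ 2 * (n11 * TA t + n12 * TB t) ^+ 4 /\
  TB (mob a b c d t) ^+ 4 = aut c d t ^+ 2 * (n21 * TA t + n22 * TB t) ^+ 4.

Lemma linear_lawT (a b c d : int) : linear_law a (b + a) c (d + c) <-> linear_law a b c d.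
Proof.
have E t : mob a (b + a) c (d + c) t = mob a b c d (t + 1).
  by rewrite /mob !intrD; congr (_ / _); ring.
have E2 t : aut c (d + c) t = aut c d (t + 1) by rewrite /aut intrD; ring.
split=> -[n11 [n12 [n21 [n22 H]]]].
  exists n11, (- 'i * n12), n21, (- 'i * n22) => t t0.
  have t1 : 0 < I (t - 1) by rewrite (Im_subn t 1).
  have B1 : TB (t - 1) = - 'i * TB t.
    rewrite -[in RHS](subrK 1 t) TB_T // mulrA mulNr -expr2 sqr_i opprK mul1r //.
  have A1 : TA (t - 1) = TA t by rewrite -[in RHS](subrK 1 t) TA_T.
  have := H (t - 1) t1; rewrite E E2 subrK B1 A1.
  by rewrite !(mulrCA _ (- 'i)) !(mulrA (- 'i)).
exists n11, ('i * n12), n21, ('i * n22) => t t0.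
have t1 : 0 < I (t + 1) by rewrite (Im_addn t 1).
have := H (t + 1) t1; rewrite E E2 TA_T TB_T //.
by rewrite !(mulrCA _ 'i) !(mulrA 'i).
Qed.

(** The constant satisfies [((1 + i)/2)^4 = -1/4], the factor in [A4_S]. *)
Lemma lin_S (n m : C) t : 0 < I t -> (n * TA (- t^-1) + m * TB (- t^-1)) ^+ 4 =
  t ^+ 2 * ((1 + 'i) / 2 * (n + m) * TA t + (1 + 'i) / 2 * (n - m) * TB t) ^+ 4.
Proof.
move=> t0; have L := S_lin t0; have E := A4_S t0; have H0 := TADB_neq0 t0.
apply: (mulIf (expf_neq0 4 H0)); rewrite -exprMn.
have -> : (n * TA (- t^-1) + m * TB (- t^-1)) * (TA t + TB t) =
  n * TA (- t^-1) * (TA t + TB t) + m * (TB (- t^-1) * (TA t + TB t)) by ring.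
rewrite -L.
have -> : n * TA (- t^-1) * (TA t + TB t) + m * (TA (- t^-1) * (TA t - TB t)) =
  TA (- t^-1) * ((n + m) * TA t + (n - m) * TB t) by ring.
rewrite exprMn E.
have -> : (1 + 'i) / 2 * (n + m) * TA t + (1 + 'i) / 2 * (n - m) * TB t =
  (1 + 'i) / 2 * ((n + m) * TA t + (n - m) * TB t) by ring.
have l4 : ((1 + 'i) / 2) ^+ 4 = - 4^-1 :> C.
  have -> : ((1 + 'i) / 2) ^+ 4 = (1 + 2 * 'i + 'i ^+ 2) ^+ 2 / 16 :> C by field.
  rewrite sqr_i; have -> : (1 + 2 * 'i + -1) ^+ 2 / 16 = 'i ^+ 2 / 4 :> C by field.
  by rewrite sqr_i mulN1r.
rewrite [in RHS]exprMn l4.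
by move: (_ + _) (_ + _) => x y; field.
Qed.

Lemma linear_lawS (a b c d : int) : linear_law b (- a) d (- c) -> linear_law a b c d.
Proof.
move=> [n11 [n12 [n21 [n22 H]]]].
pose l : C := (1 + 'i) / 2.
exists (l * (n11 + n12)), (l * (n11 - n12)), (l * (n21 + n22)), (l * (n21 - n22)) => t t0.
have tn := t_neq0 t0.
have E : mob b (- a) d (- c) (- t^-1) = mob a b c d t.
  rewrite /mob !intrN.
  have -> : b%:~R * - t^-1 - a%:~R = - ((a%:~R * t + b%:~R) / t) :> C by field.
  have -> : d%:~R * - t^-1 - c%:~R = - ((c%:~R * t + d%:~R) / t) :> C by field.
  by rewrite invrN mulrNN invf_div mulrA mulfVK.
have E2 : aut d (- c) (- t^-1) ^+ 2 * t ^+ 2 = aut c d t ^+ 2.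
  by rewrite /aut intrN; field.
have [H1 H2] := H _ (Im_S t0); rewrite E in H1 H2.
by rewrite H1 H2 !lin_S // -/l !(mulrA (_ ^+ 2) (t ^+ 2)) E2.
Qed.

Lemma linear_law_all (a b c d : int) : a * d - b * c = 1 -> linear_law a b c d.
Proof.
have tr n (x y z : int) : (absz y <= n)%N -> x * z = 1 -> linear_law x y 0 z.
  elim: n y => [|n IH] y yn D.
    have -> : y = 0 by lia.
    exists 1, 0, 0, 1 => t t0; rewrite /mob /aut !mul0r !add0r !addr0 !mul1r.
    have [[-> ->]|[-> ->]] := int_unit D.
      by rewrite mul1r divr1 expr1n !mul1r.
    by rewrite invrN1 mulrN1 !mulN1r opprK sqrrN expr1n !mul1r.
  have [y0|y0] := eqVneq y 0; first by apply: IH => //; rewrite y0.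
  have x1 : x = 1 \/ x = -1 by have := int_unit D; lia.
  case: (boolP (0 <= y * x)) => yx.
    have h : (absz (y - x)%R <= n)%N by case: x1 => ?; subst x; lia.
    by have := linear_lawT x (y - x) 0 z; rewrite subrK addr0 => ->; apply: IH.
  have h : (absz (y + x)%R <= n)%N by case: x1 => ?; subst x; lia.
  by have := linear_lawT x y 0 z; rewrite addr0 => <-; apply: IH.
(* The weight 2 on [|c|] makes the swap by [S] decrease the measure when [|d| < |c|]. *)
move: {2}(2 * (absz c) + absz d)%N (leqnn (2 * (absz c) + absz d)%N) => n.
elim: n a b c d => [|n IH] a b c d cdn D.
  by have : c = 0 /\ d = 0 by [lia]; case=> c0 d0; move: D; rewrite c0 d0 !mulr0 subrr.
have [c0|c0] := eqVneq c 0.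
  by move: D; rewrite c0 mulr0 subr0 => D; apply: (tr (absz b)).
case: (ltnP (absz d) (absz c)) => dc.
  apply: linear_lawS; apply: IH; last by rewrite -[RHS]D; ring.
  by rewrite abszN; lia.
case: (boolP (0 <= c * d)) => sg.
  have := linear_lawT a (b - a) c (d - c); rewrite !subrK => ->.
  by apply: IH; [nia|rewrite -[RHS]D; ring].
by rewrite -linear_lawT; apply: IH; [nia|rewrite -[RHS]D; ring].
Qed.

(** * Growth at the cusps *)

Lemma theta_bounded (r : R) : 0 < r -> exists2 M : R, 0 <= M &
  forall t, r <= I t -> cn (TA t) <= M /\ cn (TB t) <= M.
Proof.
move=> r0; have rb (x : R) : 0 < x -> 0 <= expR (- (2 * pi * x)) < 1.
  by move=> x0; rewrite expR_ge0 -expR0 ltr_expR oppr_lt0 !mulr_gt0 // pi_gt0.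
have [M1 M10 H1] := ev_bound pb_phi (rb _ r0).
have r4 : 0 < r / 4 by rewrite divr_gt0.
have [M2 M20 H2] := ev_bound pb_thb (rb _ r4).
exists (M1 + M2); first by rewrite addr_ge0.
move=> t rt; split.
  apply: le_trans (_ : M1 <= _); last by rewrite lerDl.
  by rewrite TA.unlock; apply: H1; apply: nome_le.
apply: le_trans (_ : M2 <= _); last by rewrite lerDr.
by rewrite TB.unlock; apply: H2; apply: nome_le; rewrite (Im_divn t 4) ler_pM2r // invr_gt0.
Qed.

(** Hermite normal form: [diag(N, 1) g] is a matrix of SL2(Z) times the upper triangular matrix with
    rows [(al, be)] and [(0, de)]. Thus [N * g t] is the image under SL2(Z) of
    [(al t + be) / de]. *)
Lemma hermite (a b c d N : int) : 0 < N -> a * d - b * c = 1 ->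
  exists x y z u al be de : int, [/\ x * u - y * z = 1, 0 < al, 0 < de, al * de = N &
   [/\ N * a = x * al, N * b = x * be + y * de, c = z * al & d = z * be + u * de]].
Proof.
move=> N0 D; pose al := gcdz (N * a) c.
have al0 : al != 0.
  rewrite /al gcdz_eq0 negb_and mulf_eq0 (gt_eqF N0) /=; apply/orP.
  case: (eqVneq a 0) => [a0|a0]; [right|by left].
  by apply: contraTneq isT => c0; move: D; rewrite a0 c0 mulr0 mul0r.
have alp : 0 < al by rewrite lt_def al0.
have /dvdzP[x xE] : (al %| N * a)%Z := dvdz_gcdl _ _.
have /dvdzP[z zE] : (al %| c)%Z := dvdz_gcdr _ _.
have [u [v uv]] := Bezoutz (N * a) c; rewrite -/al in uv.
have uv1 : x * u - (- v) * z = 1.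
  by apply: (mulfI al0); rewrite mulr1 -[RHS]uv xE zE; ring.
pose be := u * (N * b) + v * d; pose de := x * d - z * (N * b).
have ad : al * de = N.
  have -> : al * de = (x * al) * d - (z * al) * (N * b) by rewrite /de; ring.
  by rewrite -xE -zE -[RHS]mulr1 -[X in _ = N * X]D; ring.
exists x, (- v), z, u, al, be, de; split=> //.
  by rewrite -(pmulr_rgt0 _ alp) ad.
split=> //; rewrite /be /de.
  have -> : x * (u * (N * b) + v * d) + - v * (x * d - z * (N * b)) = (x * u - (- v) * z) * (N * b) by ring.
  by rewrite uv1 mul1r.
have -> : z * (u * (N * b) + v * d) + u * (x * d - z * (N * b)) = (x * u - (- v) * z) * d by ring.
by rewrite uv1 mul1r.
Qed.

(** By [hermite], the thetas are evaluated at the SL2(Z)-image of a point [w] with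
    [Im w >= al / de], where they are bounded. The automorphy factor at [w] is the one at [t]
    divided by [de >= 1]. *)
Lemma cusp_bound (N : nat) (a b c d : int) : (0 < N)%N -> a * d - b * c = 1 ->
  exists2 M : R, 0 <= M & forall t, 1 <= I t ->
   cn (TA (N%:R * mob a b c d t)) ^+ 4 <= M * cn (aut c d t) ^+ 2 /\
   cn (TB (N%:R * mob a b c d t)) ^+ 4 <= M * cn (aut c d t) ^+ 2.
Proof.
move=> N0 D; have N0' : 0 < N%:Z by [].
have [x [y [z [u [al [be [de [D' al0 de0 ad [E1 E2 E3 E4]]]]]]]]] := hermite N0' D.
have [n11 [n12 [n21 [n22 H]]]] := linear_law_all D'.
have al1 : 1 <= al%:~R :> R by rewrite (ler_int _ 1); lia.
have de1 : 0 < de%:~R :> R by rewrite ltr0z.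
have de2 : 1 <= de%:~R :> R by rewrite (ler_int _ 1); lia.
have r0 : 0 < al%:~R / de%:~R :> R by rewrite divr_gt0 // ltr0z.
have [M M0 HM] := theta_bounded r0.
pose K := cn n11 + cn n12 + cn n21 + cn n22.
have K0 : 0 <= K by rewrite /K !addr_ge0 ?cn_ge0.
exists ((K * M) ^+ 4); first by rewrite exprn_ge0 // mulr_ge0.
move=> t t1; have t0 : 0 < I t by lra.
pose w := (al%:~R * t + be%:~R) / de%:~R : C.
have dn : de%:~R != 0 :> C by rewrite intr_eq0 gt_eqF.
have wI : I w = al%:~R * I t / de%:~R.
  rewrite /w -[de%:~R : C](rmorph_int (real_complex R)) -fmorphV mulrC.
  have RI (k : R) (v : C) : I (k%:C * v) = k * I v by case: v => p q /=; ring.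
  by rewrite RI Im_intD Im_int_mul mulrC.
have rw : al%:~R / de%:~R <= I w.
  by rewrite wI ler_pM2r ?invr_gt0 // ler_peMr //; lra.
have w0 : 0 < I w by apply: lt_le_trans rw.
have n0 := aut_neq0 t0 (det_cd D); have nw := aut_neq0 w0 (det_cd D').
have Ea : aut c d t = de%:~R * aut z u w.
  by rewrite /aut /w E3 E4 !intrD !intrM; field.
have Em : N%:R * mob a b c d t = mob x y z u w.
  rewrite /mob -/(aut c d t) -/(aut z u w) mulrA Ea.
  have -> : N%:R * (a%:~R * t + b%:~R) = de%:~R * (x%:~R * w + y%:~R) :> C.
    have -> : N%:R * (a%:~R * t + b%:~R) = (N%:Z * a)%:~R * t + (N%:Z * b)%:~R :> C by rewrite !intrM -pmulrn; ring.
    by rewrite E1 E2 /w intrD !intrM; field.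
  by field; rewrite dn nw.
have auw : cn (aut z u w) <= cn (aut c d t).
  rewrite Ea cnM cn_int ger0_norm ?ler_peMl ?cn_ge0 //; lra.
have [h1 h2] := H w w0; have [A1 B1] := HM w rw; rewrite Em.
have lin (n m : C) : cn n + cn m <= K -> cn (n * TA w + m * TB w) <= K * M.
  move=> nm; apply: le_trans (cnD _ _) _; rewrite !cnM.
  have g1 : cn n * cn (TA w) <= cn n * M by rewrite ler_wpM2l ?cn_ge0.
  have g2 : cn m * cn (TB w) <= cn m * M by rewrite ler_wpM2l ?cn_ge0.
  apply: le_trans (lerD g1 g2) _; rewrite -mulrDl ler_wpM2r //.
have l1 : cn (n11 * TA w + n12 * TB w) <= K * M.
  by apply: lin; rewrite /K; have := cn_ge0 n21; have := cn_ge0 n22; lra.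
have l2 : cn (n21 * TA w + n22 * TB w) <= K * M.
  by apply: lin; rewrite /K; have := cn_ge0 n11; have := cn_ge0 n12; lra.
have fin X : cn X <= K * M -> cn (aut z u w) ^+ 2 * cn X ^+ 4 <= (K * M) ^+ 4 * cn (aut c d t) ^+ 2.
  move=> XK; rewrite mulrC; apply: ler_pM; rewrite ?exprn_ge0 ?cn_ge0 //.
    by rewrite lerXn2r // nnegrE ?cn_ge0 // mulr_ge0.
  by rewrite lerXn2r // nnegrE cn_ge0.
by rewrite -!cnX h1 h2 !(cnM (aut z u w ^+ 2)) !(cnX _ 4) !(cnX _ 2); split; apply: fin.
Qed.
End Modular.

(** * The modular form *)

Lemma pb_xx : pb xx. Proof. by rewrite xx.unlock; apply/pb_sub/pb_tha. Qed.
Lemma pb_yy : pb yy. Proof. by rewrite yy.unlock; apply/pb_sub/pb_thb. Qed.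
Lemma pb_kap : pb kap. Proof. by rewrite kap.unlock; apply/pb_sub/pb_om. Qed.
Lemma pb_tht : pb tht.
Proof. by rewrite tht.unlock; apply: pbM; [apply: pb_X|apply/pb_sub/pb_ftw/pb_psi]. Qed.

Definition imon (D : nat) (p : int * nat) : fps int :=
  p.1%:~R * xx ^+ (D - p.2) * yy ^+ p.2.
(** The lift to the integers of the expression found in [main_mod], whose [r - 1] is the [r] used
    here. *)
Definition form (r D : nat) (s : seq (int * nat)) : fps int :=
  tht * kap ^+ r * \sum_(p <- s) imon D p.

Lemma pb_imon D p : pb (imon D p).
Proof. by apply: pbM; [apply: pbM; [apply: pb_int|apply/pbX/pb_xx]|apply/pbX/pb_yy]. Qed.
Lemma pb_form r D s : pb (form r D s).
Proof.
apply: pbM; last by apply: pb_sum => p; apply: pb_imon.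
by apply: pbM; [apply: pb_tht|apply/pbX/pb_kap].
Qed.

Section Final.
Variable R : realType.
Local Notation C := R[i].
Implicit Types z w q t : C.
Local Notation "'I' z" := (complex.Im z) (at level 10).

Lemma Im_natM (n : nat) z : I (n%:R * z) = n%:R * I z.
Proof. by have := Im_int_mul n%:Z z; rewrite -!pmulrn. Qed.
Lemma Im_natM_gt0 (n : nat) z : (0 < n)%N -> 0 < I z -> 0 < I (n%:R * z).
Proof. by move=> n0 z0; rewrite Im_natM mulr_gt0 // ltr0n. Qed.

Section Values.
Variable z : C.
Hypothesis z0 : 0 < I z.
Let q := nome z.
Let q1 : cn q < 1 := nome_lt1 z0.
Let z32 : 0 < I (32%:R * z) := @Im_natM_gt0 32 z isT z0.

Lemma ev_xx : ev xx q = TA (32%:R * z).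
Proof.
rewrite TA_tha // xx.unlock ev_sub //; last exact: pb_tha.
by rewrite -nomeX; congr (ev _ (nome _)); field.
Qed.
Lemma ev_yy : ev yy q = TB (32%:R * z).
Proof.
rewrite TB.unlock yy.unlock ev_sub //; last exact: pb_thb.
by rewrite -nomeX; congr (ev _ (nome _)); field.
Qed.
Lemma ev_tht : ev tht q = TG (8%:R * z) * (TA (32%:R * z) - TB (32%:R * z)).
Proof.
have px := pb_X; have pp := pb_psi; have pf := pb_ftw pp; have p8 := pb_sub 8 pf.
rewrite TABB // tht.unlock evM ?ev_X ?ev_sub //.
rewrite ev_ftw //; last exact: cnX_lt1.
have E : nome (32%:R * z / 4) = nome (8%:R * z) by congr nome; field.
have E8 : nome (8%:R * z / 8) = q by rewrite /q; congr nome; field.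
rewrite E /TG E8 -nomeX mulfVK // phiN_neq0 // nome_lt1 //.
exact: Im_natM_gt0.
Qed.
Lemma ev_kap : ev kap q = TG (8%:R * z) ^+ 2 * (TA (32%:R * z) - TB (32%:R * z)).
Proof.
have px := pb_xx; have py := pb_yy; have pk := pb_kap; have pt := pb_tht.
have h := congr1 (fun f => ev f q) tht_sq.
rewrite evX // evM // in h; last by apply: pbD => //; apply: pbN.
rewrite evD ?evN // in h; last exact: pbN.
rewrite ev_tht ev_xx ev_yy in h.
by apply: (mulfI (TABB_neq0 z32)); rewrite -h; ring.
Qed.
Lemma ev_kap4 : 2 * ev kap q ^+ 4 = TA (32%:R * z) * TB (32%:R * z) *
  (TA (32%:R * z) ^+ 2 + TB (32%:R * z) ^+ 2).
Proof.
have px := pb_xx; have py := pb_yy; have pk := pb_kap.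
have h := congr1 (fun f => ev f q) kap4.
rewrite evM ?(ev_nat 2) // in h; [|exact: (pb_nat 2)|exact: pbX].
rewrite evX // evM // in h; [|exact: pbM|by apply: pbD; apply: pbX].
by rewrite evM // evD ?evX // in h; rewrite -?ev_xx -?ev_yy //; exact: pbX.
Qed.

Lemma ev_form r D s : ev (form r D s) q = \sum_(p <- s) (p.1%:~R * (ev tht q * ev kap q ^+ r *
  TA (32%:R * z) ^+ (D - p.2) * TB (32%:R * z) ^+ p.2)).
Proof.
have px := pb_xx; have py := pb_yy; have pk := pb_kap; have pt := pb_tht.
have pk' := pbX r pk.
rewrite evM //; [|exact: pbM|by apply: pb_sum => p; apply: pb_imon].
rewrite evM // evX // ev_sum //; last by move=> p; apply: pb_imon.
rewrite mulr_sumr; apply: eq_bigr => p _.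
rewrite evM //; [|by apply: pbM; [apply: pb_int|apply: pbX]|exact: pbX].
rewrite evM //; [|exact: pb_int|exact: pbX].
by rewrite ev_int // !evX // ev_xx ev_yy; ring.
Qed.

(** Once [theta_3^(4K)] is factored out, what remains is a polynomial in the weight 0 functions
    [TG(8z)] and [TU(32z)], whose multipliers are roots of unity. *)
Lemma ev_form_weight (r D K : nat) s : (D + r.+1 = 4 * K)%N -> all (fun p => p.2 <= D)%N s ->
  ev (form r D s) q = (TA (32%:R * z) ^+ 4) ^+ K * \sum_(p <- s) (p.1%:~R *
   (TG (8%:R * z) ^+ r.*2.+1 * (1 - TU (32%:R * z)) ^+ r.+1 * TU (32%:R * z) ^+ p.2)).
Proof.
move=> DK /allP sD; rewrite ev_form mulr_sumr big_seq [RHS]big_seq; apply: eq_bigr => p /sD pD.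
have -> : TB (32%:R * z) = TA (32%:R * z) * TU (32%:R * z).
  by rewrite /TU mulrCA mulfV ?mulr1 // TA_neq0.
have -> : ev tht q = TG (8%:R * z) * (TA (32%:R * z) * (1 - TU (32%:R * z))).
  by rewrite ev_tht /TU; congr (_ * _); rewrite mulrBr mulr1 mulrCA mulfV ?mulr1 // TA_neq0.
have -> : ev kap q = TG (8%:R * z) ^+ 2 * (TA (32%:R * z) * (1 - TU (32%:R * z))).
  by rewrite ev_kap /TU; congr (_ * _); rewrite mulrBr mulr1 mulrCA mulfV ?mulr1 // TA_neq0.
move: (TA _) (TU _) (TG _) => A u g.
rewrite -[(A ^+ 4) ^+ K]exprM -DK (exprMn r (g ^+ 2)) (exprMn r A) (exprMn p.2 A) -(exprM g) mul2n.
have -> : A ^+ (D + r.+1) = A * A ^+ r * A ^+ (D - p.2) * A ^+ p.2.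
  by rewrite -exprS -!exprD -addnA subnK // addnC.
rewrite !exprS.
by move: (A ^+ r) (A ^+ (D - p.2)) (A ^+ p.2) (g ^+ r.*2) (_ ^+ r) (u ^+ p.2) => *; ring.
Qed.

(** If [T] is the larger of the moduli of the two thetas, [ev_kap4] gives [|kap| <= T], and then
    [tht^2 = (x - y) kap] gives [|tht| <= 2T]. Unlike [ev_form_weight] this divides by no theta
    function, so it stays uniform where [theta_3] is small. *)
Lemma form_bound (r D K : nat) s (M : R) : (D + r.+1 = 4 * K)%N -> all (fun p => p.2 <= D)%N s ->
  cn (TA (32%:R * z)) ^+ 4 <= M -> cn (TB (32%:R * z)) ^+ 4 <= M ->
  cn (ev (form r D s) q) <= \sum_(p <- s) cn (p.1%:~R : C) * (2 * M ^+ K).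
Proof.
move=> DK /allP sD AM BM.
have tq2 : ev tht q ^+ 2 = (TA (32%:R * z) - TB (32%:R * z)) * ev kap q by rewrite ev_tht ev_kap; ring.
have kq4 := ev_kap4; rewrite ev_form.
move: (TA _) (TB _) (ev tht q) (ev kap q) AM BM tq2 kq4 => A B th ka AM BM tq2 kq4.
pose T := Num.max (cn A) (cn B).
have AT : cn A <= T by rewrite le_max lexx.
have BT : cn B <= T by rewrite le_max lexx orbT.
have T0 : 0 <= T := le_trans (cn_ge0 A) AT.
have TM : T ^+ 4 <= M by rewrite /T; case: (leP (cn A) (cn B)).
have kaT : cn ka <= T.
  rewrite -(@ler_pXn2r _ 4) ?nnegrE ?cn_ge0 //.
  have := congr1 (@cn R) kq4; rewrite (cnM 2) (cn_nat _ 2) (cnX ka) (cnM (A * B)) (cnM A) => E.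
  have h1 : cn A * cn B <= T * T by apply: ler_pM; rewrite ?cn_ge0.
  have h2 : cn (A ^+ 2 + B ^+ 2) <= 2 * T ^+ 2.
    apply: le_trans (cnD _ _) _; rewrite !cnX.
    have g1 : cn A ^+ 2 <= T ^+ 2 by rewrite lerXn2r // nnegrE cn_ge0.
    have g2 : cn B ^+ 2 <= T ^+ 2 by rewrite lerXn2r // nnegrE cn_ge0.
    lra.
  have := ler_pM (mulr_ge0 (cn_ge0 A) (cn_ge0 B)) (cn_ge0 _) h1 h2; rewrite -E.
  have -> : T * T * (2 * T ^+ 2) = 2 * T ^+ 4 by ring.
  by rewrite ler_pM2l.
have thT : cn th <= 2 * T.
  rewrite -(@ler_pXn2r _ 2) ?nnegrE ?cn_ge0 ?mulr_ge0 //.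
  rewrite -cnX tq2 cnM.
  have h1 : cn (A - B) <= 2 * T by apply: le_trans (cnB _ _) _; lra.
  have := ler_pM (cn_ge0 _) (cn_ge0 _) h1 kaT; have := mulr_ge0 T0 T0; rewrite exprMn !expr2; lra.
apply: le_trans (cn_sum _ _ _) _; rewrite big_seq [leRHS]big_seq; apply: ler_sum => p /sD pD.
rewrite cnM ler_wpM2l ?cn_ge0 //.
apply: (@le_trans _ _ (2 * T ^+ (4 * K))); last first.
  by rewrite ler_wpM2l // exprM lerXn2r // nnegrE ?exprn_ge0 // (le_trans _ TM) // exprn_ge0.
have -> : 2 * T ^+ (4 * K) = 2 * T * T ^+ r * T ^+ (D - p.2) * T ^+ p.2.
  by rewrite -!mulrA -!exprD -exprS subnK // -DK addnS addnC.
rewrite !cnM !cnX.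
have pw n x : 0 <= x -> x <= T -> x ^+ n <= T ^+ n by move=> x0 xT; rewrite lerXn2r // nnegrE.
by do 3!(apply: ler_pM; rewrite ?mulr_ge0 ?exprn_ge0 ?cn_ge0 ?pw ?cn_ge0 //).
Qed.
End Values.

Lemma det2 (g : 'M[int]_2) : \det g = g 0 0 * g 1 1 - g 0 1 * g 1 0.
Proof.
rewrite (expand_det_row _ 0) !big_ord_recl big_ord0 addr0 /cofactor !det_mx11 !mxE /=.
rewrite expr0 mul1r expr1 mulN1r mulrN.
by congr (_ * g _ _ - g _ _ * g _ _); apply: val_inj.
Qed.

Lemma form_modular (r D K : nat) s : (D + r.+1 = 4 * K)%N -> all (fun p => p.2 <= D)%N s ->
  modular_form (2 * K) 256 (fun z : C => ev (form r D s) (nome z)).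
Proof.
move=> DK sD; split.
- exact/holomorphic_ev/pb_form.
- move=> g [gD /dvdzP[k gk]] z z0; rewrite /SL2Z /= det2 in gD.
  rewrite /slash -[automorphy g z]/(aut (g 1 0) (g 1 1) z) -[moebius g z]/(mob (g 0 0) (g 0 1) (g 1 0) (g 1 1) z).
  have gz0 := Im_mob z0 gD; have n0 := aut_neq0 z0 (det_cd gD).
  rewrite (ev_form_weight gz0 DK sD) (ev_form_weight z0 DK sD).
  move: gD gk gz0 n0; move: (g 0 0) (g 0 1) (g 1 0) (g 1 1) => a b c d gD gk gz0 n0.
  have z8' : 0 < I (8%:R * z) by apply: Im_natM_gt0.
  have z32 : 0 < I (32%:R * z) by apply: Im_natM_gt0.
  have E8 : 8%:R * mob a b c d z = mob a (8 * b) (4 * (8 * k)) d (8%:R * z).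
    rewrite /mob gk [LHS]mulrA; congr (_ / _); rewrite !intrM; ring.
  have E32 : 32%:R * mob a b c d z = mob a (32 * b) (4 * (2 * k)) d (32%:R * z).
    rewrite /mob gk [LHS]mulrA; congr (_ / _); rewrite !intrM; ring.
  have D8 : a * d - (8 * b) * (4 * (8 * k)) = 1 by rewrite -[RHS]gD gk; ring.
  have D32 : a * d - (32 * b) * (4 * (2 * k)) = 1 by rewrite -[RHS]gD gk; ring.
  have [_ _ G8] := Gamma04_law z8' D8; have [A32 U32 _] := Gamma04_law z32 D32.
  have aE : aut (4 * (2 * k)) d (32%:R * z) = aut c d z by rewrite /aut gk !intrM; ring.
  rewrite E8 E32 A32 U32 G8 aE.
  (* With [c = 256 k], the exponents [gexp] of the eighth root and [32 b d] of [i] are divisible by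
     8 and by 4, so the character is trivial. *)
  rewrite (@z8_mod R _ 0); last first.
    by apply/dvdzP; exists (b * d * (1 + 4 * (8 * k) ^+ 2) + k * (2 * d - a)); rewrite /gexp; ring.
  rewrite (@i_mod R _ 0); last by apply/dvdzP; exists (8 * b * d); ring.
  rewrite !expr0z !mul1r exprMn -[(aut c d z ^+ 2) ^+ K]exprM -mulrA mulKf //.
  by rewrite expf_neq0.
move=> g gD; rewrite /SL2Z /= det2 in gD.
have [M M0 HM] := @cusp_bound R 32 _ _ _ _ isT gD.
pose S := \sum_(p <- s) cn (p.1%:~R : C) * (2 * M ^+ K).
exists 1, S => z z0 z1.
have [HA HB] := HM z z1.
have gz0 := Im_mob z0 gD; have n0 := aut_neq0 z0 (det_cd gD).
rewrite /slash -[automorphy g z]/(aut (g 1 0) (g 1 1) z) -[moebius g z]/(mob (g 0 0) (g 0 1) (g 1 0) (g 1 1) z).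
rewrite normE lecR cnM cnV cnX mulrC ler_pdivrMr ?exprn_gt0 ?cn_gt0 //.
apply: le_trans (form_bound gz0 DK sD HA HB) _.
rewrite /S mulr_suml; apply: ler_sum => p _; rewrite exprMn -exprM.
by rewrite !mulrA.
Qed.
End Final.

Lemma co_Fb N : co Fb N = if N is N'.+1 then (if (8 %| N')%N then (b4_nat (N' %/ 8))%:R else 0) else 0.
Proof.
rewrite Fb.unlock -[X int]expr1 coXnM; case: N => [|N] //=.
by rewrite subn1.
Qed.

Lemma b4_Fb (N : nat) : (b4 ((N%:R - 1) / 8))%:R = co Fb N.
Proof.
rewrite co_Fb /b4; case: N => [|N].
  (* For [N = 0] the argument is [-1/8], where [b4] vanishes. *)
  case: natrP => // -[k E]; exfalso.
  have : (k%:R : rat) < 0 by rewrite -E sub0r; lra.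
  by rewrite ltrn0.
have -> : (N.+1%:R - 1) / 8 = N%:R / 8 :> rat by rewrite -natr1 addrK.
case: ifP => [/natrP[k E]|E].
  have N8 : N = (8 * k)%N.
    by apply/eqP; rewrite -(eqr_nat rat) natrM -E mulrCA mulfV ?mulr1.
  by rewrite E natrK N8 dvdn_mulr // mulKn.
case: ifP => // /dvdnP[k Nk]; move/negP: E; case; apply/natrP; exists k.
by rewrite Nk natrM mulfK.
Qed.

Theorem theorem3p1 (R : realType) (m : nat) (m_prime : prime m)
    (m_ge3 : (3 <= m)%N) :
  modular_forms_mod R (3 * m - 3)%N 256 m
    (fun n : nat => (b4 ((m%:R * n%:R - 1) / 8))%:R).
Proof.
have [r [s [/andP[r0 r4] rm sD E]]] := main_mod m_prime m_ge3.
have modd : odd m by case: (even_prime m_prime) => // m2; rewrite m2 in m_ge3.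
(* The choice [K = 3(m - 1)/2] gives both [D + r = 4K] and the weight [2K = 3m - 3]. *)
pose D := (6 * m - 6 - r)%N; pose K := (3 * m./2)%N.
have mE : m = m./2.*2.+1 by rewrite -[LHS]odd_double_half modd.
have DK : (D + r.-1.+1 = 4 * K)%N by rewrite prednK // /D /K; lia.
have kE : (3 * m - 3 = 2 * K)%N by rewrite /K; lia.
exists (fun z => ev (form r.-1 D s) (nome z)), (co (form r.-1 D s)); split.
- by rewrite kE; apply: form_modular.
- exact/qexpansion_ev/pb_form.
move=> n.
have redE : red m (form r.-1 D s) = Um (red m Fb).
  rewrite E /form (rmorphM _ (tht * _)) (rmorphM _ tht) rmorphXn rmorph_sum; congr (_ * _).
  apply: eq_bigr => p _; rewrite /imon /mon (rmorphM _ (_ * _)) (rmorphM _ p.1%:~R) !rmorphXn rmorph_int.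
  by [].
have := congr1 (fun f => co f n) redE; rewrite /= => ->.
by rewrite -b4_Fb natrM rmorph_nat.
Qed.
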